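(* Let $0\le k\le n-1$, let $\Sigma^n$ be a connected orientable hypersurface properly immersed in $\mathbb{R}^{n+1}$, with chosen unit normal field $\nu$, and let $f=\frac{|x|^2}{4}$. Suppose that the function $\big|(\overline{\nabla}f)^\perp\big|\,|\boldsymbol{H}_{k,f}|$ is bounded on $\Sigma$, that $\sigma_k$ is bounded on $\Sigma$, and that $P_k$ is coercive. Then \[ \int_{\Sigma} e^{-f}\, dv_g < +\infty \] and $\Sigma$ has polynomial volume growth. More precisely, there exist constants $\beta>0$ and $a \geq 0$ such that, for every $r \geq \sqrt{2\beta}$, \[ \operatorname{Vol}(B_r(0) \cap \Sigma) \le C\, r^{\frac{2 a}{\beta}}, \qquad\text{where } C = e^{\frac{\beta}{2}}(2\beta)^{-\frac{a}{\beta}}\int_{\Sigma} e^{-f}\,dv_g . \]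
   Context: Hypersurfaces are smooth, without boundary, with induced metric $g$ and immersion $x:\Sigma^n\to\mathbb{R}^{n+1}$; $x$ also denotes the position vector. $\overline{\nabla}$ is the Levi-Civita connection (and gradient) of $\mathbb{R}^{n+1}$; functions on $\mathbb{R}^{n+1}$ are identified with their pullbacks to $\Sigma$. $(\cdot)^\perp$ denotes the component normal to $\Sigma$. The shape operator is $A(X)=\overline{\nabla}_X\nu$, with eigenvalues (principal curvatures) $\lambda_1,\dots,\lambda_n$. For $1\le k\le n$, $\sigma_k=\sum_{i_1<\cdots<i_k}\lambda_{i_1}\cdots\lambda_{i_k}$, with $\sigma_0=1$ and $\sigma_j=0$ for $j>n$. The Newton transformations are $P_0=I$ and $P_k=\sigma_k I-AP_{k-1}$. A symmetric endomorphism $P$ of $T\Sigma$ is coercive if there is a constant $\delta>0$ with $\langle P(X),X\rangle\ge\delta|X|^2$ for all $X\in T\Sigma$. The weighted $Q_k$-curvature vector is \[ \boldsymbol{H}_{k,f}=\sigma_k(\overline{\nabla}f)^\perp-(k+1)\sigma_{k+1}\nu . \] $\operatorname{Vol}(B_r(0)\cap\Sigma)$ is the volume, in $(\Sigma,g)$, of $\{q\in\Sigma: |x(q)|\le r\}$. Polynomial volume growth means that there are constants $C',d\geq 0$ with $\operatorname{Vol}(B_r(0)\cap\Sigma)\le C'r^d$ for all sufficiently large $r$. *)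

(* Defs.v *)
From HB Require Import structures.
From mathcomp Require Import all_boot all_order all_algebra.
From mathcomp Require Import all_classical all_reals all_analysis.

Set Implicit Arguments.
Unset Strict Implicit.
Unset Printing Implicit Defensive.

Import Order.TTheory GRing.Theory Num.Theory.
Import numFieldNormedType.Exports.

Local Open Scope classical_set_scope.
Local Open Scope ring_scope.

(* The norm `|v| of 'rV[R]_m is the sup norm, hence a separate Euclidean norm.
   Both define the same topology. *)
Definition dot (R : realType) (m : nat) (u v : 'rV[R]_m) : R :=
  \sum_i u 0 i * v 0 i.

Definition enorm (R : realType) (m : nat) (v : 'rV[R]_m) : R :=
  Num.sqrt (dot v v).

Definition gradient (R : realType) (m : nat) (h : 'rV[R]_m -> R)
    (z : 'rV[R]_m) : 'rV[R]_m :=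
  \row_i 'D_(delta_mx 0 i) (h : 'rV[R]_m -> R^o) z.

Fixpoint Ck_on (R : realType) (m : nat) (V : normedModType R)
    (U : set 'rV[R]_m) (j : nat) (F : 'rV[R]_m -> V) : Prop :=
  (forall y, U y -> {for y, continuous F}) /\
  if j is j'.+1 then
    forall i : 'I_m,
      (forall y, U y -> derivable F y (delta_mx 0 i)) /\
      Ck_on U j' (fun y => 'D_(delta_mx 0 i) F y)
  else True.

Definition smooth_on (R : realType) (m : nat) (V : normedModType R)
    (U : set 'rV[R]_m) (F : 'rV[R]_m -> V) : Prop :=
  forall j, Ck_on U j F.

(* Lebesgue integral over R^m of a nonnegative Borel function, computed one
   coordinate at a time (Tonelli). *)
Fixpoint lebesgue_int (R : realType) (m : nat) :
    ('rV[R]_m -> \bar R) -> \bar R :=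
  if m is m'.+1 then
    fun F => (\int[@lebesgue_measure R]_t
                lebesgue_int (fun y : 'rV[R]_m' => F (row_mx t%:M y)))%E
  else fun F => F 0.

(* [coord] and [param] are relevant only on [dom] and [cod] respectively. *)
Record chart (R : realType) (n : nat) (S : topologicalType) := Chart {
  dom : set S;
  cod : set 'rV[R]_n;
  coord : S -> 'rV[R]_n;
  param : 'rV[R]_n -> S;
  dom_open : open dom;
  cod_open : open cod;
  coord_cod : forall p, dom p -> cod (coord p);
  param_dom : forall y, cod y -> dom (param y);
  coordK : forall p, dom p -> param (coord p) = p;
  paramK : forall y, cod y -> coord (param y) = y;
  coord_cts : forall p, dom p -> {for p, continuous coord};
  param_cts : forall y, cod y -> {for y, continuous param} }.

Definition covering (R : realType) (n : nat) (S : topologicalType)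
    (A : set (chart R n S)) : Prop :=
  forall p : S, exists2 c, A c & dom c p.

Definition overlap (R : realType) (n : nat) (S : topologicalType)
    (c1 c2 : chart R n S) : set 'rV[R]_n :=
  cod c1 `&` param c1 @^-1` dom c2.

Definition transition (R : realType) (n : nat) (S : topologicalType)
    (c1 c2 : chart R n S) : 'rV[R]_n -> 'rV[R]_n :=
  coord c2 \o param c1.

Definition smooth_atlas (R : realType) (n : nat) (S : topologicalType)
    (A : set (chart R n S)) : Prop :=
  covering A /\
  forall c1 c2, A c1 -> A c2 -> smooth_on (overlap c1 c2) (transition c1 c2).

Definition smooth_manifold (R : realType) (n : nat) (S : topologicalType)
    (A : set (chart R n S)) : Prop :=
  [/\ hausdorff_space S, @second_countable S & smooth_atlas A].

(* The oriented atlas [B] need not be a subset of [A], only of the maximal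
   atlas that contains [A]. *)
Definition orientable (R : realType) (n : nat) (S : topologicalType)
    (A : set (chart R n S)) : Prop :=
  exists B : set (chart R n S),
    [/\ smooth_atlas (A `|` B), covering B &
        forall c1 c2, B c1 -> B c2 -> forall y, overlap c1 c2 y ->
          0 < \det ('J (transition c1 c2) y)].

Definition smooth_map (R : realType) (n : nat) (S : topologicalType)
    (A : set (chart R n S)) (V : normedModType R) (F : S -> V) : Prop :=
  forall c, A c -> smooth_on (cod c) (F \o param c).

(* The i-th row of the n x (n+1) matrix 'J (x \o param c) y is the coordinate
   tangent vector d_i x. A tangent vector with coordinate row v is, as an
   element of R^(n+1), v *m 'J (x \o param c) y. *)
Definition tangent_basis (R : realType) (n : nat) (S : topologicalType)
    (x : S -> 'rV[R]_n.+1) (c : chart R n S) (y : 'rV[R]_n) :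
    'M[R]_(n, n.+1) :=
  'J (x \o param c) y.

Definition immersion (R : realType) (n : nat) (S : topologicalType)
    (A : set (chart R n S)) (x : S -> 'rV[R]_n.+1) : Prop :=
  smooth_map A x /\
  forall c y, A c -> cod c y -> row_free (tangent_basis x c y).

Definition proper_map (S T : topologicalType) (F : S -> T) : Prop :=
  forall K : set T, compact K -> compact (F @^-1` K).

Definition unit_normal (R : realType) (n : nat) (S : topologicalType)
    (A : set (chart R n S)) (x nu : S -> 'rV[R]_n.+1) : Prop :=
  [/\ smooth_map A nu,
      forall p, enorm (nu p) = 1 &
      forall c y, A c -> cod c y ->
        forall i, dot (row i (tangent_basis x c y)) (nu (param c y)) = 0].

Definition metric (R : realType) (n : nat) (S : topologicalType)
    (x : S -> 'rV[R]_n.+1) (c : chart R n S) (y : 'rV[R]_n) : 'M[R]_n :=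
  \matrix_(i, j) dot (row i (tangent_basis x c y))
                     (row j (tangent_basis x c y)).

Notation borel S := (g_sigma_algebraType (@open S)).

(* dv_g: the unique Borel measure equal to sqrt(det g) dy in every chart. *)
Definition riemannian_volume (R : realType) (n : nat) (S : ptopologicalType)
    (A : set (chart R n S)) (x : S -> 'rV[R]_n.+1)
    (vol : set (borel S) -> \bar R) : Prop :=
  forall (c : chart R n S) (B : set (borel S)),
    A c -> measurable B -> B `<=` dom c ->
    vol B = lebesgue_int (fun y =>
      (\1_(cod c `&` param c @^-1` B) y * Num.sqrt (\det (metric x c y)))%:E).

(* Matrix of the shape operator X |-> D_X nu in the basis (d_i x), acting on
   coordinate rows from the right. Row i holds the coordinates of d_i nu, which
   is tangent, so that multiplying by tangent_basis gives back
   'J (nu \o param c) y. *)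
Definition shape_mx (R : realType) (n : nat) (S : topologicalType)
    (x nu : S -> 'rV[R]_n.+1) (c : chart R n S) (y : 'rV[R]_n) : 'M[R]_n :=
  'J (nu \o param c) y *m pinvmx (tangent_basis x c y).

(* [lam p] lists the eigenvalues of the shape operator at p, with
   multiplicity. *)
Definition principal_curvatures (R : realType) (n : nat) (S : topologicalType)
    (A : set (chart R n S)) (x nu : S -> 'rV[R]_n.+1)
    (lam : S -> 'I_n -> R) : Prop :=
  forall c y, A c -> cod c y ->
    char_poly (shape_mx x nu c y) = \prod_i ('X - (lam (param c y) i)%:P).

Definition sigma (R : realType) (n : nat) (k : nat) (lam : 'I_n -> R) : R :=
  \sum_(I : {set 'I_n} | #|I| == k) \prod_(i in I) lam i.

(* Same convention as shape_mx. The composite "A after P" of operators is the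
   product P *m A of matrices. *)
Fixpoint newton_mx (R : realType) (n : nat) (S : topologicalType)
    (x nu : S -> 'rV[R]_n.+1) (lam : S -> 'I_n -> R) (k : nat)
    (c : chart R n S) (y : 'rV[R]_n) : 'M[R]_n :=
  if k is k'.+1 then
    (sigma k (lam (param c y)))%:M
      - newton_mx x nu lam k' c y *m shape_mx x nu c y
  else 1%:M.

Definition coercive (R : realType) (n : nat) (S : topologicalType)
    (A : set (chart R n S)) (x : S -> 'rV[R]_n.+1)
    (P : chart R n S -> 'rV[R]_n -> 'M[R]_n) : Prop :=
  exists2 delta : R, 0 < delta &
    forall c y, A c -> cod c y -> forall v : 'rV[R]_n,
      delta * enorm (v *m tangent_basis x c y) ^+ 2
        <= dot (v *m P c y *m tangent_basis x c y)
               (v *m tangent_basis x c y).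

Definition normal_part (R : realType) (n : nat) (nu w : 'rV[R]_n) : 'rV[R]_n :=
  dot w nu *: nu.

Definition curvature_vector (R : realType) (n : nat) (S : Type)
    (x nu : S -> 'rV[R]_n.+1) (lam : S -> 'I_n -> R)
    (k : nat) (f : 'rV[R]_n.+1 -> R) (p : S) : 'rV[R]_n.+1 :=
  sigma k (lam p) *: normal_part (nu p) (gradient f (x p))
    - (k.+1%:R * sigma k.+1 (lam p)) *: nu p.

Definition quarter_sqnorm (R : realType) (m : nat) (z : 'rV[R]_m) : R :=
  enorm z ^+ 2 / 4.

Definition ext_ball (R : realType) (n : nat) (S : Type)
    (x : S -> 'rV[R]_n) (r : R) : set S :=
  [set q | enorm (x q) <= r].

Definition polynomial_volume_growth (R : realType) (n : nat)
    (S : ptopologicalType) (x : S -> 'rV[R]_n)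
    (vol : set (borel S) -> \bar R) : Prop :=
  exists C d : R, [/\ 0 <= C, 0 <= d &
    \forall r \near +oo, (vol (ext_ball x r) <= (C * r `^ d)%:E)%E].

(* Main.v *)
Require Import Defs.
From HB Require Import structures.
From mathcomp Require Import all_boot all_order all_algebra.
From mathcomp Require Import all_classical all_reals all_analysis.
From mathcomp Require Import perm measurable_realfun ring lra.

(* Write x/2 = b nu + Y0 with Y0 tangent, so that f = b^2 + |Y0|^2. The vector field Y = P_k Y0 has
   divergence h = (n - k) sigma_k / 2 - b (k + 1) sigma_(k+1). Since |b| |b sigma_k - (k + 1) sigma_(k+1)|
   and sigma_k are bounded and sigma_k >= delta by coercivity, h <= C0 - delta b^2. For a decreasing
   cutoff Phi >= 0 with Phi' <= - theta Phi, 0 <= theta <= 1, the divergence theorem applied to Phi(f) Y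
   and <P_k Y0, Y0> >= delta |Y0|^2 then give
     0 <= int Phi(f) (C0 - delta theta f).
   With Phi(s) = ((1 - s/T)_+)^(2m) and theta = 2m/T, m large, the integrand is negative for f > T/4,
   whence Vol(f <= T/2) <= D Vol(f <= T/4) for all large T. Doubling yields polynomial growth of the
   sublevel sets of f and the integrability of exp(-f). The explicit constant is obtained at the
   scale f = beta/2 from Vol(f <= s) <= exp(s) int exp(-f).

   The divergence of Y is computed without connections: in a chart its flux against sqrt(det g) is a
   combination, with Vandermonde weights in s, of the determinants obtained from the frame
   (nu, d_i x + s d_i nu) by replacing its j-th tangent row by x/2, because the adjugate of I + s A is
   the sum of the s^k P_k. *)

Set Implicit Arguments.
Unset Strict Implicit.
Unset Printing Implicit Defensive.

Import Order.TTheory GRing.Theory Num.Theory.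
Import numFieldNormedType.Exports.

Local Open Scope classical_set_scope.
Local Open Scope ring_scope.

Local Notation coord := Defs.coord.

(** * Differential calculus of several variables *)

(** The bound [theta <= 1] lets one inequality control both parts of [f]: the divergence damps the
    normal part [b^2] with weight [delta], the slope of the cutoff damps the tangent part only with
    weight [delta theta], and weakening the former leaves [delta theta f]. As [m] is fixed by
    [C0 / delta] and [theta = 2m/T], this restricts [T] from below, whence the scale at which
    doubling starts. The determinants are chosen because their divergence pairs second derivatives
    of [x + s nu], symmetric in two indices, with an expression skew in the same indices; this
    cancellation does the work of the Codazzi equations. The sign of [det (nu, d x)] varies with the
    chart, but only its absolute value and quotients by it matter. The volume is prescribed on sets
    only, chart by chart, as an iterated integral whose sections carry no measurability. Integrals
    of continuous functions are recovered by slicing them into horizontal layers, whose superlevel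
    sets have a known volume. *)

Section Calculus.
Context {R : realType}.

Lemma is_derive_line (V W : normedModType R) (F : V -> W) (z v : V) (s : R) :
  derivable F (z + s *: v) v ->
  is_derive s (1 : R) (fun t : R => F (z + t *: v)) ('D_v F (z + s *: v)).
Proof.
move=> dF.
have E : (fun h : R => h^-1 *: (F (z + (h *: (1:R) + s) *: v) - F (z + s *: v)))
  = (fun h : R => h^-1 *: (F (h *: v + (z + s *: v)) - F (z + s *: v))).
  apply/funext => h; congr (_ *: (F _ - _)).
  by rewrite scalerDl [h%:A]mulr1 addrCA.
split; first by rewrite /derivable /= E.
by rewrite /derive /= E.
Qed.

(** The symmetric range of parameters covers both signs of [t] at once, since increments along a
    coordinate axis have no preferred sign. *)
Lemma mean_value_line (V : normedModType R) (F : V -> R) (z v : V) (t : R) :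
  (forall s, `|s| <= `|t| -> derivable F (z + s *: v) v) ->
  exists2 s : R, `|s| <= `|t| & F (z + t *: v) - F z = t * 'D_v F (z + s *: v).
Proof.
move=> dF.
pose g := fun s : R => F (z + s *: v).
have dg s : `|s| <= `|t| -> is_derive s (1 : R) g ('D_v F (z + s *: v)).
  by move=> /dF; exact: is_derive_line.
have cg (a b : R) : `|a| <= `|t| -> `|b| <= `|t| -> {within `[a, b], continuous g}.
  move=> at_ bt; apply: derivable_within_continuous => s.
  rewrite in_itv /= => /andP[as_ sb].
  have st : `|s| <= `|t|.
    rewrite ler_norml; move: at_ bt; rewrite !ler_norml => /andP[? ?] /andP[? ?].
    by apply/andP; split; [apply: le_trans as_|apply: le_trans sb _].
  by have [] := dg _ st.
have [t0|t0] := leP 0 t.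
  have [||s] := @MVT_segment _ g (fun s => 'D_v F (z + s *: v)) 0 t t0.
  - move=> s; rewrite in_itv /= => /andP[s0 st]; apply: dg.
    by rewrite !ger0_norm// ltW.
  - by apply: cg => //; rewrite normr0.
  - rewrite in_itv /= => /andP[s0 st]; rewrite /g scale0r addr0 subr0 mulrC => ->.
    by exists s => //; rewrite !ger0_norm.
have [||s] := @MVT_segment _ g (fun s => 'D_v F (z + s *: v)) t 0 (ltW t0).
- move=> s; rewrite in_itv /= => /andP[s0 st]; apply: dg.
  by rewrite !ltr0_norm// lerN2 ltW.
- by apply: cg => //; rewrite normr0.
- rewrite in_itv /= => /andP[s0 st]; rewrite /g scale0r addr0 sub0r => E.
  exists s; last by rewrite -opprB E mulrN opprK mulrC.
  by rewrite (ltr0_norm t0) ler0_norm // lerN2.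
Qed.

Lemma cvg_sumr (T : Type) (F : set_system T) {FF : Filter F} (I : Type) (r : seq I)
    (P : pred I) (f : I -> T -> R) (a : I -> R) :
  (forall i, P i -> f i t @[t --> F] --> a i) ->
  (\sum_(i <- r | P i) f i t) @[t --> F] --> \sum_(i <- r | P i) a i.
Proof.
move=> fa; elim: r => [|i r IH].
  by rewrite big_nil; under eq_fun do rewrite big_nil; exact: cvg_cst.
rewrite big_cons; under eq_fun do rewrite big_cons.
by have [Pi|Pi] := boolP (P i) => //; apply: cvgD => //; exact: fa.
Qed.

Section ForContinuous.
Context {T : topologicalType}.
Implicit Types (f g : T -> R) (t : T).

Lemma for_continuousD f g t : {for t, continuous f} -> {for t, continuous g} ->
  {for t, continuous (fun s => f s + g s)}.
Proof. by move=> cf cg; exact: (cvgD cf cg). Qed.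

Lemma for_continuousM f g t : {for t, continuous f} -> {for t, continuous g} ->
  {for t, continuous (fun s => f s * g s)}.
Proof. by move=> cf cg; exact: (cvgM cf cg). Qed.

Lemma for_continuousV f t : f t != 0 -> {for t, continuous f} ->
  {for t, continuous (fun s => (f s)^-1)}.
Proof. by move=> ft cf; exact: (cvgV ft cf). Qed.

Lemma for_continuous_sum (I : Type) (r : seq I) (P : pred I) (f : I -> T -> R) t :
  (forall i, P i -> {for t, continuous (f i)}) ->
  {for t, continuous (fun s => \sum_(i <- r | P i) f i s)}.
Proof. exact: cvg_sumr. Qed.

Lemma for_continuous_comp (T' : topologicalType) (h : T -> T') (f : T' -> R) t :
  {for t, continuous h} -> {for h t, continuous f} ->
  {for t, continuous (fun s => f (h s))}.
Proof. by move=> ch cf; exact: (continuous_comp ch cf). Qed.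

Lemma for_continuous_near f g t : (\forall s \near t, f s = g s) ->
  {for t, continuous f} -> {for t, continuous g}.
Proof.
move=> fg; rewrite /prop_for /continuous_at (nbhs_singleton fg).
by apply: cvg_trans; exact: near_eq_cvg.
Qed.

End ForContinuous.

End Calculus.

(** The candidate differential of a function with partial derivatives [g], packaged as a linear map
    for [differentiable_approx]. *)
Definition row_form (R : realType) (n : nat) (g : 'I_n -> R) (v : 'rV[R]_n) : R :=
  \sum_i v 0 i * g i.

Lemma row_form_linear (R : realType) (n : nat) (g : 'I_n -> R) :
  linear (row_form g : 'rV[R]_n -> R^o).
Proof.
move=> a u v; rewrite /row_form scaler_sumr -big_split; apply: eq_bigr => i _.
by rewrite !mxE mulrDl -mulrA.
Qed.

HB.instance Definition _ (R : realType) (n : nat) (g : 'I_n -> R) :=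
  GRing.isLinear.Build R 'rV[R]_n R _ (row_form g) (row_form_linear g).

Lemma differentiable_approx (R : realType) (V W : normedModType R) (F : V -> W)
    (df : {linear V -> W}) (y : V) :
  continuous df ->
  (forall eps, 0 < eps -> \forall h \near 0, `|F (h + y) - F y - df h| <= eps * `|h|) ->
  differentiable F y.
Proof.
move=> cdf H.
have main : F \o shift y = cst (F y) + df +o_ 0 id.
  apply/eqaddoP => _/posnumP[eps]; near=> h.
  rewrite /= -![(_ + _ : _ -> _) _]/(_ + _) -![(- _ : _ -> _) _]/(- _) /= opprD addrA.
  by near: h; exact: H.
by apply/diff_locallyP; rewrite (diff_unique cdf main).
Unshelve. all: by end_near. Qed.

Section Calculus.
Context {R : realType} {n : nat}.
Implicit Types (U : set 'rV[R]_n) (F : 'rV[R]_n -> R).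
Local Notation e i := (delta_mx 0 i : 'rV[R]_n).

Lemma row_form_continuous (g : 'I_n -> R) : continuous (row_form g : 'rV[R]_n -> R).
Proof.
move=> y; apply: for_continuous_sum => i _.
by apply: for_continuousM; [exact: coord_continuous|exact: cst_continuous].
Qed.

Lemma norm_row_coord (h : 'rV[R]_n) i : `|h 0 i| <= `|h|.
Proof. rewrite [leRHS]/Num.Def.normr/= mx_normrE; exact: (le_bigmax _ _ (0, i)). Qed.

(* The partial sums of [h] along the coordinate axes, which join [y] to [y + h]. *)
Definition trunc_row (h : 'rV[R]_n) (k : nat) : 'rV[R]_n :=
  \row_i (h 0 i *+ (i < k)%N).

Lemma trunc_row_ball (h : 'rV[R]_n) (i : 'I_n) (s : R) :
  `|s| <= `|h 0 i| -> `|trunc_row h i + s *: e i| <= `|h|.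
Proof.
move=> sh; rewrite [leLHS]/Num.Def.normr/= mx_normrE (bigmax_le _ (normr_ge0 _))//=.
move=> [a j] _ /=; rewrite !mxE (ord1 a) /=.
have [->|ji] := eqVneq j i.
  by rewrite ltnn mulr0n add0r mulr1 (le_trans sh)// norm_row_coord.
rewrite mulr0 addr0; case: (_ < _)%N; first by rewrite mulr1n norm_row_coord.
by rewrite mulr0n normr0.
Qed.

(** The increment from [y] to [y + h] is split into steps parallel to the axes. On each step the
    mean value theorem gives a partial derivative at a nearby point, and continuity moves it back to
    [y]. *)
Lemma differentiable_partials U F : open U ->
  (forall y, U y -> forall i, derivable F y (e i)) ->
  (forall y, U y -> forall i, {for y, continuous (fun z => 'D_(e i) F z)}) ->
  forall y, U y -> differentiable F y.
Proof.
move=> oU dF cF y Uy.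
pose g i := 'D_(e i) F y.
apply: (@differentiable_approx _ _ _ _ (row_form g)).
  exact: row_form_continuous.
move=> _/posnumP[eps].
  (* Each of the [n] axis steps gets this share of the error; the successor keeps the quotient
     meaningful for [n = 0]. *)
  have e1 : 0 < eps%:num / n.+1%:R by rewrite divr_gt0.
  have : \forall z \near y, U z /\ forall i, `|g i - 'D_(e i) F z| <= eps%:num / n.+1%:R.
    apply: filterI; first exact: open_nbhs_nbhs.
    apply: (@filter_forall _ _ (fun i z => `|g i - 'D_(e i) F z| <= eps%:num / n.+1%:R) (nbhs y)) => i.
    by have /cvgrPdist_le /(_ _ e1) := cF y Uy i.
  move=> /nbhs_ballP[d /= d0 dU].
  near=> h.
  have hd : `|h| < d.
    near: h; apply/nbhs_ballP; exists d => //= z.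
    by rewrite -ball_normE /= sub0r normrN.
  have inB z : `|z| <= `|h| -> ball y d (y + z).
    by move=> zh; rewrite -ball_normE /= opprD addNKr normrN (le_lt_trans zh).
  have step (i : 'I_n) : `|F (y + trunc_row h i.+1) - F (y + trunc_row h i) - h 0 i * g i|
      <= eps%:num / n.+1%:R * `|h|.
    have E : trunc_row h i.+1 = trunc_row h i + h 0 i *: e i.
      apply/rowP => j; rewrite !mxE eqxx /= ltnS.
      have [->|ji] := eqVneq j i; first by rewrite leqnn ltnn mulr1n mulr0n add0r mulr1.
      by rewrite mulr0 addr0 ltn_neqAle val_eqE ji.
    have [|s sh] := @mean_value_line R _ F (y + trunc_row h i) (e i) (h 0 i).
      move=> s sh; apply: dF; apply: (dU _ _).1; rewrite -addrA; apply: inB.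
      exact: trunc_row_ball.
    rewrite E addrA => ->; rewrite -mulrBr normrM mulrC.
    rewrite ler_pM // ?norm_row_coord // distrC.
    by apply: (dU _ _).2; rewrite -addrA; apply: inB; apply: trunc_row_ball.
  have tele : F (h + y) - F y - row_form g h =
      \sum_(i < n) (F (y + trunc_row h i.+1) - F (y + trunc_row h i) - h 0 i * g i).
    rewrite sumrB; congr (_ - _).
    rewrite (eq_bigr (fun i : 'I_n => (fun k => F (y + trunc_row h k)) i.+1
       - (fun k => F (y + trunc_row h k)) i)) //.
    rewrite -(big_mkord xpredT (fun k => F (y + trunc_row h k.+1) - F (y + trunc_row h k))).
    rewrite telescope_sumr //.
    have -> : trunc_row h n = h by apply/rowP => j; rewrite mxE ltn_ord.
    have -> : trunc_row h 0 = 0 by apply/rowP => j; rewrite !mxE.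
    by rewrite addr0 (addrC h).
  rewrite tele.
  apply: le_trans (ler_norm_sum _ _ _) _.
  apply: le_trans (ler_sum _ (fun i _ => step i)) _.
  rewrite sumr_const card_ord -[leLHS]mulr_natr mulrAC ler_wpM2r // -mulrA ler_piMr //.
  by rewrite mulrC ler_pdivrMr // mul1r ler_nat.
Unshelve. all: by end_near. Qed.

End Calculus.

Section DirectionalDerivatives.
Context {R : realType} {V : normedModType R}.

Lemma is_derive_translate (W : normedModType R) (F : V -> W) (w y v : V) :
  derivable F (y + w) v -> is_derive y v (fun z => F (z + w)) ('D_v F (y + w)).
Proof.
move=> dF.
have E : (fun h : R => h^-1 *: (F (h *: v + y + w) - F (y + w)))
       = (fun h : R => h^-1 *: (F (h *: v + (y + w)) - F (y + w))).
  by apply/funext => h; rewrite addrA.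
split; first by rewrite /derivable /= E.
by rewrite /derive /= E.
Qed.

(** Two uses of the mean value theorem: along [u] for [z |-> F (z + h v) - F z], then along [v] for
    the derivative of [F] in direction [u]. *)
Lemma second_difference (F : V -> R) (y u v : V) (h : R) :
  (forall s t, `|s| <= `|h| -> `|t| <= `|h| ->
     derivable F (y + s *: u + t *: v) u /\
     derivable ('D_u F) (y + s *: u + t *: v) v) ->
  exists s t : R, [/\ `|s| <= `|h|, `|t| <= `|h| &
    F (y + h *: u + h *: v) - F (y + h *: u) - (F (y + h *: v) - F y)
    = h * (h * 'D_v ('D_u F) (y + s *: u + t *: v))].
Proof.
move=> dF.
pose g z := F (z + h *: v) - F z.
have dg s : `|s| <= `|h| ->
    is_derive (y + s *: u) u g ('D_u F (y + s *: u + h *: v) - 'D_u F (y + s *: u)).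
  move=> sh; apply: is_deriveB.
    by apply: is_derive_translate; have [] := dF s h sh (lexx _).
  apply: derivableP; have [|+ _] := dF s 0 sh _; first by rewrite normr0.
  by rewrite scale0r addr0.
have [|s sh] := @mean_value_line R _ g y u h; first by move=> s sh; have [] := dg s sh.
rewrite {1}/g {1}/g => ->; rewrite (@derive_val _ _ _ _ _ _ _ (dg s sh)).
have [|t th ->] := @mean_value_line R _ ('D_u F) (y + s *: u) v h.
  by move=> t th; have [] := dF s t sh th.
by exists s, t; split.
Qed.

(** The second difference is symmetric in [u] and [v], so the two mixed derivatives agree at some
    pair of points near [y]. If they differed at [y], continuity within a third of the gap would
    contradict this. *)
Lemma derive_commute (F : V -> R) (y u v : V) :
  (\forall z \near y, [/\ derivable F z u, derivable F z v,
     derivable ('D_u F) z v & derivable ('D_v F) z u]) ->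
  {for y, continuous (fun z => 'D_v ('D_u F) z)} ->
  {for y, continuous (fun z => 'D_u ('D_v F) z)} ->
  'D_v ('D_u F) y = 'D_u ('D_v F) y.
Proof.
have aux (a b c d : R) : a - b - (c - d) = a - c - (b - d) by ring.
have final (a b p q : R) : 0 < `|a - b| -> p = q -> `|a - p| <= `|a - b| / 3 ->
    `|b - q| <= `|a - b| / 3 -> False.
  move=> ab0 <- Ha Hb; have : `|a - b| <= `|a - b| / 3 + `|a - b| / 3.
    by rewrite -{1}(subrKA p a) (le_trans (ler_normD _ _)) // lerD // distrC.
  by move: ab0; move: (`|a - b|); clear; move=> x; lra.
move=> dF cvu cuv; apply/eqP/negPn/negP => ab.
set a := 'D_v _ y in ab; set b := 'D_u _ y in ab.
pose e := `|a - b| / 3.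
have ab0 : 0 < `|a - b| by rewrite normr_gt0 subr_eq0.
have e0 : 0 < e by rewrite divr_gt0.
have : \forall z \near y, [/\ derivable F z u, derivable F z v,
     derivable ('D_u F) z v & derivable ('D_v F) z u] /\
     (`|a - 'D_v ('D_u F) z| <= e /\ `|b - 'D_u ('D_v F) z| <= e).
  apply: filterI => //; apply: filterI.
    by have /cvgrPdist_le /(_ _ e0) := cvu.
  by have /cvgrPdist_le /(_ _ e0) := cuv.
move=> /nbhs_ballP[d /= d0 dU].
have [h [h0 hd]] : exists h : R, 0 < h /\ h * (`|u| + `|v|) < d.
  have N0 : 0 < `|u| + `|v| + 1 by rewrite ltr_wpDl // addr_ge0.
  exists (d / (`|u| + `|v| + 1)); split; first by rewrite divr_gt0.
  by rewrite mulrAC ltr_pdivrMr // ltr_pM2l // ltrDl.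
have inB s t : `|s| <= `|h| -> `|t| <= `|h| -> ball y d (y + s *: u + t *: v).
  rewrite (gtr0_norm h0) => sh th; rewrite -ball_normE /= -addrA opprD addNKr normrN.
  apply: le_lt_trans (ler_normD _ _) _; rewrite !normrZ.
  by apply: le_lt_trans hd; rewrite mulrDr lerD // ler_wpM2r.
have [|s [t [sh th E1]]] := @second_difference F y u v h.
  by move=> s t sh th; have [[]] := dU _ (inB s t sh th).
have inB' s' t' : `|s'| <= `|h| -> `|t'| <= `|h| -> ball y d (y + s' *: v + t' *: u).
  by move=> ? ?; rewrite addrAC; apply: inB.
have [|s' [t' [sh' th' E2]]] := @second_difference F y v u h.
  by move=> s' t' sh' th'; have [[]] := dU _ (inB' s' t' sh' th').
have : 'D_v ('D_u F) (y + s *: u + t *: v) = 'D_u ('D_v F) (y + s' *: v + t' *: u).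
  have hn0 : h != 0 by rewrite gt_eqF.
  apply: (mulfI hn0); apply: (mulfI hn0).
  refine (etrans (esym E1) _).
  refine (etrans _ E2).
  rewrite (addrAC y (h *: v) (h *: u)).
  exact: aux.
have [_ [Ha _]] := dU _ (inB s t sh th).
have [_ [_ Hb]] := dU _ (inB' s' t' sh' th').
by move=> E; exact: (final _ _ _ _ ab0 E Ha Hb).
Qed.


End DirectionalDerivatives.

Section DeriveProducts.
Context {R : realType} {V : normedModType R}.

Lemma is_derive_bigprod (m : nat) (f : 'I_m -> V -> R) (f' : 'I_m -> R) (y v : V) :
  (forall i, is_derive y v (f i) (f' i)) ->
  is_derive y v (fun z => \prod_i f i z)
    (\sum_i \prod_j (if j == i then f' j else f j y)).
Proof.
elim: m f f' => [|m IH] f f' df.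
  rewrite big_ord0; under eq_fun do rewrite big_ord0; exact: is_derive_cst.
under eq_fun do rewrite big_ord_recl.
have H : is_derive y v (fun z => f ord0 z * \prod_(i < m) f (lift ord0 i) z) _ :=
  is_deriveM (df ord0) (IH _ _ (fun i => df (lift ord0 i))).
apply: (is_derive_eq H); rewrite big_ord_recl addrC /=; congr (_ + _).
  by rewrite big_ord_recl eqxx -[LHS]/(_ * _) mulrC; congr (_ * _).
rewrite -[LHS]/(_ * _) mulr_sumr; apply: eq_bigr => i _.
by rewrite [RHS]big_ord_recl.
Qed.

Lemma is_derive_bigsum (I : Type) (r : seq I) (P : pred I) (f : I -> V -> R)
    (f' : I -> R) (y v : V) :
  (forall i, is_derive y v (f i) (f' i)) ->
  is_derive y v (fun z => \sum_(i <- r | P i) f i z) (\sum_(i <- r | P i) f' i).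
Proof.
move=> df; elim: r => [|i r IH].
  rewrite big_nil; under eq_fun do rewrite big_nil; exact: is_derive_cst.
rewrite big_cons; under eq_fun do rewrite big_cons.
by have [Pi|Pi] := boolP (P i) => //; exact: is_deriveD.
Qed.

Definition row_set (m p : nat) (i : 'I_m) (a : 'rV[R]_p) (M : 'M[R]_(m, p)) : 'M[R]_(m, p) :=
  \matrix_(k, l) (if k == i then a 0 l else M k l).

Lemma is_derive_det (m : nat) (M : V -> 'M[R]_m) (M' : 'M[R]_m) (y v : V) :
  (forall i j, is_derive y v (fun z => M z i j) (M' i j)) ->
  is_derive y v (fun z => \det (M z)) (\sum_i \det (row_set i (row i M') (M y))).
Proof.
move=> dM.
have H : is_derive y v (fun z => \sum_(s : 'S_m) (-1) ^+ s * \prod_i M z i (s i))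
   (\sum_(s : 'S_m) (-1) ^+ s * \sum_i \prod_j (if j == i then M' j (s j) else M y j (s j))).
  apply: is_derive_bigsum => s; apply: is_deriveZ.
  by apply: (is_derive_bigprod (f := fun i z => M z i (s i)) (f' := fun i => M' i (s i))).
apply: (is_derive_eq H); rewrite [RHS]exchange_big /=; apply: eq_bigr => s _.
rewrite big_distrr /=; apply: eq_bigr => i _; congr (_ * _).
by apply: eq_bigr => j _; rewrite !mxE; have [->|] := eqVneq j i.
Qed.

End DeriveProducts.

Section C1At.
Context {R : realType} {n : nat}.
Implicit Types (F G : 'rV[R]_n -> R) (y v : 'rV[R]_n).
Local Notation e i := (delta_mx 0 i : 'rV[R]_n).

(** Continuity is asked of each directional derivative, at [y] only, rather than of the differential
    as a map; no topology on linear maps is needed, and sums, products and composites stay in the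
    class. *)
Definition C1_at F y : Prop :=
  (\forall z \near y, differentiable F z) /\
  forall v, {for y, continuous ('D_v F)}.

Lemma C1_at_diff F y : C1_at F y -> differentiable F y.
Proof. by case=> /nbhs_singleton. Qed.

Lemma C1_at_derivable F y v : C1_at F y -> derivable F y v.
Proof. by move=> /C1_at_diff /diff_derivable. Qed.

Lemma C1_at_continuous F y : C1_at F y -> {for y, continuous F}.
Proof. by move=> /C1_at_diff /differentiable_continuous. Qed.

Lemma near_differentiable_C1 F (F' : 'rV[R]_n -> 'rV[R]_n -> R) y :
  (\forall z \near y, differentiable F z /\ forall v, 'D_v F z = F' v z) ->
  (forall v, {for y, continuous (F' v)}) -> C1_at F y.
Proof.
move=> dF cF'; split; first by apply: filterS dF => z [].
move=> v; by apply: for_continuous_near (cF' v); apply: filterS dF => z [_ /(_ v)].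
Qed.

(** Agreement near [y] is agreement near every point close to [y], so differentiability transfers on
    a whole neighbourhood. This serves functions that have a C1 formula only locally, such as
    extensions by zero. *)
Lemma C1_at_near F G y : (\forall z \near y, F z = G z) -> C1_at G y -> C1_at F y.
Proof.
move=> /nbhs_interior FG [dG cG].
apply: (@near_differentiable_C1 _ (fun v => 'D_v G)) => //.
near=> z.
have FGz : \forall t \near z, F t = G t by near: z.
have dGz : differentiable G z by near: z.
split; last by move=> v; exact: near_eq_derive.
have := dGz => /diff_locallyP [cd E].
apply: (differentiable_approx cd) => eps eps0.
have /eqaddoP /(_ _ eps0) H := E.
have FGz0 : \forall h \near (0 : 'rV[R]_n), F (h + z) = G (h + z).
  by have := FGz; rewrite (near_shift 0) /= subr0; apply: filterS.
near=> h.
rewrite (near FGz0 h) // (nbhs_singleton FGz).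
have : `|((G \o shift z) - (cst (G z) + 'd G z)) h| <= eps * `|h| by near: h.
by rewrite /= -![(_ + _ : _ -> _) _]/(_ + _) -![(- _ : _ -> _) _]/(- _) /= opprD addrA.
Unshelve. all: by end_near. Qed.

Lemma derive_partials F y v : differentiable F y ->
  'D_v F y = \sum_i v 0 i * 'D_(e i) F y.
Proof.
move=> dF; rewrite deriveE // [in LHS](row_sum_delta v) linear_sum /=.
by apply: eq_bigr => i _; rewrite linearZ /= -deriveE.
Qed.

Lemma C1_at_partials (U : set 'rV[R]_n) F : open U ->
  (forall y, U y -> forall i, derivable F y (e i)) ->
  (forall y, U y -> forall i, {for y, continuous (fun z => 'D_(e i) F z)}) ->
  forall y, U y -> C1_at F y.
Proof.
move=> oU dF cF y Uy.
apply: (@near_differentiable_C1 _ (fun v z => \sum_i v 0 i * 'D_(e i) F z)).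
  have : \forall z \near y, U z by exact: open_nbhs_nbhs.
  apply: filterS => z Uz; have dz := differentiable_partials oU dF cF Uz.
  by split => // v; exact: derive_partials.
move=> v; apply: for_continuous_sum => i _.
by apply: for_continuousM; [exact: cst_continuous|exact: cF].
Qed.

Lemma C1_at_cst (a : R) y : C1_at (fun=> a) y.
Proof.
apply: (@near_differentiable_C1 _ (fun _ _ => 0)).
  by apply: filterE => z; split => // v; exact: derive_cst.
by move=> v; exact: cst_continuous.
Qed.

Lemma C1_atD F G y : C1_at F y -> C1_at G y -> C1_at (fun z => F z + G z) y.
Proof.
move=> [dF cF] [dG cG].
apply: (@near_differentiable_C1 _ (fun v z => 'D_v F z + 'D_v G z)).
  apply: filterS2 dF dG => z dF dG; split; first exact: differentiableD.
  by move=> v; apply: deriveD; exact: diff_derivable.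
by move=> v; exact: for_continuousD.
Qed.

Lemma C1_atM F G y : C1_at F y -> C1_at G y -> C1_at (fun z => F z * G z) y.
Proof.
move=> CF CG; have [dF cF] := CF; have [dG cG] := CG.
apply: (@near_differentiable_C1 _ (fun v z => F z * 'D_v G z + G z * 'D_v F z)).
  apply: filterS2 dF dG => z dF dG; split; first exact: differentiableM.
  by move=> v; rewrite deriveM //; exact: diff_derivable.
by move=> v; apply: for_continuousD; apply: for_continuousM => //; exact: C1_at_continuous.
Qed.

Lemma C1_at_sum (I : Type) (r : seq I) (P : pred I) (F : I -> 'rV[R]_n -> R) y :
  (forall i, P i -> C1_at (F i) y) -> C1_at (fun z => \sum_(i <- r | P i) F i z) y.
Proof.
move=> CF; elim: r => [|i r IH].
  by under eq_fun do rewrite big_nil; exact: C1_at_cst.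
under eq_fun do rewrite big_cons.
by have [Pi|//] := boolP (P i); apply: C1_atD; [exact: CF|exact: IH].
Qed.

Lemma C1_at_prod (I : Type) (r : seq I) (P : pred I) (F : I -> 'rV[R]_n -> R) y :
  (forall i, P i -> C1_at (F i) y) -> C1_at (fun z => \prod_(i <- r | P i) F i z) y.
Proof.
move=> CF; elim: r => [|i r IH].
  by under eq_fun do rewrite big_nil; exact: C1_at_cst.
under eq_fun do rewrite big_cons.
by have [Pi|//] := boolP (P i); apply: C1_atM; [exact: CF|exact: IH].
Qed.

Lemma C1_at_det (m : nat) (M : 'rV[R]_n -> 'M[R]_m) y :
  (forall i j, C1_at (fun z => M z i j) y) -> C1_at (fun z => \det (M z)) y.
Proof.
move=> CM; apply: C1_at_sum => s _; apply: C1_atM; first exact: C1_at_cst.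
by apply: C1_at_prod => i _; exact: CM.
Qed.

Lemma C1_at_coord i y : C1_at (fun z => z 0 i) y.
Proof.
apply: (@near_differentiable_C1 _ (fun v _ => v 0 i)).
  apply: filterE => z; split; first exact: differentiable_coord.
  move=> v; have := derive_mx (@derivable_id R _ z v).
  by rewrite derive_id => /rowP /(_ i); rewrite mxE.
by move=> v; exact: cst_continuous.
Qed.

Lemma C1_at_comp1 (phi : R -> R) F y :
  (forall t, derivable phi t 1) -> continuous (derive1 phi) -> C1_at F y ->
  C1_at (fun z => phi (F z)) y.
Proof.
move=> dphi cphi CF; have [dF cF] := CF.
apply: (@near_differentiable_C1 _ (fun v z => (derive1 phi) (F z) * 'D_v F z)).
  apply: filterS dF => z dF; have dp : differentiable phi (F z) by exact/derivable1_diffP.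
  have dc : differentiable (phi \o F) z by exact: differentiable_comp.
  split=> // v; rewrite (deriveE v dc) diff_comp //= -(deriveE v dF).
  by rewrite -[X in 'd _ _ X = _]mulr1 [LHS]linearZ /= derive1E' // mulrC.
move=> v; apply: for_continuousM; last exact: cF.
exact: (for_continuous_comp (C1_at_continuous CF) (cphi _)).
Qed.

Lemma derive_comp1 (phi : R -> R) F y v : derivable phi (F y) 1 -> differentiable F y ->
  'D_v (fun z => phi (F z)) y = (derive1 phi) (F y) * 'D_v F y.
Proof.
move=> /derivable1_diffP dp dF.
have dc : differentiable (phi \o F) y by exact: differentiable_comp.
rewrite (deriveE v dc) diff_comp //= -(deriveE v dF).
by rewrite -[X in 'd _ _ X = _]mulr1 [LHS]linearZ /= derive1E' // mulrC.
Qed.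

End C1At.

Section C1Comp.
Context {R : realType} {n m : nat}.
Implicit Types (G : 'rV[R]_n -> 'rV[R]_m) (H : 'rV[R]_m -> R) (y v : 'rV[R]_n).

Lemma differentiable_row G y :
  (forall i, differentiable (fun z => G z 0 i : R) y) -> differentiable G y.
Proof.
move=> dG.
have -> : G = \sum_(i < m) (fun z => G z 0 i *: (delta_mx 0 i : 'rV[R]_m)).
  by apply/funext => z; rewrite fct_sumE -row_sum_delta.
by apply: differentiable_sum => i; apply: differentiableZl.
Qed.

Lemma derive_row G y v : differentiable G y ->
  'D_v G y = \row_i 'D_v (fun z => G z 0 i) y.
Proof.
move=> /diff_derivable dG; rewrite derive_mx //.
by apply/rowP => i; rewrite !mxE.
Qed.

Lemma derive_comp G H y v : differentiable G y -> differentiable H (G y) ->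
  'D_v (fun z => H (G z)) y = 'D_('D_v G y) H (G y).
Proof.
move=> dG dH; have dc : differentiable (H \o G) y by exact: differentiable_comp.
by rewrite (deriveE v dc) diff_comp //= -(deriveE v dG) (deriveE _ dH).
Qed.

Lemma C1_at_comp G H y : (forall i, C1_at (fun z => G z 0 i) y) -> C1_at H (G y) ->
  C1_at (fun z => H (G z)) y.
Proof.
move=> CG [dH cH].
have dG : differentiable G y.
  by apply: differentiable_row => i; exact: C1_at_diff.
have dGn : \forall z \near y, differentiable G z.
  have : \forall z \near y, forall i, differentiable (fun z => G z 0 i : R) z.
    apply: (@filter_forall _ _ (fun i z => differentiable (fun z => G z 0 i : R) z) (nbhs y)) => i.
    by have [] := CG i.
  by apply: filterS => z; exact: differentiable_row.
apply: (@near_differentiable_C1 _ _ _ (fun v z => \sum_i ('D_v (fun t => G t 0 i) z)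
    * 'D_(delta_mx 0 i) H (G z))).
  have := differentiable_continuous dG dH.
  apply: filterS2 dGn => z dGz dHz.
  split; first exact: differentiable_comp.
  move=> v; rewrite derive_comp // derive_partials // derive_row //.
  by apply: eq_bigr => i _; rewrite mxE.
move=> v; apply: for_continuous_sum => i _; apply: for_continuousM.
  by have [_] := CG i; exact.
exact: (for_continuous_comp (differentiable_continuous dG) (cH _)).
Qed.

End C1Comp.

(** * Iterated integrals *)

Section CompactSupport.
Context {R : realType}.
Local Notation mu := (@lebesgue_measure R).

(* Sections of an iterated integral are not known to be measurable where this is used. *)
Lemma le_integral_nonmeasurable (f g : R -> \bar R) : (forall t, 0 <= f t)%E ->
  (forall t, f t <= g t)%E -> (\int[mu]_t f t <= \int[mu]_t g t)%E.
Proof.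
move=> f0 fg; have g0 t : (0 <= g t)%E by apply: le_trans (fg t).
rewrite !ge0_integralTE //; apply: le_ereal_sup => _ [h hf <-].
by exists h => // t; apply: le_trans (fg t); exact: hf.
Qed.

Definition csupp (V : normedModType R) (r : R) (F : V -> R) : Prop :=
  continuous F /\ forall y, r < `|y| -> F y = 0.

Lemma integral_csupp (r : R) (g : R -> R) : csupp (V := R) r g ->
  (\int[mu]_t (g t)%:E = \int[mu]_(t in `[(- r)%R, r]) (g t)%:E)%E.
Proof.
move=> [cg g0]; rewrite [RHS]integral_mkcond; apply: eq_integral => t _.
rewrite /patch; case: ifPn => // /negP; rewrite inE /= in_itv /= => tr.
by rewrite g0 // ltNge; apply/negP => /ler_normlP[? ?]; apply: tr; apply/andP; split; lra.
Qed.

Lemma integrable_csupp (r : R) (g : R -> R) : csupp (V := R) r g ->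
  mu.-integrable setT (EFin \o g).
Proof.
move=> [cg g0]; have mI : measurable (`[- r, r]%classic : set (measurableTypeR R)) by exact: measurable_itv.
have : mu.-integrable setT ((EFin \o g) \_ `[- r, r]).
  apply: (@integrable_mkcond _ (measurableTypeR R) R mu _ (EFin \o g) mI).1.
  apply: continuous_compact_integrable.
    exact: segment_compact.
  exact: continuous_subspaceT.
apply: eq_integrable => // t _; rewrite /patch; case: ifPn => // /negP.
rewrite inE /= in_itv /= => tr.
by rewrite g0 // ltNge; apply/negP => /ler_normlP[? ?]; apply: tr; apply/andP; split; lra.
Qed.

Lemma Rintegral_csupp_bound (r M : R) (g : R -> R) : 0 <= r -> csupp (V := R) r g ->
  (forall t, `|g t| <= M) -> `|\int[mu]_t g t| <= 2 * r * M.
Proof.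
move=> r0 cg gM; have ig := integrable_csupp cg.
have mI : measurable (`[- r, r]%classic : set (measurableTypeR R)) by exact: measurable_itv.
have igI : mu.-integrable `[- r, r] (EFin \o g) by apply: integrableS ig.
have -> : \int[mu]_t g t = \int[mu]_(t in `[- r, r]) g t.
  by rewrite /Rintegral (integral_csupp cg).
apply: le_trans (le_normr_Rintegral _ igI) _ => //.
have iM : mu.-integrable `[- r, r] (EFin \o cst M).
  apply: continuous_compact_integrable; first exact: segment_compact.
  by apply: continuous_subspaceT => t; exact: cvg_cst.
apply: le_trans (le_Rintegral (f2 := cst M) _ _ iM _) _ => //.
  exact: integrable_norm.
rewrite Rintegral_cst //.
rewrite [X in fine X](_ : _ = (if - r < r then (r - - r)%:E else 0%E)); last first.
  by have := @lebesgue_measure_itv R `[- r, r]; rewrite /= lte_fin -EFinB.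
case: ifPn => [_|]; first by rewrite /= opprK; lra.
rewrite -leNgt /= mulr0 => rr; have -> : r = 0 by lra.
by rewrite mulr0 mul0r.
Qed.

Lemma csupp_uniform (m : nat) (r : R) (F : 'rV[R]_m -> R) (eps : R) :
  csupp r F -> 0 < eps ->
  exists2 d : R, 0 < d & forall y z, `|y - z| < d -> `|F y - F z| <= eps.
Proof.
move=> [cF F0] e0.
(* With margin 2 and [d < 1], a point outside the box and any point within [d] of it both have norm
   above [r], where [F] vanishes. *)
pose K := [set v : 'rV[R]_m | forall i, `[- (`|r| + 2), `|r| + 2]%classic (v ord0 i)].
have cK : compact K.
  by apply: (@rV_compact R m (fun=> `[- (`|r| + 2), `|r| + 2]%classic)) => i; exact: segment_compact.
have e2 : 0 < eps / 2 by rewrite divr_gt0.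
have H := (compact_near_coveringP K).1 cK R (at_right (0 : R))
  (fun d y => forall z, `|y - z| < d -> `|F y - F z| <= eps) _.
have : \forall d \near (0 : R)^'+, K `<=` (fun y => forall z, `|y - z| < d -> `|F y - F z| <= eps).
  apply: H => y _.
  have /cvgrPdist_le/(_ _ e2) /nbhs_ballP[d /= d0 dF] := cF y.
  exists (ball y (d / 2), [set x | 0 < x < d / 2]).
    split => /=; first by apply: nbhsx_ballx; rewrite divr_gt0.
    near=> x; apply/andP; split; near: x; first exact: nbhs_right_gt.
    by apply: nbhs_right_lt; rewrite divr_gt0.
  move=> [y' x] /= [yy' /andP[x0 xd]] z y'z.
  have By' : ball y d y'.
    by move: yy'; rewrite -ball_normE /= => /lt_le_trans; apply; lra.
  have Bz : ball y d z.
    move: yy'; rewrite -ball_normE /= => yy'.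
    rewrite -(subrKA y' y) (le_lt_trans (ler_normD _ _)) //.
    by rewrite (splitr d) ltrD // (lt_trans y'z).
  have := dF _ By'; have := dF _ Bz => /= h1 h2.
  rewrite -(subrKA (F y) (F y')) (le_trans (ler_normD _ _)) // (splitr eps) lerD //.
  by rewrite distrC.
move=> HK.
have [d [d0 d1 dK]] : exists d, [/\ 0 < d, d < 1 &
   K `<=` (fun y => forall z, `|y - z| < d -> `|F y - F z| <= eps)].
  have : \forall d \near (0 : R)^'+, [/\ 0 < d, d < 1 &
   K `<=` (fun y => forall z, `|y - z| < d -> `|F y - F z| <= eps)].
    near=> d; split; near: d => //; first exact: nbhs_right_gt.
    exact: nbhs_right_lt.
  by move=> /filter_ex.
exists d => // y z yz.
have [yK|yK] := pselect (K y); first exact: dK.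
have [i yi] : exists i, `|r| + 2 < `|y 0 i|.
  apply/not_existsP => Hn; apply: yK => i /=; rewrite in_itv /=.
  by have /negP := Hn i; rewrite -leNgt ler_norml.
have yr : `|r| + 2 < `|y| by apply: lt_le_trans yi _; exact: norm_row_coord.
have zr : `|r| + 1 < `|z|.
  have : `|y| <= `|y - z| + `|z| by rewrite -{1}(subrK z y) ler_normD.
  by move: yz yr d1; lra.
have rr := ler_norm r.
by rewrite !F0 ?subrr ?normr0 ?ltW //; lra.
Unshelve. all: by end_near. Qed.

End CompactSupport.

Definition cons_row (R : realType) (m : nat) (t : R) (y : 'rV[R]_m) : 'rV[R]_m.+1 :=
  row_mx t%:M y.

(** Real-valued counterpart of [lebesgue_int]. For continuous functions of compact support it agrees
    with the latter and is linear, which the extended version does not provide. *)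
Fixpoint rint (R : realType) (m : nat) : ('rV[R]_m -> R) -> R :=
  if m is m'.+1 then
    fun F => \int[@lebesgue_measure R]_t rint (fun y : 'rV[R]_m' => F (cons_row t y))
  else fun F => F 0.

Lemma for_continuous_dist (R : realType) (V : normedModType R) (F : V -> R) (y : V) :
  {for y, continuous F} <-> forall eps, 0 < eps ->
    exists2 d : R, 0 < d & forall z, `|y - z| < d -> `|F y - F z| <= eps.
Proof.
split=> [cF eps e0|H].
  have /cvgrPdist_le/(_ _ e0)/nbhs_ballP[d /= d0 dF] := cF.
  by exists d => // z yz; apply: dF; rewrite -ball_normE.
apply/cvgrPdist_le => eps /H[d d0 dF].
by apply/nbhs_ballP; exists d => //= z; rewrite -ball_normE; exact: dF.
Qed.

Section IteratedIntegral.
Context {R : realType}.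
Local Notation mu := (@lebesgue_measure R).

Lemma cons_row0 (m : nat) (t : R) (y : 'rV[R]_m) : cons_row t y 0 ord0 = t.
Proof.
have -> : ord0 = lshift m (ord0 : 'I_1) by apply: val_inj.
by rewrite (row_mxEl t%:M y) mxE eqxx mulr1n.
Qed.

Lemma cons_rowS (m : nat) (t : R) (y : 'rV[R]_m) i : cons_row t y 0 (lift ord0 i) = y 0 i.
Proof.
have -> : lift ord0 i = rshift 1 i by apply: val_inj.
by rewrite (row_mxEr t%:M y).
Qed.

Lemma cons_rowD (m : nat) (s t : R) (y z : 'rV[R]_m) :
  cons_row s y + cons_row t z = cons_row (s + t) (y + z).
Proof.
by apply/rowP => i; rewrite [LHS]mxE; case: (unliftP ord0 i) => [j|] ->;
  rewrite ?cons_rowS ?cons_row0 // !mxE.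
Qed.

Lemma cons_rowZ (m : nat) (s t : R) (y : 'rV[R]_m) :
  s *: cons_row t y = cons_row (s * t) (s *: y).
Proof.
by apply/rowP => i; rewrite [LHS]mxE; case: (unliftP ord0 i) => [j|] ->;
  rewrite ?cons_rowS ?cons_row0 // !mxE.
Qed.

Lemma cons_rowB (m : nat) (s t : R) (y z : 'rV[R]_m) :
  cons_row s y - cons_row t z = cons_row (s - t) (y - z).
Proof. by rewrite -scaleN1r cons_rowZ cons_rowD mulN1r scaleN1r. Qed.

Lemma cons_row_delta0 (m : nat) : cons_row 1 0 = delta_mx 0 ord0 :> 'rV[R]_m.+1.
Proof.
by apply/rowP => i; case: (unliftP ord0 i) => [j|] ->;
  rewrite ?cons_rowS ?cons_row0 // !mxE.
Qed.

Lemma cons_row_deltaS (m : nat) (j : 'I_m) :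
  cons_row 0 (delta_mx 0 j) = delta_mx 0 (lift ord0 j) :> 'rV[R]_m.+1.
Proof.
by apply/rowP => i; case: (unliftP ord0 i) => [k|] ->;
  rewrite ?cons_rowS ?cons_row0 // !mxE.
Qed.

Lemma norm_cons_row (m : nat) (t : R) (y : 'rV[R]_m) : `|cons_row t y| <= `|t| + `|y|.
Proof.
rewrite [leLHS]/Num.Def.normr/= mx_normrE (bigmax_le _ (addr_ge0 _ _))//=.
move=> [a j] _ /=; rewrite (ord1 a); case: (unliftP ord0 j) => [k|] ->.
  by rewrite cons_rowS ler_wpDl // norm_row_coord.
by rewrite cons_row0 ler_wpDr.
Qed.

Lemma norm_cons_row_ge0 (m : nat) (t : R) (y : 'rV[R]_m) : `|t| <= `|cons_row t y|.
Proof. by rewrite -{1}(cons_row0 t y) norm_row_coord. Qed.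

Lemma norm_cons_row_geS (m : nat) (t : R) (y : 'rV[R]_m) : `|y| <= `|cons_row t y|.
Proof.
rewrite [leLHS]/Num.Def.normr/= mx_normrE (bigmax_le _ (normr_ge0 _))//=.
by move=> [a j] _ /=; rewrite (ord1 a) -(cons_rowS t) norm_row_coord.
Qed.

Lemma csupp_slice (m : nat) (r : R) (F : 'rV[R]_m.+1 -> R) (t : R) : csupp r F ->
  csupp r (fun y : 'rV[R]_m => F (cons_row t y)).
Proof.
move=> [cF F0]; split; last first.
  by move=> y ry; apply: F0; apply: lt_le_trans ry _; exact: norm_cons_row_geS.
move=> y; apply/for_continuous_dist => eps e0.
have [d d0 dF] := (for_continuous_dist _ _).1 (cF (cons_row t y)) _ e0.
exists d => // z yz; apply: dF; rewrite cons_rowB subrr.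
by apply: le_lt_trans (norm_cons_row _ _) _; rewrite normr0 add0r.
Qed.

Lemma csuppZD (V : normedModType R) (r a b : R) (F G : V -> R) :
  csupp r F -> csupp r G -> csupp r (fun y => a * F y + b * G y).
Proof.
move=> [cF F0] [cG G0]; split; last by move=> y ry; rewrite F0 // G0 // !mulr0 addr0.
by move=> y; apply: cvgD; apply: cvgM; [exact: cvg_cst|exact: cF|exact: cvg_cst|exact: cG].
Qed.

(** Stated as a predicate of the dimension, like [rint_bounded]: in dimension [m.+1] the slices are
    integrable only once both are known in dimension [m], so the two go through one induction. *)
Definition rint_linear (m : nat) : Prop :=
  forall (r a b : R) (F G : 'rV[R]_m -> R), csupp r F -> csupp r G ->
  rint (fun y => a * F y + b * G y) = a * rint F + b * rint G.

Definition rint_bounded (m : nat) : Prop :=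
  forall (r M : R) (F : 'rV[R]_m -> R), 0 <= r -> csupp r F ->
  (forall y, `|F y| <= M) -> `|rint F| <= (2 * r) ^+ m * M.

Lemma rintB_bound (m : nat) (r M : R) (F G : 'rV[R]_m -> R) :
  rint_linear m -> rint_bounded m -> 0 <= r -> csupp r F -> csupp r G ->
  (forall y, `|F y - G y| <= M) -> `|rint F - rint G| <= (2 * r) ^+ m * M.
Proof.
move=> lin bd r0 cF cG FG.
have -> : rint F - rint G = rint (fun y => 1 * F y + -1 * G y).
  by rewrite (lin _ _ _ _ _ cF cG) mul1r mulN1r.
by apply: bd => // [|y]; [exact: csuppZD|rewrite mul1r mulN1r].
Qed.

Lemma csupp_rint_slice (m : nat) (r : R) (F : 'rV[R]_m.+1 -> R) :
  rint_linear m -> rint_bounded m -> 0 <= r -> csupp r F ->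
  csupp (V := R) r (fun t => rint (fun y => F (cons_row t y))).
Proof.
move=> lin bd r0 cF; split; last first.
  move=> t rt; have F0 y : F (cons_row t y) = 0.
    by apply: (cF.2); apply: lt_le_trans rt _; exact: norm_cons_row_ge0.
  apply/eqP; rewrite -normr_le0; apply: le_trans (bd r 0 _ r0 (csupp_slice t cF) _) _.
    by move=> y; rewrite F0 normr0.
  by rewrite mulr0.
move=> t; apply/(for_continuous_dist (V := R)) => eps e0.
(* The added 1 keeps the divisor positive when [r = 0]. *)
have C0 : 0 < (2 * r) ^+ m + 1 by rewrite ltr_wpDl // exprn_ge0 // mulr_ge0.
have [d d0 dF] := csupp_uniform cF (divr_gt0 e0 C0).
exists d => // s ts.
apply: le_trans (rintB_bound lin bd r0 (csupp_slice t cF) (csupp_slice s cF) _) _.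
  move=> y; apply: dF; rewrite cons_rowB subrr.
  by apply: le_lt_trans (norm_cons_row _ _) _; rewrite normr0 addr0.
rewrite mulrA ler_pdivrMr // mulrC ler_wpM2l ?ltW // ltrDl //.
Qed.

Lemma rint_linear_bounded (m : nat) : rint_linear m /\ rint_bounded m.
Proof.
elim: m => [|m [lin bd]]; first by split=> // r M F r0 cF FM /=; rewrite expr0 mul1r.
split.
  move=> r a b F G cF0 cG0 /=.
  (* The radius in [rint_linear] is arbitrary, while slicing needs a nonnegative one. *)
  pose r' := Num.max r 0.
  have wid (H : 'rV[R]_m.+1 -> R) : csupp r H -> csupp r' H.
    move=> [cH H0]; split => // y; rewrite /r' gt_max => /andP[ry _]; exact: H0.
  have r0 : 0 <= r' by rewrite le_max lexx orbT.
  have {}cF0 := wid _ cF0; have {}cG0 := wid _ cG0.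
  have iF := integrable_csupp (csupp_rint_slice lin bd r0 cF0).
  have iG := integrable_csupp (csupp_rint_slice lin bd r0 cG0).
  under eq_Rintegral do rewrite (lin _ _ _ _ _ (csupp_slice _ cF0) (csupp_slice _ cG0)).
  rewrite RintegralD //.
  - by rewrite !RintegralZl.
  - exact: (@integrableZl _ _ _ mu _ _ _ _ iF).
  - exact: (@integrableZl _ _ _ mu _ _ _ _ iG).
move=> r M F r0 cF FM /=; rewrite exprS -mulrA.
apply: Rintegral_csupp_bound => //; first exact: csupp_rint_slice.
by move=> t; apply: bd => //; exact: csupp_slice.
Qed.

End IteratedIntegral.

Section IteratedIntegral.
Context {R : realType}.
Local Notation mu := (@lebesgue_measure R).
Local Notation e j := (delta_mx 0 j).

Lemma csupp_widen (V : normedModType R) (r r' : R) (F : V -> R) : r <= r' ->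
  csupp r F -> csupp r' F.
Proof. by move=> rr' [cF F0]; split => // y r'y; apply: F0; apply: le_lt_trans r'y. Qed.

Lemma rintZD (m : nat) (r a b : R) (F G : 'rV[R]_m -> R) : csupp r F -> csupp r G ->
  rint (fun y => a * F y + b * G y) = a * rint F + b * rint G.
Proof. exact: (rint_linear_bounded m).1. Qed.

Lemma csupp_rint (m : nat) (r : R) (F : 'rV[R]_m.+1 -> R) : 0 <= r -> csupp r F ->
  csupp (V := R) r (fun t => rint (fun y => F (cons_row t y))).
Proof. by have [? ?] := @rint_linear_bounded R m; exact: csupp_rint_slice. Qed.

Lemma lebesgue_int_rint (m : nat) (r : R) (F : 'rV[R]_m -> R) : 0 <= r -> csupp r F ->
  lebesgue_int (fun y => (F y)%:E) = (rint F)%:E.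
Proof.
move=> r0; elim: m F => [//|m IH] F cF /=.
transitivity (\int[mu]_t (rint (fun y => F (cons_row t y)))%:E)%E.
  by apply: eq_integral => t _; rewrite IH //; exact: csupp_slice.
rewrite /Rintegral fineK //; apply: integrable_fin_num => //.
exact: integrable_csupp (csupp_rint r0 cF).
Qed.

Lemma lebesgue_int_ge0 (m : nat) (F : 'rV[R]_m -> \bar R) : (forall y, 0 <= F y)%E ->
  (0 <= lebesgue_int F)%E.
Proof.
elim: m F => [|m IH] F F0 //=; apply: integral_ge0 => t _.
by apply: IH => y; exact: F0.
Qed.

Lemma le_lebesgue_int (m : nat) (F G : 'rV[R]_m -> \bar R) :
  (forall y, 0 <= F y)%E -> (forall y, F y <= G y)%E ->
  (lebesgue_int F <= lebesgue_int G)%E.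
Proof.
elim: m F G => [|m IH] F G F0 FG //=; apply: le_integral_nonmeasurable => t.
  by apply: lebesgue_int_ge0 => y; exact: F0.
by apply: IH => y; [exact: F0|exact: FG].
Qed.

Lemma rint_ge0 (m : nat) (r : R) (F : 'rV[R]_m -> R) : 0 <= r -> csupp r F ->
  (forall y, 0 <= F y) -> 0 <= rint F.
Proof.
move=> r0 cF F0; rewrite -lee_fin -(lebesgue_int_rint r0 cF).
by apply: lebesgue_int_ge0 => y; rewrite lee_fin.
Qed.

Lemma C1_at_slice (m : nat) (F : 'rV[R]_m.+1 -> R) (t : R) (y : 'rV[R]_m) :
  C1_at F (cons_row t y) -> C1_at (fun z => F (cons_row t z)) y.
Proof.
move=> CF; apply: (@C1_at_comp R m m.+1 (fun z => cons_row t z)) => // i.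
case: (unliftP ord0 i) => [k|] ->.
  by under eq_fun do rewrite cons_rowS; exact: C1_at_coord.
by under eq_fun do rewrite cons_row0; exact: C1_at_cst.
Qed.

Lemma csupp_derive (m : nat) (r : R) (F : 'rV[R]_m -> R) (v : 'rV[R]_m) :
  csupp r F -> (forall y, C1_at F y) -> csupp r ('D_v F).
Proof.
move=> [_ F0] CF; split; first by move=> y; have [_] := CF y; exact.
move=> y ry; rewrite (@near_eq_derive _ _ _ _ (cst 0)) ?derive_cst //.
apply/nbhs_ballP; exists (`|y| - r); first by rewrite /= subr_gt0.
move=> z; rewrite -ball_normE /= => yz; apply: F0.
have : `|y| <= `|y - z| + `|z| by rewrite -{1}(subrK z y) ler_normD.
by move: yz; lra.
Qed.

Lemma derive_slice (m : nat) (F : 'rV[R]_m.+1 -> R) (t : R) (y v : 'rV[R]_m) :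
  'D_v (fun z => F (cons_row t z)) y = 'D_(cons_row 0 v) F (cons_row t y).
Proof.
have E : (fun h : R => h^-1 *: (F (cons_row t (h *: v + y)) - F (cons_row t y))) =
    (fun h : R => h^-1 *: (F (h *: cons_row 0 v + cons_row t y) - F (cons_row t y))).
  by apply/funext => h; rewrite cons_rowZ cons_rowD mulr0 add0r.
by rewrite /derive /= E.
Qed.

(** By the mean value theorem the difference quotient of each slice is a partial derivative at a
    shifted point; uniform continuity makes the shift harmless for all [y] simultaneously. *)
Lemma is_derive_rint (m : nat) (r : R) (F : 'rV[R]_m.+1 -> R) (t : R) : 0 <= r ->
  csupp r F -> (forall y, C1_at F y) ->
  is_derive t (1 : R) (fun s => rint (fun y => F (cons_row s y)))
    (rint (fun y => 'D_(e ord0) F (cons_row t y))).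
Proof.
move=> r0 cF CF; set g := fun s => _.
have cD := csupp_derive (e ord0) cF CF.
have [lin bd] := @rint_linear_bounded R m.
have key : h^-1 *: (g (h *: (1 : R) + t) - g t) @[h --> 0^'] -->
    rint (fun y => 'D_(e ord0) F (cons_row t y)).
  apply/cvgrPdist_le => eps e0.
  have C0 : 0 < (2 * r) ^+ m + 1 by rewrite ltr_wpDl // exprn_ge0 // mulr_ge0.
  have [d d0 dF] := csupp_uniform cD (divr_gt0 e0 C0).
  near=> h.
  have h0 : h != 0 by near: h; exact: nbhs_dnbhs_neq.
  have hd : `|h| < d by near: h; exact: dnbhs0_lt.
  rewrite [h *: 1]mulr1 /g.
  have -> : h^-1 *: (rint (fun y => F (cons_row (h + t) y)) - rint (fun y => F (cons_row t y)))
    = rint (fun y => h^-1 * F (cons_row (h + t) y) + - h^-1 * F (cons_row t y)).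
    by rewrite (lin _ _ _ _ _ (csupp_slice _ cF) (csupp_slice _ cF)) mulNr -mulrBr.
  apply: le_trans (rintB_bound lin bd r0 (csupp_slice t cD)
     (csuppZD _ _ (csupp_slice _ cF) (csupp_slice _ cF)) _) _.
    move=> y.
    have [|s sh E] := @mean_value_line R _ F (cons_row t y) (e ord0) h.
      by move=> s _; exact: C1_at_derivable.
    have -> : h^-1 * F (cons_row (h + t) y) + - h^-1 * F (cons_row t y) =
        'D_(e ord0) F (cons_row t y + s *: e ord0).
      rewrite mulNr -mulrBr -[cons_row (h + t) y](_ : cons_row t y + h *: e ord0 = _).
        by rewrite E mulKf.
      by rewrite -cons_row_delta0 cons_rowZ cons_rowD scaler0 addr0 mulr1 addrC.
    apply: dF; rewrite opprD addNKr normrN -cons_row_delta0 cons_rowZ scaler0 mulr1.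
    by apply: le_lt_trans (norm_cons_row _ _) _; rewrite normr0 addr0 (le_lt_trans sh).
  by rewrite mulrA ler_pdivrMr // mulrC ler_wpM2l ?ltW // ltrDl.
split; first by apply/cvg_ex; exists (rint (fun y => 'D_(e ord0) F (cons_row t y))).
exact/cvg_lim.
Unshelve. all: by end_near. Qed.

(** A derivative in an inner variable is handled by induction on slices. For the outermost variable
    the inner integral is a C1 function of [t] with compact support, and the fundamental theorem of
    calculus applies. *)
Lemma rint_derive (m : nat) (r : R) (F : 'rV[R]_m -> R) (j : 'I_m) : 0 <= r ->
  csupp r F -> (forall y, C1_at F y) -> rint ('D_(e j) F) = 0.
Proof.
move=> r0; elim: m F j => [|m IH] F j cF CF; first by case: j.
rewrite /=; case: (unliftP ord0 j) => [k|] ->.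
  rewrite (@eq_Rintegral _ _ _ _ _ (cst 0)) ?Rintegral_cst ?mul0r //.
  move=> t _ /=; rewrite -(IH (fun y => F (cons_row t y)) k); last first.
  - by move=> y; exact: C1_at_slice.
  - exact: csupp_slice.
  by congr rint; apply/funext => y; rewrite derive_slice cons_row_deltaS.
have cD := csupp_derive (e ord0) cF CF.
set g := fun t => rint (fun y => F (cons_row t y)).
set g' := fun t => rint _.
have dg t : is_derive t (1 : R) g (g' t) := is_derive_rint t r0 cF CF.
have cg := csupp_rint r0 cF : csupp (V := R) r g.
(* The radius is enlarged because [csupp] yields vanishing strictly outside [r] only, and the
   primitive must vanish at the endpoints. *)
have cg' : csupp (V := R) (r + 1) g'.
  by apply: csupp_widen (csupp_rint r0 cD); rewrite lerDl.
rewrite /Rintegral (integral_csupp cg').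
have r1 : - (r + 1) < r + 1 by lra.
rewrite (@continuous_FTC2 _ g' g _ _ r1).
- rewrite (cg.2 (r + 1)) ?(cg.2 (- (r + 1))) ?subee //.
    by rewrite normrN ger0_norm ?addr_ge0 // ltrDl.
  by rewrite ger0_norm ?addr_ge0 // ltrDl.
- by apply: continuous_subspaceT; exact: cg'.1.
- split.
  + by move=> t _; have [] := dg t.
  + by apply: cvg_at_right_filter; exact: cg.1.
  + by apply: cvg_at_left_filter; exact: cg.1.
- by move=> t _; rewrite derive1E; exact: derive_val.
Qed.

End IteratedIntegral.

(** * Newton transformations and the flux in a chart *)

Section RowSet.
Context {R : realType}.

Lemma row_set_mul (m n p : nat) (i : 'I_m) (a : 'rV[R]_n) (C : 'M[R]_(m, n))
    (M : 'M[R]_(n, p)) :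
  row_set i (a *m M) (C *m M) = row_set i a C *m M.
Proof.
apply/matrixP => k l; rewrite !mxE; case: ifP => ki.
  by apply: eq_bigr => j _; rewrite mxE ki.
by apply: eq_bigr => j _; rewrite mxE ki.
Qed.

Lemma det_row_set (m : nat) (i : 'I_m) (a : 'rV[R]_m) (M : 'M[R]_m) :
  \det (row_set i a M) = (a *m \adj M) 0 i.
Proof.
rewrite (expand_det_row _ i) mxE; apply: eq_bigr => j _; rewrite !mxE eqxx; congr (_ * _).
rewrite /cofactor; congr (_ * \det _); apply/matrixP => k l; rewrite !mxE.
by rewrite eq_sym (negbTE (neq_lift i k)).
Qed.

Lemma row_setC (m p : nat) (i j : 'I_m) (a b : 'rV[R]_p) (M : 'M[R]_(m, p)) : i != j ->
  row_set i a (row_set j b M) = row_set j b (row_set i a M).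
Proof.
move=> ij; apply/matrixP => k l; rewrite !mxE.
by have [->|//] := eqVneq k i; rewrite (negbTE ij).
Qed.

Lemma det_row_set_swap (m : nat) (i j : 'I_m) (a b : 'rV[R]_m) (M : 'M[R]_m) : i != j ->
  \det (row_set i a (row_set j b M)) = - \det (row_set i b (row_set j a M)).
Proof.
move=> ij.
have -> : row_set i a (row_set j b M) = xrow i j (row_set i b (row_set j a M)).
  apply/matrixP => k l; rewrite !mxE; case: tpermP => [->|->|/eqP ki /eqP kj].
  - by rewrite eqxx eq_sym (negbTE ij) eqxx.
  - by rewrite eq_sym (negbTE ij) !eqxx.
  - by rewrite (negbTE ki) (negbTE kj).
by rewrite xrowE det_mulmx det_perm odd_tperm ij expr1 mulN1r.
Qed.

Lemma col_mx_row0 (m p : nat) (u : 'rV[R]_p) (T : 'M[R]_(m, p)) l :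
  (col_mx u T : 'M[R]_(m.+1, p)) ord0 l = u 0 l.
Proof.
have -> : ord0 = lshift m (ord0 : 'I_1) by apply: val_inj.
exact: (col_mxEu u T).
Qed.

Lemma col_mx_rowS (m p : nat) (u : 'rV[R]_p) (T : 'M[R]_(m, p)) i l :
  (col_mx u T : 'M[R]_(m.+1, p)) (lift ord0 i) l = T i l.
Proof.
have -> : lift ord0 i = rshift 1 i by apply: val_inj.
exact: (col_mxEd u T).
Qed.

Lemma row_set_col_mx (m p : nat) (j : 'I_m) (a u : 'rV[R]_p) (T : 'M[R]_(m, p)) :
  row_set (lift ord0 j) a (col_mx u T : 'M[R]_(m.+1, p)) = col_mx u (row_set j a T).
Proof.
apply/matrixP => k l; rewrite [LHS]mxE; case: (unliftP ord0 k) => [i|] ->.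
  by rewrite (inj_eq lift_inj) !col_mx_rowS mxE.
by rewrite /= !col_mx_row0.
Qed.

Lemma row_set0_col_mx (m p : nat) (a u : 'rV[R]_p) (T : 'M[R]_(m, p)) :
  row_set ord0 a (col_mx u T : 'M[R]_(m.+1, p)) = col_mx a T.
Proof.
apply/matrixP => k l; rewrite [LHS]mxE; case: (unliftP ord0 k) => [i|] ->.
  by rewrite /= !col_mx_rowS.
by rewrite eqxx !col_mx_row0.
Qed.

Lemma tr_mul_adj (m : nat) (A M : 'M[R]_m) :
  \tr (A *m \adj M) = \sum_j \det (row_set j (row j A) M).
Proof.
apply: eq_bigr => j _; rewrite det_row_set -row_mul.
by rewrite [in RHS]mxE.
Qed.

End RowSet.

Section Frame.
Context {R : realType} {n : nat}.
Variables (u : 'rV[R]_n.+1) (T : 'M[R]_(n, n.+1)).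
Local Notation M0 := (col_mx u T : 'M[R]_n.+1).

Lemma det_frame_rows (b : 'cV[R]_n) (C : 'M[R]_n) :
  \det (col_mx u (b *m u + C *m T) : 'M[R]_n.+1) = \det C * \det M0.
Proof.
have -> : (col_mx u (b *m u + C *m T) : 'M[R]_n.+1) =
    (block_mx 1%:M 0 b C : 'M[R]_n.+1) *m M0.
  by rewrite (mul_block_col 1%:M 0 b C u T) mul1mx mul0mx addr0.
by rewrite det_mulmx (det_lblock (1%:M : 'M[R]_1) b C) det1 mul1r.
Qed.

(** The part along [u] is a multiple of the first row and drops out; the remaining row replacement
    takes place in the coefficient matrix [C]. *)
Lemma det_frame_set (j : 'I_n) (v : 'rV[R]_n) (b : R) (C : 'M[R]_n) :
  \det (row_set (lift ord0 j) (b *: u + v *m T) (col_mx u (C *m T) : 'M[R]_n.+1)) =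
  (v *m \adj C) 0 j * \det M0.
Proof.
rewrite row_set_col_mx.
have -> : row_set j (b *: u + v *m T) (C *m T) =
    (b *: delta_mx j 0 : 'cV[R]_n) *m u + row_set j v C *m T.
  rewrite -row_set_mul -scalemxAl; apply/matrixP => k l.
  rewrite !mxE big_ord1 !mxE eqxx andbT.
  by case: ifP => kj; rewrite ?mul1r ?mul0r ?mulr0 ?add0r.
by rewrite det_frame_rows det_row_set.
Qed.

Lemma sum_det_frame (A C : 'M[R]_n) :
  \sum_j \det (row_set (lift ord0 j) (row j (A *m T)) (col_mx u (C *m T) : 'M[R]_n.+1)) =
  \tr (A *m \adj C) * \det M0.
Proof.
rewrite mulr_suml; apply: eq_bigr => j _.
have := det_frame_set j (row j A) 0 C; rewrite scale0r add0r row_mul => ->.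
by rewrite -row_mul mxE.
Qed.

(** Exchanging the two replaced rows brings [b u + v T] to the top. There [v T] contributes nothing,
    since all [n.+1] rows would then lie in the span of the [n] rows of [T]; only [b u] survives,
    with the sign of the exchange. *)
Lemma sum_det_frame_swap (A C : 'M[R]_n) (v : 'rV[R]_n) (b : R) :
  \sum_j \det (row_set ord0 (row j (A *m T))
     (row_set (lift ord0 j) (b *: u + v *m T) (col_mx u (C *m T) : 'M[R]_n.+1))) =
  - b * \tr (A *m \adj C) * \det M0.
Proof.
rewrite -mulrA -sum_det_frame mulr_sumr; apply: eq_bigr => j _.
rewrite det_row_set_swap // mulNr; congr (- _).
rewrite row_set_col_mx row_set0_col_mx.
rewrite row_mul row_set_mul.
set W := row_set _ _ _.
have L (w : 'rV[R]_n.+1) : \det (col_mx w (W *m T) : 'M[R]_n.+1) =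
    (w *m \adj (col_mx u (W *m T) : 'M[R]_n.+1)) 0 ord0.
  by rewrite -det_row_set row_set0_col_mx.
rewrite L mulmxDl -scalemxAl mxE [X in X + _]mxE -!L -[RHS]addr0; congr (_ + _).
have -> : (col_mx (v *m T) (W *m T) : 'M[R]_n.+1) =
   (block_mx (0 : 'M[R]_1) v 0 W : 'M[R]_n.+1) *m M0.
  by rewrite (mul_block_col (0 : 'M[R]_1) v 0 W u T) !mul0mx !add0r.
by rewrite det_mulmx (det_ublock (0 : 'M[R]_1) v W) det_mx11 mxE mul0r mul0r.
Qed.

End Frame.

(** The recursion of [newton_mx] for a bare matrix and arbitrary scalars, which keeps the algebra
    free of charts. *)
Fixpoint newton (R : realType) (n : nat) (B : 'M[R]_n) (s : nat -> R) (k : nat) : 'M[R]_n :=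
  if k is k'.+1 then (s k)%:M - newton B s k' *m B else 1%:M.

Section Newton.
Context {R : realType}.

Lemma poly_eq_horner (p q : {poly R}) : (forall t, p.[t] = q.[t]) -> p = q.
Proof.
move=> pq; apply/eqP; rewrite -subr_eq0; apply/negPn/negP => pq0.
pose rs : seq R := [seq m%:R | m <- iota 0 (size (p - q))].
have := max_poly_roots pq0 (_ : all (root (p - q)) rs) (_ : uniq rs).
rewrite size_map size_iota ltnn => H; suff : false by []; apply: H.
  by apply/allP => t _; rewrite /root hornerD hornerN pq subrr.
by rewrite map_inj_uniq ?iota_uniq // => a b /eqP; rewrite eqr_nat => /eqP.
Qed.

(** The weights are a column of the inverse Vandermonde matrix. The nodes are distinct because the
    characteristic is zero, and [0 ^+ 0 = 1] covers the node 0. *)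
Lemma vandermonde_weights (n : nat) (k : 'I_n) :
  exists c : 'I_n -> R, forall l : 'I_n, \sum_i c i * i%:R ^+ l = (l == k)%:R.
Proof.
pose a : 'rV[R]_n := \row_i i%:R.
have uV : Vandermonde n a \in unitmx.
  rewrite unitmxE unitfE det_Vandermonde; apply/prodf_neq0 => i _; apply/prodf_neq0 => j ij.
  by rewrite !mxE subr_eq0 eqr_nat gtn_eqF.
pose c := invmx (Vandermonde n a) *m delta_mx k (0 : 'I_1).
exists (fun i => c i 0) => l.
have := congr1 (fun M : 'cV_n => M l 0) (mulKVmx uV (delta_mx k (0 : 'I_1))).
rewrite -/c mxE [RHS]mxE eqxx andbT => <-.
by apply: eq_bigr => i _; rewrite !mxE mulrC.
Qed.

Lemma prod_1D_sigma (n : nat) (lam : 'I_n -> R) (t : R) :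
  \prod_i (1 + t * lam i) = \sum_(k < n.+1) sigma k lam * t ^+ k.
Proof.
under eq_bigr do rewrite addrC.
rewrite bigA_distr /=.
rewrite (partition_big (fun J : {set 'I_n} => inord #|J| : 'I_n.+1) xpredT) //=.
apply: eq_bigr => k _; rewrite /sigma mulr_suml.
have cardlt (J : {set 'I_n}) : (#|J| < n.+1)%N by rewrite ltnS -[X in (_ <= X)%N]card_ord max_card.
rewrite (eq_bigl (fun J : {set 'I_n} => #|J| == k)); last first.
  by move=> J; rewrite -val_eqE /= inordK.
apply: eq_bigr => J /eqP <-.
rewrite (bigID (mem J)) /= [X in _ * X]big1 ?mulr1; last by move=> i /negbTE ->.
rewrite (eq_bigr (fun i => lam i * t)); last by move=> i ->; rewrite mulrC.
by rewrite big_split /= prodr_const.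
Qed.

Lemma sigma0 (n : nat) (lam : 'I_n -> R) : sigma 0 lam = 1.
Proof.
rewrite /sigma (eq_bigl (pred1 (finset.set0 : {set 'I_n}))) => [|J]; last by rewrite /= cards_eq0.
by rewrite big_pred1_eq big_set0.
Qed.

Lemma size_det_leq (m : nat) (M : 'M[{poly R}]_m) :
  (forall i j, size (M i j) <= 2)%N -> (size (\det M) <= m.+1)%N.
Proof.
move=> sM; apply: leq_trans (size_sum _ _ _) _; apply/bigmax_leqP => p _.
suff H : (size (\prod_i M i (p i))%R <= m.+1)%N.
  by rewrite mulr_sign; case: ifP => _; rewrite ?size_polyN.
apply: leq_trans (size_poly_prod_leq _ _) _; rewrite leq_subLR.
rewrite (eq_card (B := 'I_m)) // card_ord addnS ltnS addnn -mul2n.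
rewrite -[X in (_ <= 2 * X)%N]card_ord -sum1_card big_distrr /=.
by apply: leq_sum => i _; rewrite muln1.
Qed.

Lemma size_linear_leq (a : nat) (b : R) : (size (a%:R + 'X * b%:P : {poly R})%R <= 2)%N.
Proof.
apply/leq_sizeP => j j2; rewrite coefD coefXM coefMn coef1 coefC.
by case: j j2 => [|[|j]] //= _; rewrite mul0rn addr0.
Qed.

Section Shape.
Context {n : nat}.
Variables (B : 'M[R]_n) (lam : 'I_n -> R).
Hypothesis cpB : char_poly B = \prod_i ('X - (lam i)%:P).
Local Notation s := (fun k => sigma k lam).

(** For [t != 0] this is the characteristic polynomial at [- t^-1], rescaled by [(- t) ^+ n]. *)
Lemma det_1D_shape (t : R) : \det (1%:M + t *: B) = \sum_(k < n.+1) sigma k lam * t ^+ k.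
Proof.
rewrite -prod_1D_sigma; have [->|t0] := eqVneq t 0.
  by rewrite scale0r addr0 det1 big1 // => i _; rewrite mul0r addr0.
have E : \det ((- t^-1)%:M - B) = \prod_i (- t^-1 - lam i).
  have := congr1 (fun p : {poly R} => p.[- t^-1]) cpB.
  rewrite horner_prod; under eq_bigr do rewrite hornerXsubC.
  move=> <-; rewrite /char_poly -horner_evalE -det_map_mx; congr (\det _).
  apply/matrixP => i j; rewrite !mxE /= /horner_eval.
  by rewrite hornerD hornerN hornerMn hornerX hornerC.
have -> : 1%:M + t *: B = (- t) *: ((- t^-1)%:M - B).
  rewrite scalerBr scale_scalar_mx mulrNN mulfV // scaleNr opprK //.
rewrite detZ E -[X in _ ^+ X]card_ord -prodr_const -big_split /=.
by apply: eq_bigr => i _; rewrite mulrBr mulrNN mulfV // mulNr opprK.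
Qed.

Let N : 'M[{poly R}]_n := 1%:M + 'X *: map_mx polyC B.

Lemma horner_shape_pencil (t : R) : map_mx (horner_eval t) N = 1%:M + t *: B.
Proof.
apply/matrixP => i j; rewrite !mxE /horner_eval !hornerE.
by rewrite hornerMn hornerE.
Qed.

Lemma det_shape_pencil : \det N = \poly_(k < n.+1) s k.
Proof.
apply: poly_eq_horner => t; rewrite horner_poly -det_1D_shape -horner_shape_pencil.
by rewrite det_map_mx.
Qed.

Let Q (k : nat) : 'M[R]_n := map_mx (coefp k) (\adj N).

Lemma sigma_gt (k : nat) : (n < k)%N -> s k = 0.
Proof.
move=> nk; rewrite /sigma big_pred0 // => J; apply/negbTE; rewrite neq_ltn.
by rewrite (leq_ltn_trans _ nk) // -[X in (_ <= X)%N]card_ord max_card.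
Qed.

(** Comparing coefficients of [X^l] in [\adj N *m N = (\det N)%:M] gives [Q l + Q (l - 1) B = s l],
    which is the Newton recursion. *)
Lemma adj_shape_pencil_coef (k : nat) : Q k = newton B s k.
Proof.
have E : \adj N + 'X *: (\adj N *m map_mx polyC B) = (\det N)%:M.
  by rewrite -mul_adj_mx /N mulmxDr mulmx1 scalemxAr.
have cE l i j : (\adj N i j)`_l + (if l is l'.+1 then (Q l' *m B) i j else 0) = s l *+ (i == j).
  have := congr1 (fun M : 'M[{poly R}]_n => (M i j)`_l) E.
  rewrite det_shape_pencil !mxE coefD coefXM coefMn coef_poly ltnS => H.
  (* Beyond degree [n] the truncated polynomial has coefficient zero, and [s l] vanishes too. *)
  have -> : s l *+ (i == j) = (if (l <= n)%N then s l else 0) *+ (i == j).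
    by case: leqP => // /sigma_gt ->.
  rewrite -H; congr (_ + _); case: l {H} => [//|l]; rewrite /= coef_sum mxE.
  by apply: eq_bigr => p _; rewrite !mxE coefMC.
elim: k => [|k IH]; apply/matrixP => i j.
  have s0 : s 0%N = 1.
    by rewrite sigma0.
  by have := cE 0%N i j; rewrite addr0 s0 => H; rewrite [LHS]mxE [RHS]mxE; exact: H.
have := cE k.+1 i j; rewrite IH => /(canRL (addrK _)) H.
by rewrite [LHS]mxE [RHS]mxE [X in X + _]mxE [X in _ + X]mxE; exact: H.
Qed.

(** The cofactors are minors of order [n - 1] with entries of degree at most one. Hence [n]
    coefficients describe the adjugate, and [n] nodes suffice to extract each of them. *)
Lemma size_adj_shape_pencil i j : (size (\adj N i j) <= n)%N.
Proof.
have n1 : n = n.-1.+1 by rewrite prednK // (leq_ltn_trans _ (ltn_ord i)).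
rewrite mxE /cofactor -signr_odd mulr_sign [X in (_ <= X)%N]n1.
have H : (size (\det (row' j (col' i N))) <= n.-1.+1)%N.
  by apply: size_det_leq => k l; rewrite !mxE size_linear_leq.
by case: ifP => _; rewrite ?size_polyN.
Qed.

Lemma adj_shape (t : R) : \adj (1%:M + t *: B) = \sum_(k < n) t ^+ k *: newton B s k.
Proof.
apply/matrixP => i j; rewrite -horner_shape_pencil -map_mx_adj [LHS]mxE.
change (((\adj N) i j).[t] = (\sum_(k < n) t ^+ k *: newton B s k) i j).
rewrite (horner_coef_wide _ (size_adj_shape_pencil i j)) summxE; apply: eq_bigr => k _.
rewrite [RHS]mxE -adj_shape_pencil_coef mulrC; congr (_ * _).
by rewrite [RHS]mxE.
Qed.

(** The derivative of [\det (1 + t B)] is computed twice: from its expansion in the [sigma k], and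
    row by row, where it is the trace of [B] times the adjugate. The claim is the coefficient of
    [t^k]. *)
Lemma trace_newton_shape (k : nat) : (k < n)%N ->
  \tr (B *m newton B s k) = k.+1%:R * s k.+1.
Proof.
move=> kn.
have dM (t : R) i j : is_derive t (1 : R) (fun u : R => (1%:M + u *: B) i j) (B i j).
  have -> : (fun u : R => (1%:M + u *: B) i j) = (fun u : R => (1%:M : 'M[R]_n) i j + B i j * u).
    by apply/funext => u; rewrite !mxE mulrC.
  have D : is_derive t (1 : R) (fun u : R => B i j * u) (B i j * 1).
    exact: (is_deriveZ (B i j) (is_derive_id t (1 : R))).
  have D' : is_derive t (1 : R) (fun u : R => (1%:M : 'M[R]_n) i j + B i j * u) (0 + B i j * 1).
    exact: (is_deriveD (is_derive_cst _ _ _) D).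
  by apply: (is_derive_eq D'); rewrite add0r mulr1.
have : (\poly_(k < n.+1) s k)^`() = \poly_(k < n) \tr (B *m newton B s k).
  apply: poly_eq_horner => t.
  have := is_derive_det (dM t).
  rewrite -tr_mul_adj adj_shape mulmx_sumr raddf_sum /=.
  have -> : (fun u : R => \det (1%:M + u *: B)) = horner (\poly_(k < n.+1) s k).
    by apply/funext => u; rewrite det_1D_shape horner_poly.
  move=> /(@derive_val _ _ _ _ _ _ _); rewrite derive_val => ->.
  by rewrite horner_poly; apply: eq_bigr => l _; rewrite -scalemxAr mxtraceZ mulrC.
move=> /(congr1 (fun p : {poly R} => p`_k)).
by rewrite coef_deriv !coef_poly ltnS kn => <-; rewrite mulr_natl.
Qed.

Lemma trace_newton (k : nat) : (k < n)%N -> \tr (newton B s k) = (n - k)%:R * s k.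
Proof.
case: k => [|k] kn.
  by rewrite /= mxtrace1 subn0 sigma0 mulr1.
rewrite /= raddfB /= mxtrace_scalar mxtrace_mulC trace_newton_shape; last exact: ltnW.
by rewrite -[X in X - _]mulr_natl -mulrBl natrB // ltnW.
Qed.

End Shape.

(* Inverting the Vandermonde system of the nodes 0, ..., n - 1 extracts the coefficient of [s^k]
   in [\adj (1 + s B)]. *)
Lemma newton_weights (n k : nat) : (k < n)%N -> exists c : 'I_n -> R,
  forall (B : 'M[R]_n) (lam : 'I_n -> R), char_poly B = \prod_i ('X - (lam i)%:P) ->
  newton B (fun k => sigma k lam) k = \sum_i c i *: \adj (1%:M + i%:R *: B).
Proof.
move=> kn; have [c cE] := vandermonde_weights (Ordinal kn).
exists c => B lam cpB.
under eq_bigr do rewrite (adj_shape cpB) scaler_sumr.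
rewrite exchange_big /= (bigD1 (Ordinal kn)) //= [X in _ + X]big1 ?addr0.
  under eq_bigr do rewrite scalerA.
  by have := cE (Ordinal kn); rewrite eqxx -scaler_suml /= => ->; rewrite scale1r.
move=> l lk; under eq_bigr do rewrite scalerA.
by rewrite -scaler_suml cE (negbTE lk) scale0r.
Qed.

End Newton.

Section SmoothCharts.
Context {R : realType} {n m : nat}.
Local Notation e i := (delta_mx 0 i : 'rV[R]_n).
Implicit Types (U : set 'rV[R]_n) (F : 'rV[R]_n -> 'rV[R]_m).

Lemma for_continuous_coord (T : topologicalType) (G : T -> 'rV[R]_m) (t : T) (a : 'I_m) :
  {for t, continuous G} -> {for t, continuous (fun s => G s 0 a)}.
Proof. by move=> cG; exact: (for_continuous_comp cG (@coord_continuous _ _ _ 0 a _)). Qed.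

Lemma derive_coord F y v a : derivable F y v -> 'D_v (fun z => F z 0 a) y = 'D_v F y 0 a.
Proof. by move=> dF; rewrite [in RHS]derive_mx // mxE. Qed.

Lemma Ck_on1_C1_at U F : open U -> Ck_on U 1 F ->
  forall y, U y -> forall a, C1_at (fun z => F z 0 a) y.
Proof.
move=> oU [cF dF] y Uy a; apply: (C1_at_partials oU) Uy => {}y Uy i.
  have [/(_ y Uy) d _] := dF i.
  exact: ((derivable_mxP _ _ _).1 d).
have [d [c _]] := dF i.
apply: for_continuous_near (for_continuous_coord (a := a) (c y Uy)).
have : \forall z \near y, U z by exact: open_nbhs_nbhs.
by apply: filterS => z Uz; rewrite derive_coord //; exact: d.
Qed.

Lemma Ck_on1_differentiable U F : open U -> Ck_on U 1 F ->
  forall y, U y -> differentiable F y.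
Proof.
by move=> oU cF y Uy; apply: differentiable_row => a; apply: C1_at_diff; exact: Ck_on1_C1_at cF _ Uy a.
Qed.

Lemma jacobian_entry F y i a : differentiable F y -> 'J F y i a = 'D_(e i) (fun z => F z 0 a) y.
Proof.
move=> dF; rewrite derive_coord; last exact: diff_derivable.
by rewrite /jacobian mxE deriveE.
Qed.

Lemma jacobian_C1_at U F : open U -> Ck_on U 2 F ->
  forall y, U y -> forall i a, C1_at (fun z => 'J F z i a) y.
Proof.
move=> oU cF y Uy i a.
have c1 : Ck_on U 1 F by have [c d] := cF; split => // j; have [dj [cj _]] := d j; split.
have c1i : Ck_on U 1 ('D_(e i) F) by have [_ /(_ i)[]] := cF.
apply: C1_at_near (Ck_on1_C1_at oU c1i Uy a).
have : \forall z \near y, U z by exact: open_nbhs_nbhs.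
apply: filterS => z Uz; have dF := Ck_on1_differentiable oU c1 Uz.
by rewrite jacobian_entry // derive_coord //; exact: diff_derivable.
Qed.

Lemma jacobian_derive_sym U F : open U -> Ck_on U 2 F ->
  forall y, U y -> forall i j a,
  'D_(e j) (fun z => 'J F z i a) y = 'D_(e i) (fun z => 'J F z j a) y.
Proof.
move=> oU cF y Uy i j a.
have c1 : Ck_on U 1 F by have [c d] := cF; split => // k; have [dj [cj _]] := d k; split.
have nU z : U z -> \forall t \near z, U t by move=> ?; exact: open_nbhs_nbhs.
have JE k z : U z -> \forall t \near z, 'J F t k a = 'D_(e k) (fun t => F t 0 a) t.
  move=> /nU; apply: filterS => t Ut; apply: jacobian_entry.
  exact: Ck_on1_differentiable oU c1 _ Ut.
have CD k z : U z -> C1_at ('D_(e k) (fun t => F t 0 a)) z.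
  move=> Uz; apply: C1_at_near (jacobian_C1_at oU cF Uz k a).
  by apply: filterS (JE k z Uz) => t ->.
rewrite (near_eq_derive _ (JE i y Uy)) (near_eq_derive _ (JE j y Uy)).
apply: derive_commute.
- apply: filterS (nU y Uy) => z Uz.
  have Cz := Ck_on1_C1_at oU c1 Uz a.
  by split; apply: C1_at_derivable => //; exact: CD.
- by have [_] := CD i y Uy; exact.
- by have [_] := CD j y Uy; exact.
Qed.

End SmoothCharts.

Section LocalDivergence.
Context {R : realType} {n : nat}.
Local Notation e i := (delta_mx 0 i : 'rV[R]_n).
Variables (U : set 'rV[R]_n) (X Nu : 'rV[R]_n -> 'rV[R]_n.+1).
Hypotheses (oU : open U) (sX : Ck_on U 2 X) (sNu : Ck_on U 2 Nu).

(** The normal and the coordinate tangent vectors of the parallel map [X + s Nu]. *)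
Definition parallel_frame (s : R) (z : 'rV[R]_n) : 'M[R]_n.+1 :=
  col_mx (Nu z) ('J X z + s *: 'J Nu z).

(* The coordinate on [d_j x] of [\adj (1 + s A)] applied to the tangential part of [x / 2], times
   [\det (nu, d x) = +- sqrt (det g)]. *)
Definition position_flux (s : R) (j : 'I_n) (z : 'rV[R]_n) : R :=
  \det (row_set (lift ord0 j) (2^-1 *: X z) (parallel_frame s z)).

Lemma parallel_frameS s z i l :
  parallel_frame s z (lift ord0 i) l = 'J X z i l + s * 'J Nu z i l.
Proof. by rewrite /parallel_frame col_mx_rowS [LHS]mxE; congr (_ + _); rewrite [LHS]mxE. Qed.

Lemma parallel_frame0 s z l : parallel_frame s z ord0 l = Nu z 0 l.
Proof. by rewrite /parallel_frame col_mx_row0. Qed.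

Let Ck12 (F : 'rV[R]_n -> 'rV[R]_n.+1) : Ck_on U 2 F -> Ck_on U 1 F.
Proof. by move=> [c d]; split; [exact: c|] => k; have [dj [cj _]] := d k; split. Qed.

Lemma parallel_frame_C1_at (s : R) y : U y -> forall k l, C1_at (fun z => parallel_frame s z k l) y.
Proof.
move=> Uy k l; case: (unliftP ord0 k) => [i|] ->.
  have -> : (fun z => parallel_frame s z (lift ord0 i) l) = (fun z => 'J X z i l + s * 'J Nu z i l).
    by apply/funext => z; exact: parallel_frameS.
  apply: C1_atD; first exact: jacobian_C1_at oU sX _ Uy _ _.
  by apply: C1_atM; [exact: C1_at_cst|exact: jacobian_C1_at oU sNu _ Uy _ _].
have -> : (fun z => parallel_frame s z ord0 l) = (fun z => Nu z 0 l).
  by apply/funext => z; exact: parallel_frame0.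
exact: Ck_on1_C1_at oU (Ck12 sNu) _ Uy _.
Qed.

Let half_C1 y l : U y -> C1_at (fun z => 2^-1 * X z 0 l) y.
Proof.
move=> Uy; apply: C1_atM; first exact: C1_at_cst.
exact: Ck_on1_C1_at oU (Ck12 sX) _ Uy _.
Qed.

Let flux_mx (s : R) (j : 'I_n) z := row_set (lift ord0 j) (2^-1 *: X z) (parallel_frame s z).

Let flux_mxE s j z k l : flux_mx s j z k l =
  if k == lift ord0 j then 2^-1 * X z 0 l else parallel_frame s z k l.
Proof. by rewrite mxE mxE. Qed.

Let flux_mx_C1 s j y k l : U y -> C1_at (fun z => flux_mx s j z k l) y.
Proof.
move=> Uy; have [kj|kj] := boolP (k == lift ord0 j).
  have -> : (fun z => flux_mx s j z k l) = (fun z => 2^-1 * X z 0 l).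
    by apply/funext => z; rewrite flux_mxE kj.
  exact: half_C1.
have -> : (fun z => flux_mx s j z k l) = (fun z => parallel_frame s z k l).
  by apply/funext => z; rewrite flux_mxE (negbTE kj).
exact: parallel_frame_C1_at.
Qed.

Lemma position_flux_C1_at s j y : U y -> C1_at (position_flux s j) y.
Proof. by move=> Uy; apply: C1_at_det => k l; exact: flux_mx_C1. Qed.

Lemma sum_offdiag_skew (f : 'I_n -> 'I_n -> R) : (forall i j, i != j -> f i j = - f j i) ->
  \sum_j \sum_(i | i != j) f j i = 0.
Proof.
move=> fS; set S := \sum_j _; suff : S = - S by lra.
rewrite {1}/S; under eq_bigr do rewrite big_mkcond; rewrite exchange_big /= -sumrN.
apply: eq_bigr => i _; rewrite -sumrN [in RHS]big_mkcond; apply: eq_bigr => j _.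
by rewrite eq_sym; case: ifP => // /fS ->.
Qed.

(** The determinant is differentiated row by row. The replaced row yields half of [d_j X], the top
    row yields [d_j Nu], and every other row [i] yields the second derivative [d_j d_i (X + s Nu)].
    These last terms cancel in the sum over [j]. *)
Lemma position_flux_div (s : R) y : U y ->
  \sum_j 'D_(e j) (position_flux s j) y =
  2^-1 * \sum_j \det (row_set (lift ord0 j) (row j ('J X y)) (parallel_frame s y)) +
  \sum_j \det (row_set ord0 (row j ('J Nu y))
    (row_set (lift ord0 j) (2^-1 *: X y) (parallel_frame s y))).
Proof.
move=> Uy.
pose H j i : 'rV[R]_n.+1 := \row_l ('D_(e j) (fun z => 'J X z i l) y +
   s * 'D_(e j) (fun z => 'J Nu z i l) y).
have Hs j i : H j i = H i j.
  apply/rowP => l; rewrite [LHS]mxE [RHS]mxE.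
  by congr (_ + _ * _); [exact: (jacobian_derive_sym oU sX Uy)|exact: (jacobian_derive_sym oU sNu Uy)].
pose W j : 'M[R]_n.+1 := \matrix_(k, l) 'D_(e j) (fun z => flux_mx s j z k l) y.
have dX k l : 'D_(e k) (fun z => X z 0 l) y = 'J X y k l.
  by rewrite jacobian_entry //; exact: Ck_on1_differentiable oU (Ck12 sX) _ Uy.
have W0 j : row ord0 (W j) = row j ('J Nu y).
  apply/rowP => l; rewrite [LHS]mxE [LHS]mxE [RHS]mxE.
  have -> : (fun z => flux_mx s j z ord0 l) = (fun z => Nu z 0 l).
    by apply/funext => z; rewrite flux_mxE; exact: parallel_frame0.
  by rewrite -jacobian_entry //; exact: Ck_on1_differentiable oU (Ck12 sNu) _ Uy.
have Wd j : row (lift ord0 j) (W j) = 2^-1 *: row j ('J X y).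
  apply/rowP => l; rewrite [LHS]mxE [LHS]mxE [RHS]mxE [X in _ * X]mxE -dX.
  under eq_fun do rewrite flux_mxE eqxx.
  rewrite (_ : (fun z => 2^-1 * X z 0 l) = (fun z => 2^-1 *: X z 0 l)) //.
  by rewrite deriveZ //; apply: C1_at_derivable; exact: Ck_on1_C1_at oU (Ck12 sX) _ Uy _.
have Wo j i : i != j -> row (lift ord0 i) (W j) = H j i.
  move=> ij; apply/rowP => l; rewrite [LHS]mxE [LHS]mxE [RHS]mxE.
  have -> : (fun z => flux_mx s j z (lift ord0 i) l) = (fun z => 'J X z i l + s *: 'J Nu z i l).
    apply/funext => z; rewrite flux_mxE (inj_eq lift_inj) (negbTE ij).
    exact: parallel_frameS.
  rewrite deriveD.
  - rewrite deriveZ //; apply: C1_at_derivable; exact: jacobian_C1_at oU sNu _ Uy _ _.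
  - by apply: C1_at_derivable; exact: jacobian_C1_at oU sX _ Uy _ _.
  - by apply: derivableZ; apply: C1_at_derivable; exact: jacobian_C1_at oU sNu _ Uy _ _.
have dV j : 'D_(e j) (position_flux s j) y = \sum_k \det (row_set k (row k (W j)) (flux_mx s j y)).
  have dM k l : is_derive y (e j) (fun z => flux_mx s j z k l) (W j k l).
    by rewrite mxE; apply: derivableP; apply: C1_at_derivable; exact: flux_mx_C1.
  exact: (@derive_val _ _ _ _ _ _ _ (is_derive_det dM)).
pose E j i := \det (row_set (lift ord0 i) (H j i) (flux_mx s j y)).
(* [H] is symmetric by equality of mixed derivatives, while exchanging the two tangent rows changes
   the sign of the determinant. *)
have ES i j : i != j -> E i j = - E j i.
  move=> ij; have lij : lift ord0 j != lift ord0 i by rewrite (inj_eq lift_inj) eq_sym.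
  rewrite /E Hs; set h := H j i; set M := parallel_frame s y; set x := 2^-1 *: X y.
  have -> : flux_mx s i y = row_set (lift ord0 i) x M by [].
  have -> : flux_mx s j y = row_set (lift ord0 j) x M by [].
  by rewrite (det_row_set_swap h x M lij) (row_setC x h M lij).
under eq_bigr do rewrite dV big_ord_recl.
rewrite big_split /= addrC; congr (_ + _); last by apply: eq_bigr => j _; rewrite W0.
transitivity (\sum_j (2^-1 * \det (row_set (lift ord0 j) (row j ('J X y)) (parallel_frame s y)) +
   \sum_(i | i != j) E j i)).
  apply: eq_bigr => j _; rewrite (bigD1 j) //=; congr (_ + _).
    rewrite Wd /flux_mx; set a := row j _.
    have -> : row_set (lift ord0 j) (2^-1 *: a) (row_set (lift ord0 j) (2^-1 *: X y) (parallel_frame s y))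
      = row_set (lift ord0 j) (2^-1 *: a) (parallel_frame s y).
      by apply/matrixP => k l; rewrite [LHS]mxE [RHS]mxE; case: ifP => // kj; rewrite mxE kj.
    by rewrite !det_row_set -scalemxAl mxE.
  by apply: eq_bigr => i ij; rewrite (Wo _ _ ij).
by rewrite big_split /= (sum_offdiag_skew ES) addr0 mulr_sumr.
Qed.

End LocalDivergence.

Section DotProduct.
Context {R : realType} {m : nat}.
Implicit Types u v w : 'rV[R]_m.

Lemma dotE u v : dot u v = (u *m v^T) 0 0.
Proof. by rewrite mxE; apply: eq_bigr => i _; rewrite mxE. Qed.

Lemma dotC u v : dot u v = dot v u.
Proof. by apply: eq_bigr => i _; rewrite mulrC. Qed.

Lemma dotDl u v w : dot (u + v) w = dot u w + dot v w.
Proof. by rewrite !dotE mulmxDl mxE. Qed.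

Lemma dotZl a u v : dot (a *: u) v = a * dot u v.
Proof. by rewrite !dotE -scalemxAl mxE. Qed.

Lemma dotDr u v w : dot u (v + w) = dot u v + dot u w.
Proof. by rewrite dotC dotDl !(dotC u). Qed.

Lemma dotZr a u v : dot u (a *: v) = a * dot u v.
Proof. by rewrite dotC dotZl dotC. Qed.

Lemma dot_ge0 u : 0 <= dot u u.
Proof. by apply: sumr_ge0 => i _; rewrite -expr2 sqr_ge0. Qed.

Lemma enorm_sqr u : enorm u ^+ 2 = dot u u.
Proof. by rewrite sqr_sqrtr // dot_ge0. Qed.

Lemma enormZ a u : enorm (a *: u) = `|a| * enorm u.
Proof. by rewrite /enorm dotZl dotZr mulrA -expr2 sqrtrM ?sqr_ge0 // sqrtr_sqr. Qed.

End DotProduct.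

Section Frame.
Context {R : realType} {n : nat}.
Variables (u : 'rV[R]_n.+1) (T : 'M[R]_(n, n.+1)).
Hypotheses (u1 : dot u u = 1) (Tu : forall i, dot (row i T) u = 0) (Tf : row_free T).
Local Notation M0 := (col_mx u T : 'M[R]_n.+1).

Lemma frame_tangent (v : 'rV[R]_n) : dot (v *m T) u = 0.
Proof.
rewrite dotE -mulmxA; have -> : T *m u^T = 0; last by rewrite mulmx0 mxE.
apply/matrixP => i j; rewrite [RHS]mxE -(Tu i) (ord1 j) mxE; apply: eq_bigr => k _.
by rewrite !mxE.
Qed.

Lemma frame_unit : M0 \in unitmx.
Proof.
rewrite -row_free_unit; apply: inj_row_free => w.
rewrite -(hsubmxK (w : 'M[R]_(1, 1 + n))).
rewrite (mul_row_col (lsubmx (w : 'M[R]_(1, 1 + n))) (rsubmx (w : 'M[R]_(1, 1 + n))) u T).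
set a := lsubmx _; set v := rsubmx _ => E.
have a0 : a = 0.
  apply/matrixP => i j; rewrite !ord1 [RHS]mxE.
  have := congr1 (fun z => dot z u) E; rewrite dotDl frame_tangent addr0.
  have -> : a *m u = a 0 0 *: u.
    by rewrite {1}(mx11_scalar a) mul_scalar_mx.
  by rewrite dotZl u1 mulr1 => ->; rewrite /dot big1 // => k _; rewrite mxE mul0r.
have v0 : v = 0.
  by move: E; rewrite a0 mul0mx add0r => E; apply: (row_free_inj Tf); rewrite mul0mx.
rewrite a0 v0; apply/rowP => k; rewrite !mxE; by case: fintype.split => l; rewrite mxE.
Qed.

Lemma frame_decomposition (w : 'rV[R]_n.+1) : exists v, w = dot w u *: u + v *m T.
Proof.
pose c := w *m invmx M0.
have E : w = c *m M0 by rewrite mulmxKV // frame_unit.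
move: E; rewrite -(hsubmxK (c : 'M[R]_(1, 1 + n))).
rewrite (mul_row_col (lsubmx (c : 'M[R]_(1, 1 + n))) (rsubmx (c : 'M[R]_(1, 1 + n))) u T).
set a := lsubmx _; set v := rsubmx _ => E; exists v.
have aE : a *m u = a 0 0 *: u.
  by rewrite {1}(mx11_scalar a) mul_scalar_mx.
have d : dot w u = a 0 0 by rewrite E aE dotDl dotZl u1 mulr1 frame_tangent addr0.
by rewrite d -aE.
Qed.

(** The Gram matrix of the full frame is block diagonal with blocks 1 and [T *m T^T]; so the
    determinant of the frame is, up to sign, the Riemannian volume density. *)
Lemma frame_det : \det M0 ^+ 2 = \det (\matrix_(i, j) dot (row i T) (row j T)).
Proof.
have TT : T *m T^T = \matrix_(i, j) dot (row i T) (row j T).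
  by apply/matrixP => i j; rewrite !mxE; apply: eq_bigr => k _; rewrite !mxE.
rewrite expr2 -{2}det_tr -det_mulmx -TT.
have -> : M0 *m M0^T = block_mx (1%:M : 'M[R]_1) 0 0 (T *m T^T).
  rewrite (tr_col_mx u T) (mul_col_row u T u^T T^T).
  have -> : u *m u^T = 1%:M by apply/matrixP => i j; rewrite !ord1 -dotE u1 mxE.
  have Tu0 : T *m u^T = 0.
    apply/matrixP => i j; rewrite (ord1 j) [RHS]mxE -(Tu i) mxE.
    by apply: eq_bigr => k _; rewrite !mxE.
  have -> : u *m T^T = 0 by apply: trmx_inj; rewrite trmx_mul trmxK Tu0 trmx0.
  by rewrite Tu0.
by rewrite (det_ublock (1%:M : 'M[R]_1) 0 (T *m T^T)) det1 mul1r.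
Qed.

(** [P] is completed by [delta] on the normal line to an operator of the ambient space, where the
    standard basis is orthonormal. Summing the coercivity over that basis gives [n.+1] times
    [delta], of which one [delta] is the normal contribution. *)
Lemma trace_coercive (P : 'M[R]_n) (delta : R) :
  (forall v : 'rV[R]_n, delta * dot (v *m T) (v *m T) <= dot (v *m P *m T) (v *m T)) ->
  n%:R * delta <= \tr P.
Proof.
move=> cP.
pose P1 : 'M[R]_n.+1 := block_mx (delta%:M : 'M[R]_1) 0 0 P.
pose C := invmx M0 *m P1 *m M0.
have trC : \tr C = delta + \tr P.
  rewrite /C mxtrace_mulC mulmxA mulmxV ?frame_unit // mul1mx.
  by rewrite (mxtrace_block (delta%:M : 'M[R]_1) 0 0 P) mxtrace_scalar.
have cC (w : 'rV[R]_n.+1) : delta * dot w w <= dot (w *m C) w.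
  have [v E] := frame_decomposition w; set b := dot w u in E.
  have wE : w = (row_mx b%:M v : 'rV[R]_n.+1) *m M0.
    by rewrite (mul_row_col b%:M v u T) mul_scalar_mx.
  have -> : w *m C = delta * b *: u + v *m P *m T.
    rewrite /C wE !mulmxA mulmxK ?frame_unit // (mul_row_block b%:M v (delta%:M : 'M[R]_1) 0 0 P).
    rewrite !mulmx0 addr0 add0r (mul_row_col _ _ u T) -scalar_mxM mul_scalar_mx.
    by rewrite mulrC.
  rewrite E !dotDl !dotDr !dotZl !dotZr u1 !frame_tangent (dotC u) frame_tangent.
  have := cP v; lra.
rewrite -(lerD2l delta) -trC.
have -> : delta + n%:R * delta = \sum_(a < n.+1) delta.
  by rewrite sumr_const card_ord -[RHS]mulr_natl -natr1 mulrDl mul1r addrC.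
apply: ler_sum => a _; have := cC (delta_mx 0 a).
have -> : dot (delta_mx 0 a) (delta_mx 0 a : 'rV[R]_n.+1) = 1.
  rewrite /dot (bigD1 a) //= big1 ?mxE ?eqxx ?mulr1 ?addr0 // => i ia.
  by rewrite !mxE (negbTE ia) mulr0.
have -> : dot (delta_mx 0 a *m C) (delta_mx 0 a) = C a a.
  rewrite -rowE /dot (bigD1 a) //= big1 ?mxE ?eqxx ?mulr1 ?addr0 // => i ia.
  by rewrite !mxE (negbTE ia) mulr0.
by rewrite mulr1.
Qed.

End Frame.

Section NewtonFlux.
Context {R : realType} {n k : nat}.
Local Notation e i := (delta_mx 0 i : 'rV[R]_n).
Variables (U : set 'rV[R]_n) (X Nu : 'rV[R]_n -> 'rV[R]_n.+1) (lam : 'rV[R]_n -> 'I_n -> R).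
Hypotheses (oU : open U) (sX : Ck_on U 2 X) (sNu : Ck_on U 2 Nu).
Hypothesis Nu1 : forall y, U y -> dot (Nu y) (Nu y) = 1.
Hypothesis XNu : forall y, U y -> forall i, dot (row i ('J X y)) (Nu y) = 0.
Hypothesis Xf : forall y, U y -> row_free ('J X y).
Let B y := 'J Nu y *m pinvmx ('J X y).
Hypothesis lamB : forall y, U y -> char_poly (B y) = \prod_i ('X - (lam y i)%:P).
Hypothesis kn : (k < n)%N.

Definition frame_volume (y : 'rV[R]_n) : R := \det (col_mx (Nu y) ('J X y) : 'M[R]_n.+1).

Let Ck12 (F : 'rV[R]_n -> 'rV[R]_n.+1) : Ck_on U 2 F -> Ck_on U 1 F.
Proof. by move=> [c d]; split; [exact: c|] => j; have [dj [cj _]] := d j; split. Qed.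

Lemma normal_derivative_tangent y : U y -> forall i, dot (row i ('J Nu y)) (Nu y) = 0.
Proof.
move=> Uy i.
have dNu a : is_derive y (e i) (fun z => Nu z 0 a) ('J Nu y i a).
  have dN := Ck_on1_differentiable oU (Ck12 sNu) Uy.
  rewrite jacobian_entry //; apply: derivableP; apply: C1_at_derivable.
  exact: Ck_on1_C1_at oU (Ck12 sNu) _ Uy a.
pose g : 'rV[R]_n -> R := fun z => \sum_a Nu z 0 a * Nu z 0 a.
have H : is_derive y (e i) g
    (\sum_a (Nu y 0 a * 'J Nu y i a + Nu y 0 a * 'J Nu y i a)).
  by apply: is_derive_bigsum => a; exact: is_deriveM.
have c : 'D_(e i) g y = 0.
  rewrite (@near_eq_derive R _ R g (cst 1)) ?derive_cst //.
  have : \forall z \near y, U z by exact: open_nbhs_nbhs.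
  by apply: filterS => z /Nu1.
have := @derive_val _ _ _ _ _ _ _ H; rewrite c big_split /= => /esym E.
have -> : dot (row i ('J Nu y)) (Nu y) = \sum_a Nu y 0 a * 'J Nu y i a.
  by apply: eq_bigr => a _; rewrite mulrC; congr (_ * _); rewrite [LHS]mxE.
by move: E; lra.
Qed.

(** The pseudoinverse in the shape matrix inverts exactly on the row space of the tangent basis; it
    is exact here because the derivatives of a unit normal are tangent. *)
Lemma weingarten y : U y -> B y *m 'J X y = 'J Nu y.
Proof.
move=> Uy; apply: mulmxKpV; apply/row_subP => i.
have [v ->] := frame_decomposition (Nu1 Uy) (XNu Uy) (Xf Uy) (row i ('J Nu y)).
by rewrite normal_derivative_tangent // scale0r add0r submxMl.
Qed.

Lemma parallel_frameE (s : R) y : U y ->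
  parallel_frame X Nu s y = col_mx (Nu y) ((1%:M + s *: B y) *m 'J X y).
Proof. by move=> Uy; rewrite mulmxDl mul1mx -scalemxAl weingarten. Qed.

Lemma frame_volume_C1_at y : U y -> C1_at frame_volume y.
Proof.
move=> Uy; apply: C1_at_det => a b.
have := @parallel_frame_C1_at R n U X Nu oU sX sNu 0 y Uy a b.
by congr C1_at; apply/funext => z; rewrite /parallel_frame scale0r addr0.
Qed.

Lemma frame_volume_sqr y : U y ->
  frame_volume y ^+ 2 = \det (\matrix_(i, j) dot (row i ('J X y)) (row j ('J X y))).
Proof. by move=> Uy; rewrite /frame_volume frame_det //; [exact: Nu1|exact: XNu]. Qed.

Lemma frame_volume_neq0 y : U y -> frame_volume y != 0.
Proof.
move=> Uy; have := frame_unit (Nu1 Uy) (XNu Uy) (Xf Uy).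
by rewrite unitmxE unitfE.
Qed.

Variable c : 'I_n -> R.
Hypothesis cE : forall (C : 'M[R]_n) (mu : 'I_n -> R), char_poly C = \prod_i ('X - (mu i)%:P) ->
  newton C (fun l => sigma l mu) k = \sum_i c i *: \adj (1%:M + i%:R *: C).

(** By [newton_fluxE], the [j]-th coordinate of [P_k] applied to the tangent part of [X / 2], times
    the signed density [frame_volume]. *)
Definition newton_flux (j : 'I_n) (y : 'rV[R]_n) : R :=
  \sum_i c i * position_flux X Nu i%:R j y.

Let P y := newton (B y) (fun l => sigma l (lam y)) k.

Lemma newton_flux_C1_at j y : U y -> C1_at (newton_flux j) y.
Proof.
move=> Uy; apply: C1_at_sum => i _; apply: C1_atM; first exact: C1_at_cst.
exact: position_flux_C1_at oU sX sNu _ _ _ Uy.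
Qed.

Lemma newton_fluxE j y (b : R) (v : 'rV[R]_n) : U y ->
  2^-1 *: X y = b *: Nu y + v *m 'J X y ->
  newton_flux j y = (v *m P y) 0 j * frame_volume y.
Proof.
move=> Uy E; rewrite /P (cE (lamB Uy)) mulmx_sumr summxE mulr_suml.
apply: eq_bigr => i _; rewrite /position_flux parallel_frameE // E det_frame_set.
by rewrite -scalemxAr [in RHS]mxE mulrA.
Qed.

(** For each node the divergence is half of [\tr \adj (1 + s B)] minus [b] times the trace of
    [B *m \adj (1 + s B)]. The weights turn the two traces into those of [P_k] and [B P_k], both
    known multiples of symmetric functions. *)
Lemma newton_flux_div y : U y ->
  \sum_j 'D_(e j) (newton_flux j) y =
  (2^-1 * ((n - k)%:R * sigma k (lam y))
   - dot (2^-1 *: X y) (Nu y) * (k.+1%:R * sigma k.+1 (lam y))) * frame_volume y.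
Proof.
move=> Uy; set b := dot _ _.
have [v E] := frame_decomposition (Nu1 Uy) (XNu Uy) (Xf Uy) (2^-1 *: X y).
rewrite -/b in E.
have dF i j : derivable (position_flux X Nu i%:R j) y (e j).
  by apply: C1_at_derivable; exact: position_flux_C1_at oU sX sNu _ _ _ Uy.
have D j : 'D_(e j) (newton_flux j) y = \sum_i c i * 'D_(e j) (position_flux X Nu i%:R j) y.
  have H : is_derive y (e j) (fun z => \sum_(i < n) c i * position_flux X Nu i%:R j z)
     (\sum_(i < n) c i * 'D_(e j) (position_flux X Nu i%:R j) y).
    by apply: is_derive_bigsum => i; exact: (is_deriveZ (c i) (derivableP (dF i j))).
  exact: (@derive_val _ _ _ _ _ _ _ H).
under eq_bigr do rewrite D.
rewrite exchange_big /=.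
have step (i : 'I_n) : \sum_j c i * 'D_(e j) (position_flux X Nu i%:R j) y =
   c i * (2^-1 * \tr (\adj (1%:M + i%:R *: B y)) - b * \tr (B y *m \adj (1%:M + i%:R *: B y)))
   * frame_volume y.
  rewrite -mulr_sumr (position_flux_div oU sX sNu _ Uy) parallel_frameE // E.
  rewrite -(weingarten Uy) sum_det_frame_swap.
  have -> : \sum_j \det (row_set (lift ord0 j) (row j ('J X y))
      (col_mx (Nu y) ((1%:M + i%:R *: B y) *m 'J X y) : 'M[R]_n.+1)) =
      \tr (\adj (1%:M + i%:R *: B y)) * frame_volume y.
    by rewrite -{1}(mul1mx ('J X y)) sum_det_frame mul1mx.
  rewrite /frame_volume; set a1 := \tr _; set a2 := \tr _; set a3 := \det _; ring.
under eq_bigr do rewrite step.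
rewrite -mulr_suml; congr (_ * _).
rewrite -(trace_newton (lamB Uy) kn) -(trace_newton_shape (lamB Uy) kn) (cE (lamB Uy)).
rewrite mulmx_sumr !raddf_sum /= !mulr_sumr -sumrB; apply: eq_bigr => i _.
rewrite -scalemxAr !mxtraceZ; set a1 := \tr _; set a2 := \tr _; ring.
Qed.

End NewtonFlux.

(** * Charts and Borel measures *)

Section ZeroExtension.
Context {R : realType} {n : nat}.
Variables (U K : set 'rV[R]_n) (g : 'rV[R]_n -> R).
Hypotheses (oU : open U) (cK : compact K) (KU : K `<=` U).
Hypothesis g0 : forall y, U y -> ~ K y -> g y = 0.

Lemma closed_compact_rV : closed K.
Proof. by apply: compact_closed => //; exact: norm_hausdorff. Qed.

Lemma patch_near y : U y -> \forall z \near y, (g \_ U) z = g z.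
Proof.
move=> Uy; have : \forall z \near y, U z by exact: open_nbhs_nbhs.
by apply: filterS => z Uz; rewrite patchE mem_set.
Qed.

(** A point outside [U] is outside the closed set [K], hence has a neighbourhood on which the
    extension is zero. Regularity of the extension at the boundary of [U] rests on this. *)
Lemma patch_near0 y : ~ U y -> \forall z \near y, (g \_ U) z = 0.
Proof.
move=> Uy; have : \forall z \near y, (~` K) z.
  by apply: open_nbhs_nbhs; split; [exact/closed_openC/closed_compact_rV|move=> /KU].
by apply: filterS => z Kz; rewrite patchE; case: ifPn => // /set_mem Uz; exact: g0.
Qed.

Lemma csupp_patch : (forall y, U y -> {for y, continuous g}) ->
  exists2 r, 0 <= r & csupp r (g \_ U).
Proof.
move=> cg.
have [M [_ KM]] := compact_bounded cK.
have M1 : M < `|M| + 1 by rewrite ltr_pwDr // ler_norm.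
exists (`|M| + 1); first by rewrite addr_ge0.
split => [y|y ry].
  have [Uy|Uy] := pselect (U y).
    apply: for_continuous_near (cg y Uy).
    by apply: filterS (patch_near Uy) => z ->.
  apply: (@for_continuous_near R _ (fun=> 0)); last exact: cst_continuous.
  by apply: filterS (patch_near0 Uy) => z ->.
rewrite patchE; case: ifPn => // /set_mem Uy; apply: g0 => // Ky.
by have := KM _ M1 _ Ky; rewrite /= leNgt ry.
Qed.

Lemma C1_at_patch : (forall y, U y -> C1_at g y) -> forall y, C1_at (g \_ U) y.
Proof.
move=> Cg y; have [Uy|Uy] := pselect (U y).
  by apply: C1_at_near (Cg y Uy); exact: patch_near.
by apply: C1_at_near (C1_at_cst 0 y); exact: patch_near0.
Qed.

Lemma derive_patch y v : 'D_v (g \_ U) y = ('D_v g \_ U) y.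
Proof.
rewrite patchE; case: ifPn => [/set_mem Uy|/negP Uy].
  by apply: near_eq_derive; exact: patch_near.
rewrite (@near_eq_derive R _ R (g \_ U) (cst 0)) ?derive_cst //.
by apply: patch_near0 => Uy'; apply: Uy; exact: mem_set.
Qed.

End ZeroExtension.

Section ChartTopology.
Context {R : realType} {n : nat} {S : topologicalType}.
Variable c : chart R n S.

Lemma chart_set_open (V : set 'rV[R]_n) : open V -> open (dom c `&` coord c @^-1` V).
Proof.
move=> oV; rewrite openE => p [Dp Vp]; apply: filterI.
  by apply: open_nbhs_nbhs; split => //; exact: dom_open.
by apply: (coord_cts Dp); apply: open_nbhs_nbhs.
Qed.

Lemma param_continuous (h : S -> R) y : cod c y -> {for param c y, continuous h} ->
  {for y, continuous (h \o param c)}.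
Proof. by move=> cy ch; exact: (for_continuous_comp (param_cts cy) ch). Qed.

Lemma coord_continuous_inv (h : S -> R) p : dom c p ->
  {for coord c p, continuous (h \o param c)} -> {for p, continuous h}.
Proof.
move=> dp ch; have := for_continuous_comp (coord_cts dp) ch.
apply: for_continuous_near.
have : \forall q \near p, dom c q.
  by apply: open_nbhs_nbhs; split => //; exact: dom_open.
by apply: filterS => q dq /=; rewrite coordK.
Qed.

Lemma coord_compact (K : set S) : compact K -> K `<=` dom c -> compact (coord c @` K).
Proof.
move=> cK KD; apply: continuous_compact => //.
by apply: continuous_in_subspaceT => p /set_mem /KD; exact: coord_cts.
Qed.

Lemma param_compact (K : set 'rV[R]_n) : compact K -> K `<=` cod c -> compact (param c @` K).
Proof.
move=> cK KD; apply: continuous_compact => //.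
by apply: continuous_in_subspaceT => p /set_mem /KD; exact: param_cts.
Qed.

Lemma coord_image_cod (K : set S) : K `<=` dom c -> coord c @` K `<=` cod c.
Proof. by move=> KD _ [p /KD dp <-]; exact: coord_cod. Qed.

Lemma coord_image_param (K : set S) y : cod c y -> ~ (coord c @` K) y -> ~ K (param c y).
Proof. by move=> cy nK Kp; apply: nK; exists (param c y) => //; exact: paramK. Qed.

End ChartTopology.

(** * C1 bump functions in Euclidean space *)

Section Bump.
Context {R : realType}.

(** The square makes the positive part continuously differentiable. Both the bump functions and the
    radial cutoff are built from it. *)
Definition sqpos (t : R) : R := Num.max t 0 ^+ 2.

Lemma sqpos_ge0 t : 0 <= sqpos t. Proof. exact: sqr_ge0. Qed.

Lemma sqpos_le0 t : t <= 0 -> sqpos t = 0.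
Proof. by move=> t0; rewrite /sqpos max_r // expr0n. Qed.

Lemma sqpos_taylor (t h : R) : `|2 * Num.max t 0 * h - (sqpos (h + t) - sqpos t)| <= h ^+ 2.
Proof.
rewrite /sqpos ler_norml.
have [t0|t0] := leP t 0; have [th0|th0] := leP (h + t) 0; apply/andP; split; nra.
Qed.

Lemma is_derive_sqpos (t : R) : is_derive t (1 : R) sqpos (2 * Num.max t 0).
Proof.
have key : h^-1 *: (sqpos (h *: (1 : R) + t) - sqpos t) @[h --> 0^'] --> 2 * Num.max t 0.
  apply/cvgrPdist_le => eps e0; near=> h.
  have h0 : h != 0 by near: h; exact: nbhs_dnbhs_neq.
  have he : `|h| < eps by near: h; exact: dnbhs0_lt.
  rewrite [h *: 1]mulr1.
  have -> : 2 * Num.max t 0 - h^-1 *: (sqpos (h + t) - sqpos t) =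
      h^-1 * (2 * Num.max t 0 * h - (sqpos (h + t) - sqpos t)).
    by rewrite mulrBr mulrCA mulVf // mulr1.
  rewrite normrM normfV ler_pdivrMl ?normr_gt0 //.
  apply: le_trans (sqpos_taylor t h) _.
  by rewrite -normr_id -real_normK ?num_real // expr2 normr_id ler_wpM2l // ltW.
split; first by apply/cvg_ex; exists (2 * Num.max t 0).
exact/cvg_lim.
Unshelve. all: by end_near. Qed.

Lemma derivable_sqpos (t : R) : derivable sqpos t 1.
Proof. by have [] := is_derive_sqpos t. Qed.

Lemma derive1_sqpos (t : R) : derive1 sqpos t = 2 * Num.max t 0.
Proof. by rewrite derive1E; exact: (@derive_val _ _ _ _ _ _ _ (is_derive_sqpos t)). Qed.

Lemma continuous_derive1_sqpos : continuous (derive1 sqpos).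
Proof.
have -> : derive1 sqpos = fun t => 2 * Num.max t 0.
  by apply/funext => t; exact: derive1_sqpos.
move=> t; apply: cvgM; first exact: cvg_cst.
by apply: (@continuous_max _ R id (cst 0)); [exact: cvg_id|exact: cvg_cst].
Qed.

Lemma C1_at_sqpos (n : nat) (F : 'rV[R]_n -> R) y : C1_at F y -> C1_at (fun z => sqpos (F z)) y.
Proof.
by apply: C1_at_comp1; [exact: derivable_sqpos|exact: continuous_derive1_sqpos].
Qed.

Lemma bump_exists (n : nat) (y0 : 'rV[R]_n) (r : R) : 0 < r ->
  exists b : 'rV[R]_n -> R, [/\ forall y, C1_at b y, forall y, 0 <= b y,
    forall y, r <= `|y0 - y| -> b y = 0 &
    exists2 rho, 0 < rho & forall y, `|y0 - y| < rho -> b y = 1].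
Proof.
move=> r0.
pose q (y : 'rV[R]_n) := \sum_l (y 0 l + - y0 0 l) * (y 0 l + - y0 0 l).
have Cq y : C1_at q y.
  apply: C1_at_sum => l _; apply: C1_atM; apply: C1_atD;
    by [exact: C1_at_coord|exact: C1_at_cst].
(* With [q] the squared Euclidean distance to [y0], [w <= 0] means [q >= r^2] and [w >= 1] means
   [q <= r^2 / 4]. The double use of [sqpos] below is 0 in the first region and 1 in the second. *)
pose w y := 4 / (3 * r ^+ 2) * (r ^+ 2 + -1 * q y).
have Cw y : C1_at w y.
  apply: C1_atM; first exact: C1_at_cst.
  apply: C1_atD; first exact: C1_at_cst.
  by apply: C1_atM; [exact: C1_at_cst|exact: Cq].
pose b y := 1 + -1 * sqpos (1 + -1 * sqpos (w y)).
have r2 : 0 < 3 * r ^+ 2 by rewrite mulr_gt0 // exprn_gt0.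
exists b; split.
- move=> y; apply: C1_atD; first exact: C1_at_cst.
  apply: C1_atM; first exact: C1_at_cst.
  apply: C1_at_sqpos; apply: C1_atD; first exact: C1_at_cst.
  by apply: C1_atM; [exact: C1_at_cst|exact: C1_at_sqpos].
- move=> y; rewrite /b mulN1r subr_ge0 /sqpos mulN1r.
  have := sqr_ge0 (Num.max (w y) 0); move: (_ ^+ 2) => z z0.
  by have [] := leP (1 - z) 0; nra.
- move=> y ry; suff w0 : w y <= 0.
    by rewrite /b (sqpos_le0 w0) mulr0 addr0 /sqpos max_l // expr1n mulr1 subrr.
  rewrite /w mulN1r pmulr_rle0 ?divr_gt0 // subr_le0.
  have [i ri] : exists i, r <= `|y0 0 i - y 0 i|.
    apply/not_existsP => H; move: ry; rewrite leNgt => /negP; apply.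
    rewrite [ltLHS]/Num.Def.normr/= mx_normrE; apply/bigmax_ltP; split => // -[a l] _ /=.
    by rewrite (ord1 a) !mxE ltNge; apply/negP; exact: H.
  rewrite /q (bigD1 i) //=; apply: (@le_trans _ _ ((y 0 i - y0 0 i) * (y 0 i - y0 0 i))).
    rewrite -expr2 -[leRHS]real_normK ?num_real // distrC ler_sqr ?nnegrE //.
    exact: ltW.
  by rewrite lerDl sumr_ge0 // => l _; rewrite -expr2 sqr_ge0.
(* The norm is the sup norm; this radius forces [q <= r^2 / 4] after summing the [n] squared
   coordinates. *)
exists (r / (2 * n.+1%:R)); first by rewrite divr_gt0 // mulr_gt0.
move=> y yr; suff w1 : 1 <= w y.
  have s1 : 1 <= sqpos (w y) by rewrite /sqpos max_l ?(le_trans _ w1) // expr_ge1 // (le_trans _ w1).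
  by rewrite /b (@sqpos_le0 (1 + -1 * _)) ?mulr0 ?addr0 // mulN1r subr_le0.
rewrite /w mulN1r mulrAC ler_pdivlMr // mul1r.
have : q y <= n.+1%:R * (r / (2 * n.+1%:R)) ^+ 2.
  apply: (@le_trans _ _ (\sum_(l < n) (r / (2 * n.+1%:R)) ^+ 2)).
    apply: ler_sum => l _; rewrite -expr2 -[leLHS]real_normK ?num_real // ler_sqr ?nnegrE //.
      have := norm_row_coord (y0 - y) l; rewrite !mxE distrC => h.
      exact: le_trans h (ltW yr).
    by rewrite divr_ge0 ?ltW // mulr_ge0.
  rewrite sumr_const card_ord -[leLHS]mulr_natl ler_wpM2r ?sqr_ge0 //.
  by rewrite ler_nat.
have n1 : (1 : R) <= n.+1%:R by rewrite ler1n.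
have -> : n.+1%:R * (r / (2 * n.+1%:R)) ^+ 2 = r ^+ 2 / (4 * n.+1%:R).
  have : (n.+1%:R : R) != 0 by rewrite pnatr_eq0.
  by move: (n.+1%:R : R) => N N0; field.
have : r ^+ 2 / (4 * n.+1%:R) <= r ^+ 2 / 4.
  by move: (n.+1%:R : R) n1 => N N1; rewrite ler_wpM2l ?sqr_ge0 // lef_pV2 ?posrE; lra.
move=> h1 h2; have := le_trans h2 h1; move: (q y) => Q.
lra.
Qed.

Lemma bump_in_open (n : nat) (U : set 'rV[R]_n) (y0 : 'rV[R]_n) : open U -> U y0 ->
  exists (b : 'rV[R]_n -> R) (K : set 'rV[R]_n), [/\ forall y, C1_at b y,
    forall y, 0 <= b y, compact K /\ K `<=` U, forall y, ~ K y -> b y = 0 &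
    exists2 rho, 0 < rho & forall y, ball y0 rho y -> b y = 1].
Proof.
move=> oU Uy0.
have : \forall z \near y0, U z by exact: open_nbhs_nbhs.
move=> /nbhs_ballP[r /= r0 rU].
have r2 : 0 < r / 2 by rewrite divr_gt0.
have [b [Cb b0 bout [rho rho0 b1]]] := bump_exists y0 r2.
exists b, [set v : 'rV[R]_n | forall i, `[y0 0 i - r / 2, y0 0 i + r / 2]%classic (v ord0 i)].
split=> //.
- split.
    apply: (@rV_compact R n (fun i => `[y0 0 i - r / 2, y0 0 i + r / 2]%classic)) => i.
    exact: segment_compact.
  move=> v Kv; apply: rU; rewrite -ball_normE /= [ltLHS]/Num.Def.normr/= mx_normrE.
  apply/bigmax_ltP; split => // -[a i] _ /=; rewrite (ord1 a) !mxE.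
  have := Kv i; rewrite /= in_itv /= => /andP[h1 h2].
  by rewrite ltr_norml; apply/andP; split; lra.
- move=> y nK; apply: bout; rewrite leNgt; apply/negP => yr; apply: nK => i /=.
  have := le_lt_trans (norm_row_coord (y0 - y) i) yr; rewrite !mxE ltr_norml => /andP[h1 h2].
  by rewrite in_itv /=; apply/andP; split; lra.
- by exists rho => // y; rewrite -ball_normE => /b1.
Qed.

End Bump.

(** * Equality of positive functionals by horizontal layers *)

Section LayerSandwich.
Context {R : realType}.

Definition clamp01 (t : R) : R := Num.min (Num.max t 0) 1.

Lemma clamp01_continuous : continuous clamp01.
Proof.
move=> t; apply: (@continuous_min _ R (fun t => Num.max t 0) (cst 1)); last exact: cvg_cst.
by apply: (@continuous_max _ R id (cst 0)); [exact: cvg_id|exact: cvg_cst].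
Qed.

Lemma clamp01_ge0 t : 0 <= clamp01 t.
Proof. by rewrite /clamp01 le_min ler01 le_max lexx orbT. Qed.

Lemma clamp01_le1 t : clamp01 t <= 1.
Proof. by rewrite /clamp01 ge_min lexx orbT. Qed.

Lemma clamp01_le0 t : t <= 0 -> clamp01 t = 0.
Proof. by move=> t0; rewrite /clamp01 max_r // min_l. Qed.

Lemma clamp01_ge1 t : 1 <= t -> clamp01 t = 1.
Proof. by move=> t1; rewrite /clamp01 max_l ?(le_trans ler01) // min_r. Qed.

Lemma sum_clamp01 (t : R) (L : nat) : 0 <= t ->
  \sum_(k < L) clamp01 (t - k%:R) = Num.min t L%:R.
Proof.
move=> t0; elim: L => [|L IH]; first by rewrite big_ord0 min_r.
rewrite big_ord_recr /= IH -natr1.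
have [tL|tL] := leP t L%:R.
  by rewrite clamp01_le0 ?subr_le0 // addr0 min_l // (le_trans tL) // lerDl.
rewrite /clamp01 max_l ?subr_ge0 ?ltW //.
have [h|h] := leP (t - L%:R) 1.
  by rewrite min_l; lra.
by rewrite min_r; lra.
Qed.

(** The two sums interlace through [a] with a shift of one index, so that they differ by no more
    than the first term. *)
Lemma layer_sum_le (p q a : nat -> R) (L : nat) : 0 <= a 0%N ->
  (forall k, p k <= a k) -> (forall k, a k.+1 <= q k) -> (forall k, 0 <= q k) ->
  \sum_(k < L) p k <= a 0%N + \sum_(k < L) q k.
Proof.
move=> a0 pa aq q0; case: L => [|L]; first by rewrite !big_ord0 addr0.
suff H : \sum_(k < L.+1) p k <= a 0%N + \sum_(k < L) q k.
  by apply: le_trans H _; rewrite lerD2l big_ord_recr /= lerDl.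
elim: L => [|L IH]; first by rewrite big_ord1 big_ord0 addr0.
rewrite big_ord_recr [in leRHS]big_ord_recr /= addrA lerD //.
exact: le_trans (pa _) (aq _).
Qed.

Lemma eq_le_div (x y v : R) : (forall N : nat, (0 < N)%N -> N%:R * x <= v + N%:R * y) -> x <= y.
Proof.
move=> H; rewrite leNgt; apply/negP => yx.
have [N HN] : exists N : nat, v / (x - y) < N%:R.
  by exists (Num.trunc (v / (x - y))).+1; exact: truncnS_gt.
have N0 : (0 < N.+1)%N by [].
have := H _ N0; rewrite -subr_ge0 => h.
have : v < N.+1%:R * (x - y).
  rewrite -ltr_pdivrMr ?subr_gt0 //; apply: lt_trans HN _; by rewrite ltr_nat.
by move: h; rewrite mulrBr; lra.
Qed.

Variables (T : Type) (C : (T -> R) -> Prop) (m : set T -> R).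
Hypothesis CZD : forall a b phi psi, C phi -> C psi -> C (fun t => a * phi t + b * psi t).
Hypothesis Ccomp : forall (F : R -> R) phi, continuous F -> F 0 = 0 -> C phi ->
  C (fun t => F (phi t)).
Hypothesis Cbounded : forall phi, C phi -> exists M : nat, forall t, phi t <= M%:R.

(* The two integrals to be compared, one against [vol] and one iterated in a chart, are only
   tied together through the sets [s < h], of which [m] is the common measure. *)
Definition positive_functional (I : (T -> R) -> R) : Prop :=
  [/\ forall a b phi psi, C phi -> C psi ->
        I (fun t => a * phi t + b * psi t) = a * I phi + b * I psi,
      forall phi, C phi -> (forall t, 0 <= phi t) -> 0 <= I phi,
      forall s h phi, 0 <= s -> C h -> C phi -> (forall t, 0 <= phi t <= 1) ->
        (forall t, h t <= s -> phi t = 0) -> I phi <= m [set t | s < h t] &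
      forall s h phi, 0 <= s -> C h -> C phi -> (forall t, 0 <= phi t) ->
        (forall t, s < h t -> 1 <= phi t) -> m [set t | s < h t] <= I phi].

Lemma functional_layers (I : (T -> R) -> R) (phi : nat -> T -> R) (L : nat) :
  positive_functional I -> (forall k, C (phi k)) -> C (fun=> 0) ->
  I (fun t => \sum_(k < L) phi k t) = \sum_(k < L) I (phi k) /\
  C (fun t => \sum_(k < L) phi k t).
Proof.
move=> [lin _ _ _] Cphi C0; elim: L => [|L [IH IC]].
  rewrite big_ord0; have E : (fun t => \sum_(k < 0) phi k t) = (fun=> 0).
    by apply/funext => t; rewrite big_ord0.
  rewrite E; split => //.
  have := lin 0 0 _ _ C0 C0; rewrite !mul0r addr0 => h0; rewrite -[RHS]h0.
  by congr I; apply/funext => t; rewrite mul0r addr0.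
have E : (fun t => \sum_(k < L.+1) phi k t) = (fun t => 1 * (\sum_(k < L) phi k t) + 1 * phi L t).
  by apply/funext => t; rewrite big_ord_recr /= !mul1r.
rewrite E (lin _ _ _ _ IC (Cphi L)) IH big_ord_recr /= !mul1r; split => //.
exact: CZD.
Qed.

(** [N h] is cut into layers of height one. Layer [k] has [I]-value at most the measure of
    [k / N < h], and [J]-value at least that of [k.+1 / N < h]. Hence [N I h <= m (0 < h) + N J h],
    and the fixed term is negligible for large [N]. *)
Lemma positive_functional_le (I J : (T -> R) -> R) (h : T -> R) :
  positive_functional I -> positive_functional J -> C h -> (forall t, 0 <= h t) -> I h <= J h.
Proof.
move=> pI pJ Ch h0; have [M hM] := Cbounded Ch.
have C0 : C (fun=> 0).
  have := CZD 0 0 Ch Ch; congr C; apply/funext => t; by rewrite !mul0r addr0.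
apply: (@eq_le_div _ _ (m [set t | 0 < h t])) => N N0.
have NR : 0 < N%:R :> R by rewrite ltr0n.
pose phi (k : nat) t := clamp01 (N%:R * h t - k%:R).
have Cphi k : C (phi k).
  apply: (Ccomp (F := fun u => clamp01 (N%:R * u - k%:R))) => //.
    move=> u; have cu : {for u, continuous (fun u : R => N%:R * u - k%:R)}.
      by apply: cvgB; [apply: cvgM; [exact: cvg_cst|exact: cvg_id]|exact: cvg_cst].
    have cc : {for N%:R * u - k%:R, continuous clamp01} by exact: clamp01_continuous.
    exact: (for_continuous_comp cu cc).
  by rewrite mulr0 sub0r clamp01_le0 // oppr_le0.
(* The bound [h <= M] makes [N * M] layers exhaust [N h], so the minimum in [sum_clamp01] is
   inactive. *)
have sumphi : (fun t => \sum_(k < N * M) phi k t) = (fun t => N%:R * h t + 0 * h t).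
  apply/funext => t; rewrite mul0r addr0 sum_clamp01; last by rewrite mulr_ge0.
  by rewrite min_l // natrM ler_wpM2l.
have [linI pIpos Iup Ilow] := pI; have [linJ pJpos Jup Jlow] := pJ.
have := (functional_layers (N * M) pI Cphi C0).1; rewrite sumphi linI // mul0r addr0 => ->.
have := (functional_layers (N * M) pJ Cphi C0).1; rewrite sumphi linJ // mul0r addr0 => ->.
pose a k := m [set t | k%:R / N%:R < h t].
have phi01 k t : 0 <= phi k t <= 1 by rewrite clamp01_ge0 clamp01_le1.
have s0 (l : nat) : 0 <= l%:R / N%:R :> R by rewrite divr_ge0.
have pa k : I (phi k) <= a k.
  apply: (Iup _ h _ (s0 k)) => // t.
  by rewrite ler_pdivlMr // mulrC => ht; rewrite /phi clamp01_le0 // subr_le0.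
have aq k : a k.+1 <= J (phi k).
  apply: (Jlow _ h _ (s0 k.+1)) => // [t|t]; first by have /andP[] := phi01 k t.
  rewrite ltr_pdivrMr // mulrC => ht; rewrite /phi clamp01_ge1 //.
  by move: ht; rewrite -natr1; lra.
have q0 k : 0 <= J (phi k) by apply: pJpos => // t; have /andP[] := phi01 k t.
have -> : m [set t | 0 < h t] = a 0%N.
  by rewrite /a; congr m; apply/seteqP; split => t /=; rewrite mul0r.
apply: (@layer_sum_le (fun k => I (phi k)) (fun k => J (phi k)) a) => //.
apply: le_trans (pa 0%N).
by apply: pIpos => // t; have /andP[] := phi01 0%N t.
Qed.

Lemma positive_functional_eq (I J : (T -> R) -> R) (h : T -> R) :
  positive_functional I -> positive_functional J -> C h -> I h = J h.
Proof.
move=> pI pJ Ch; have [linI _ _ _] := pI; have [linJ _ _ _] := pJ.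
pose hp t := Num.max (h t) 0; pose hn t := Num.max (- h t) 0.
have cmax : continuous (fun t : R => Num.max t 0).
  by move=> t; apply: (@continuous_max _ R id (cst 0)); [exact: cvg_id|exact: cvg_cst].
have Cp : C hp by apply: (Ccomp (F := fun t => Num.max t 0)) => //; rewrite maxxx.
have Cn : C hn.
  apply: (Ccomp (F := fun t => Num.max (- t) 0)) => //; last by rewrite oppr0 maxxx.
  move=> t; have ct : {for t, continuous (fun u : R => - u)} by apply: cvgN; exact: cvg_id.
  have cc : {for - t, continuous (fun u : R => Num.max u 0)} by exact: cmax.
  exact: (for_continuous_comp ct cc).
have -> : h = (fun t => 1 * hp t + -1 * hn t).
  apply/funext => t; rewrite /hp /hn; have [h0|h0] := leP (h t) 0.
    by rewrite max_l ?oppr_ge0 //; lra.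
  by rewrite max_r ?oppr_le0 ?ltW //; lra.
rewrite linI // linJ //.
have hp0 t : 0 <= hp t by rewrite le_max lexx orbT.
have hn0 t : 0 <= hn t by rewrite le_max lexx orbT.
by congr (_ * _ + _ * _); apply/eqP; rewrite eq_le !positive_functional_le.
Qed.

End LayerSandwich.

Lemma bounded_integrable (d : measure_display) (T : measurableType d) (R : realType)
    (mu : {measure set T -> \bar R}) (W : set T) (h : T -> R) (M : R) :
  measurable W -> (mu W < +oo)%E -> measurable_fun [set: T] h -> (forall p, `|h p| <= M) ->
  (forall p, ~ W p -> h p = 0) -> mu.-integrable [set: T] (EFin \o h).
Proof.
move=> mW Wfin mh bh h0.
have : mu.-integrable W (EFin \o h).
  apply: measurable_bounded_integrable => //.
    exact: measurable_funS mh.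
  exists M; split; first by rewrite num_real.
  by move=> z Mz p _ /=; apply: le_trans (bh p) (ltW Mz).
move=> /(integrable_mkcond _ mW); apply: eq_integrable => // p _.
by rewrite patchE; case: ifPn => // /negP Wp; rewrite /= h0 // => /mem_set.
Qed.

Section BorelIntegral.
Context {R : realType} {S : ptopologicalType}.

Lemma borel_open (B : set S) : open B -> measurable (B : set (borel S)).
Proof. exact: sub_sigma_algebra. Qed.

Lemma continuous_borel_measurable (h : S -> R) : continuous h ->
  measurable_fun [set: borel S] (h : borel S -> R).
Proof.
move=> /continuousP ch; apply: (measurability _ (RGenOpens.measurableE R)).
move=> _ [_ [a [b ->] <-]]; rewrite setTI; apply: borel_open.
exact/ch/interval_open.
Qed.

Variable vol : {measure set (borel S) -> \bar R}.

Lemma continuous_integrable (K W : set S) (h : S -> R) : compact K -> K `<=` W -> open W ->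
  (vol W < +oo)%E -> continuous h -> (forall p, ~ K p -> h p = 0) ->
  vol.-integrable [set: borel S] (EFin \o h).
Proof.
move=> cK KW oW Wfin ch h0.
have mW : measurable (W : set (borel S)) by exact: borel_open.
have mh := continuous_borel_measurable ch.
have [M [_ KM]] := compact_bounded (continuous_compact (continuous_subspaceT ch) cK).
have M1 : M < `|M| + 1 by rewrite ltr_pwDr // ler_norm.
have bh p : `|h p| <= `|M| + 1.
  have [Kp|Kp] := pselect (K p).
    by have := KM _ M1 (h p); apply; exists p.
  by rewrite h0 // normr0 addr_ge0.
apply: (bounded_integrable mW Wfin mh bh) => p Wp.
by apply: h0 => /KW.
Qed.

End BorelIntegral.

(** * Integration of continuous functions in a chart *)

Section ChartIntegral.
Context {R : realType} {n : nat} {S : ptopologicalType}.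
Variables (vol : {measure set (borel S) -> \bar R}) (c : chart R n S) (D : 'rV[R]_n -> R).
Hypothesis cD : forall y, cod c y -> {for y, continuous D}.
Hypothesis volE : forall B : set (borel S), measurable B -> B `<=` dom c ->
  vol B = lebesgue_int (fun y => (\1_(cod c `&` param c @^-1` B) y * `|D y|)%:E).

Let absD y : cod c y -> {for y, continuous (fun z => `|D z|)}.
Proof. by move=> cy; exact: (for_continuous_comp (cD cy) (@norm_continuous _ R (D y))). Qed.

(** Local finiteness is extracted from the chart formula: near [p] the indicator times the density
    lies below a bump times the density, whose iterated integral is finite. *)
Lemma chart_nbhs_finite p : dom c p ->
  exists W : set S, [/\ open W, W p, W `<=` dom c & (vol W < +oo)%E].
Proof.
move=> dp; pose y0 := coord c p.
have cy0 : cod c y0 by exact: coord_cod.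
have [b [Kc [Cb b0 [cKc Kcod] bK [rho rho0 b1]]]] := bump_in_open (@cod_open _ _ _ c) cy0.
have [r' r'0 csF] : exists2 r, 0 <= r & csupp r ((fun y => b y * `|D y|) \_ (cod c)).
  apply: (csupp_patch (@cod_open _ _ _ c) cKc Kcod).
    by move=> y _ /bK ->; rewrite mul0r.
  by move=> y cy; apply: for_continuousM; [exact: C1_at_continuous|exact: absD].
exists (dom c `&` coord c @^-1` ball y0 rho); split.
- by apply: chart_set_open; exact: ball_open.
- by split => //=; exact: ballxx.
- by move=> q [].
rewrite volE; last 2 first.
- by apply: borel_open; apply: chart_set_open; exact: ball_open.
- by move=> q [].
apply: (@le_lt_trans _ _ (rint ((fun y => b y * `|D y|) \_ (cod c)))%:E); last exact: ltry.
rewrite -(lebesgue_int_rint r'0 csF); apply: le_lebesgue_int => y.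
  by rewrite lee_fin mulr_ge0.
rewrite lee_fin indicE; have [/set_mem[cy [dy By]]|_] := boolP (y \in _).
  by rewrite patchE mem_set // b1 //; move: By; rewrite /= paramK.
by rewrite mul0r patchE; case: ifP => // _; rewrite mulr_ge0.
Qed.

Variables (K W : set S).
Hypotheses (cK : compact K) (Kc : K `<=` dom c) (oW : open W) (KW : K `<=` W)
  (Wfin : (vol W < +oo)%E).

Definition supported (phi : S -> R) : Prop := continuous phi /\ forall p, ~ K p -> phi p = 0.

Lemma supportedZD a b (phi psi : S -> R) : supported phi -> supported psi ->
  supported (fun t => a * phi t + b * psi t).
Proof.
move=> [cphi phi0] [cpsi psi0]; split => [p|p Kp]; last by rewrite phi0 // psi0 // !mulr0 addr0.
by apply: cvgD; apply: cvgM; [exact: cvg_cst|exact: cphi|exact: cvg_cst|exact: cpsi].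
Qed.

Lemma supported_comp (F : R -> R) (phi : S -> R) : continuous F -> F 0 = 0 -> supported phi ->
  supported (fun t => F (phi t)).
Proof.
move=> cF F0 [cphi phi0]; split => [p|p Kp]; last by rewrite phi0.
have cFp : {for phi p, continuous F} by exact: cF.
exact: (for_continuous_comp (cphi p) cFp).
Qed.

Lemma supported_bounded (phi : S -> R) : supported phi -> exists M : nat, forall t, phi t <= M%:R.
Proof.
move=> [cphi phi0].
have [M [_ KM]] := compact_bounded (continuous_compact (continuous_subspaceT cphi) cK).
have M1 : M < `|M| + 1 by rewrite ltr_pwDr // ler_norm.
exists (Num.trunc (`|M| + 1)).+1 => p; apply: (@le_trans _ _ (`|M| + 1)); last exact/ltW/truncnS_gt.
have [Kp|Kp] := pselect (K p); last by rewrite phi0 // addr_ge0.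
apply: le_trans (ler_norm _) _.
by have := KM _ M1 (phi p); apply; exists p.
Qed.

Let level_open s (h : S -> R) : supported h -> open [set t | s < h t].
Proof.
move=> [ch _]; have -> : [set t | s < h t] = h @^-1` `]s, +oo[%classic.
  by apply/seteqP; split => t /=; rewrite in_itv /= andbT.
by move/continuousP : ch; apply; exact: rray_open.
Qed.

Let level_sub s (h : S -> R) : 0 <= s -> supported h -> [set t | s < h t] `<=` K.
Proof.
move=> s0 [_ h0] t /= st; apply: contrapT => /h0 E; move: st.
by rewrite E ltNge s0.
Qed.

Let level_fin s (h : S -> R) : 0 <= s -> supported h -> vol [set t | s < h t] \is a fin_num.
Proof.
move=> s0 ch; rewrite ge0_fin_numE //; apply: le_lt_trans Wfin.
apply: le_measure; rewrite ?inE; [|exact: borel_open|].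
  by apply: borel_open; exact: level_open.
exact: subset_trans (level_sub s0 ch) KW.
Qed.

Lemma volume_functional :
  positive_functional supported (fun B => fine (vol B)) (fun h => \int[vol]_p h p).
Proof.
have int phi : supported phi -> vol.-integrable [set: borel S] (EFin \o phi).
  by move=> [cphi phi0]; exact: continuous_integrable cK KW oW Wfin cphi phi0.
have mlev s h : supported h -> measurable ([set t | s < h t] : set (borel S)).
  by move=> ch; apply: borel_open; exact: level_open.
have ind s h : 0 <= s -> supported h ->
    \int[vol]_p (\1_[set t | s < h t] p) = fine (vol [set t | s < h t]).
  by move=> s0 ch; rewrite /Rintegral integral_indic ?setIT //; exact: mlev.
have iind s h : 0 <= s -> supported h ->
    vol.-integrable [set: borel S] (EFin \o \1_[set t | s < h t]).
  move=> s0 ch; apply/integrableP; split.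
    by apply/measurable_EFinP; apply: measurable_indic; exact: mlev.
  rewrite (eq_integral (fun p : borel S => (\1_([set t | s < h t] : set (borel S)) p)%:E)); last first.
    by move=> p _; rewrite gee0_abs // lee_fin.
  rewrite integral_indic ?setIT //; last exact: mlev.
  by rewrite -ge0_fin_numE //; exact: level_fin.
split.
- move=> a b phi psi cphi cpsi; rewrite RintegralD //.
  + by rewrite !RintegralZl //; exact: int.
  + exact: (@integrableZl _ _ _ vol _ _ _ _ (int _ cphi)).
  + exact: (@integrableZl _ _ _ vol _ _ _ _ (int _ cpsi)).
- by move=> phi cphi phi0; apply: Rintegral_ge0 => p _.
- move=> s h phi s0 ch cphi phi01 phi0; rewrite -(ind _ _ s0 ch); apply: le_Rintegral => //.
  + exact: int.
  + exact: iind.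
  move=> p _; rewrite indicE; have [_|/negP hs] := boolP (p \in _).
    by have /andP[] := phi01 p.
  by rewrite phi0 // leNgt; apply/negP => sh; apply: hs; exact: mem_set.
- move=> s h phi s0 ch cphi phi0 phi1; rewrite -(ind _ _ s0 ch); apply: le_Rintegral => //.
  + exact: iind.
  + exact: int.
  by move=> p _; rewrite indicE; have [/set_mem/phi1|_] := boolP (p \in _).
Qed.

Definition pull (h : S -> R) : 'rV[R]_n -> R := (fun y => h (param c y) * `|D y|) \_ (cod c).

Lemma csupp_pull h : supported h -> exists2 r, 0 <= r & csupp r (pull h).
Proof.
move=> [ch h0].
apply: (csupp_patch (@cod_open _ _ _ c) (coord_compact cK Kc) (coord_image_cod Kc)).
  by move=> y cy nK; rewrite h0 ?mul0r //; exact: coord_image_param cy nK.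
move=> y cy; apply: for_continuousM; last exact: absD.
by apply: (param_continuous cy); exact: ch.
Qed.

(** Only open superlevel sets inside the chart are measured, so [volE] applies to each of them; the
    comparison with [phi] is pointwise under [lebesgue_int], whose monotonicity needs no
    measurability. *)
Lemma chart_functional :
  positive_functional supported (fun B => fine (vol B)) (fun h => rint (pull h)).
Proof.
have mlev s h : supported h -> measurable ([set t | s < h t] : set (borel S)).
  by move=> ch; apply: borel_open; exact: level_open.
have vE s h : 0 <= s -> supported h -> (fine (vol [set t | s < h t]))%:E =
    lebesgue_int (fun y => (\1_(cod c `&` param c @^-1` [set t | s < h t]) y * `|D y|)%:E).
  move=> s0 ch; rewrite fineK; last exact: level_fin.
  by apply: volE; [exact: mlev|exact: subset_trans (level_sub s0 ch) Kc].
split.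
- move=> a b phi psi cphi cpsi.
  have [r1 r10 c1] := csupp_pull cphi; have [r2 r20 c2] := csupp_pull cpsi.
  have c1' : csupp (Num.max r1 r2) (pull phi) by apply: csupp_widen c1; rewrite le_max lexx.
  have c2' : csupp (Num.max r1 r2) (pull psi) by apply: csupp_widen c2; rewrite le_max lexx orbT.
  rewrite -(rintZD _ _ c1' c2'); congr rint; apply/funext => y; rewrite /pull !patchE.
  by case: ifP => _; [rewrite mulrDl !mulrA|rewrite !mulr0 addr0].
- move=> phi cphi phi0; have [r r0 cr] := csupp_pull cphi.
  apply: (rint_ge0 r0 cr) => y; rewrite /pull patchE.
  by case: ifP => // _; rewrite mulr_ge0.
- move=> s h phi s0 ch cphi phi01 phi0; have [r r0 cr] := csupp_pull cphi.
  rewrite -lee_fin vE // -(lebesgue_int_rint r0 cr); apply: le_lebesgue_int => y.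
    rewrite lee_fin /pull patchE; case: ifP => // _; rewrite mulr_ge0 //.
    by have /andP[] := phi01 (param c y).
  rewrite lee_fin /pull patchE indicE; case: ifPn => [/set_mem cy|_]; last by rewrite mulr_ge0.
  rewrite ler_wpM2r //; have [_|/negP hs] := boolP (y \in _).
    by have /andP[] := phi01 (param c y).
  by rewrite phi0 // leNgt; apply/negP => sh; apply: hs; exact: mem_set.
- move=> s h phi s0 ch cphi phi0 phi1; have [r r0 cr] := csupp_pull cphi.
  rewrite -lee_fin vE // -(lebesgue_int_rint r0 cr); apply: le_lebesgue_int => y.
    by rewrite lee_fin mulr_ge0.
  rewrite lee_fin /pull patchE indicE; have [/set_mem[cy hs]|_] := boolP (y \in _ `&` _).
    by rewrite mem_set // ler_wpM2r //; exact: phi1.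
  by rewrite mul0r; case: ifP => // _; rewrite mulr_ge0.
Qed.

(** The change of variables for continuous functions, although the volume is given in the chart on
    sets only: both sides are positive functionals with the same values on superlevel sets. *)
Lemma chart_integral h : supported h -> \int[vol]_p h p = rint (pull h).
Proof.
exact: (positive_functional_eq supportedZD supported_comp supported_bounded
  volume_functional chart_functional).
Qed.

End ChartIntegral.

Lemma compact_seq_cover (S : ptopologicalType) (K : set S) (W : S -> set S) :
  compact K -> (forall p, open (W p) /\ W p p) ->
  exists s : seq S, forall q, K q -> exists2 p, p \in s & W p q.
Proof.
rewrite compact_cover => cK oW.
have [F _ KF] := cK S K W (fun p _ => (oW p).1) (fun q Kq => ex_intro2 _ _ q Kq (oW q).2).
by exists (finmap.enum_fset F) => q /KF [p pF Wq]; exists p.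
Qed.

Section ChartC1.
Context {R : realType} {n : nat} {S : ptopologicalType}.
Local Notation e i := (delta_mx 0 i : 'rV[R]_n).
Variable A : set (chart R n S).
Hypotheses (hS : hausdorff_space S) (covA : covering A).
Hypothesis smA : forall c1 c2, A c1 -> A c2 -> smooth_on (overlap c1 c2) (transition c1 c2).

Definition chart_C1 (psi : S -> R) : Prop :=
  forall c, A c -> forall y, cod c y -> C1_at (fun z => psi (param c z)) y.

Lemma overlap_open (c1 c2 : chart R n S) : open (overlap c1 c2).
Proof.
rewrite openE => y [cy dy]; apply: filterI.
  by apply: open_nbhs_nbhs; split => //; exact: cod_open.
by apply: (param_cts cy); apply: open_nbhs_nbhs; split => //; exact: dom_open.
Qed.

Lemma transition_C1_at (c1 c2 : chart R n S) y : A c1 -> A c2 -> overlap c1 c2 y ->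
  forall l, C1_at (fun z => transition c1 c2 z 0 l) y.
Proof.
move=> A1 A2 oy l.
exact: (Ck_on1_C1_at (@overlap_open c1 c2) (smA A1 A2 1%N) oy l).
Qed.

Lemma transition_differentiable (c1 c2 : chart R n S) y : A c1 -> A c2 -> overlap c1 c2 y ->
  differentiable (transition c1 c2) y.
Proof.
move=> A1 A2 oy; exact: (Ck_on1_differentiable (@overlap_open c1 c2) (smA A1 A2 1%N) oy).
Qed.

Lemma transition_near (T : Type) (psi : S -> T) (c1 c2 : chart R n S) y : overlap c1 c2 y ->
  \forall z \near y, psi (param c1 z) = psi (param c2 (transition c1 c2 z)).
Proof.
move=> oy; have : \forall z \near y, overlap c1 c2 z.
  by apply: open_nbhs_nbhs; split => //; exact: overlap_open.
by apply: filterS => z [_ dz]; rewrite /transition /= coordK.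
Qed.

Lemma chart_C1_change psi (c1 c2 : chart R n S) y i : chart_C1 psi -> A c1 -> A c2 ->
  overlap c1 c2 y ->
  'D_(e i) (fun z => psi (param c1 z)) y =
  \sum_l 'J (transition c1 c2) y i l *
     'D_(e l) (fun z => psi (param c2 z)) (transition c1 c2 y).
Proof.
move=> Cpsi A1 A2 oy; rewrite (near_eq_derive _ (transition_near psi oy)).
have dt := transition_differentiable A1 A2 oy.
have c2y : cod c2 (transition c1 c2 y) by apply: coord_cod; have [] := oy.
have dpsi : differentiable (fun z => psi (param c2 z)) (transition c1 c2 y).
  by apply: C1_at_diff; exact: Cpsi.
rewrite (derive_comp (H := fun z => psi (param c2 z)) _ dt dpsi).
rewrite derive_partials //; apply: eq_bigr => l _.
by rewrite derive_row // mxE -jacobian_entry.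
Qed.

Lemma chart_C1_continuous psi : chart_C1 psi -> continuous psi.
Proof.
move=> Cpsi p; have [c Ac dp] := covA p.
apply: (coord_continuous_inv dp); apply: C1_at_continuous; apply: Cpsi => //.
exact: coord_cod.
Qed.

Lemma chart_C1ZD a b psi phi : chart_C1 psi -> chart_C1 phi ->
  chart_C1 (fun p => a * psi p + b * phi p).
Proof.
move=> Cpsi Cphi c Ac y cy; apply: C1_atD; apply: C1_atM;
  by [exact: C1_at_cst|exact: Cpsi|exact: Cphi].
Qed.

Lemma chart_C1M psi phi : chart_C1 psi -> chart_C1 phi -> chart_C1 (fun p => psi p * phi p).
Proof. by move=> Cpsi Cphi c Ac y cy; apply: C1_atM; [exact: Cpsi|exact: Cphi]. Qed.

(** A Euclidean bump is transported by one chart and extended by zero. In another chart it is C1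
    through the transition map where the two charts meet. *)
Lemma manifold_bump p : exists c (beta : S -> R) (K W : set S),
  [/\ A c, chart_C1 beta, compact K /\ K `<=` dom c, forall q, ~ K q -> beta q = 0 &
   [/\ open W, W p & forall q, W q -> beta q = 1]].
Proof.
have [c Ac dp] := covA p.
have cy0 : cod c (coord c p) by exact: coord_cod.
have [b [Kc [Cb _ [cKc Kcod] bK [rho rho0 b1]]]] := bump_in_open (@cod_open _ _ _ c) cy0.
have cK : compact (param c @` Kc) by exact: param_compact.
have Kd : param c @` Kc `<=` dom c by move=> _ [y /Kcod cy <-]; exact: param_dom.
pose beta : S -> R := (b \o coord c) \_ (dom c).
have b0 q : ~ (param c @` Kc) q -> beta q = 0.
  move=> nK; rewrite /beta patchE; case: ifPn => // /set_mem dq /=; apply: bK => Kq.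
  by apply: nK; exists (coord c q) => //; exact: coordK.
exists c, beta, (param c @` Kc), (dom c `&` coord c @^-1` ball (coord c p) rho).
split => //; last first.
  split.
  - by apply: chart_set_open; exact: ball_open.
  - by split => //=; exact: ballxx.
  - by move=> q [dq Bq]; rewrite /beta patchE mem_set //=; exact: b1.
move=> c' Ac' y cy.
have [dy|dy] := pselect (dom c (param c' y)).
  have oy : overlap c' c y by [].
  apply: (C1_at_near (G := fun z => b (transition c' c z))).
    have : \forall z \near y, overlap c' c z.
      by apply: open_nbhs_nbhs; split => //; exact: overlap_open.
    by apply: filterS => z [_ dz]; rewrite /beta patchE mem_set.
  apply: (C1_at_comp (G := transition c' c) (H := b)) => // l.
  exact: (transition_C1_at Ac' Ac oy l).
(* Outside the domain of [c] the function vanishes near the point, because the compact support is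
   closed in a Hausdorff space. *)
apply: C1_at_near (C1_at_cst 0 y).
have : \forall z \near param c' y, (~` (param c @` Kc)) z.
  apply: open_nbhs_nbhs; split; last by move=> /Kd.
  by apply: closed_openC; exact: (compact_closed hS cK).
move=> /(param_cts cy) nK.
have : \forall z \near y, ~ (param c @` Kc) (param c' z) by exact: nK.
by apply: filterS => z /b0.
Qed.

End ChartC1.

(** * The divergence theorem *)

Section DivergenceTheorem.
Context {R : realType} {n : nat} {S : ptopologicalType}.
Local Notation e i := (delta_mx 0 i : 'rV[R]_n).
Variables (A : set (chart R n S)) (vol : {measure set (borel S) -> \bar R}).
Hypotheses (hS : hausdorff_space S) (covA : covering A).
Hypothesis smA : forall c1 c2, A c1 -> A c2 -> smooth_on (overlap c1 c2) (transition c1 c2).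
Variables (Z : chart R n S -> 'I_n -> 'rV[R]_n -> R) (D : chart R n S -> 'rV[R]_n -> R).
Variable h : S -> R.
Hypothesis CZ : forall c, A c -> forall y, cod c y -> forall j, C1_at (Z c j) y.
Hypothesis CD : forall c, A c -> forall y, cod c y -> C1_at (D c) y.
Hypothesis D0 : forall c, A c -> forall y, cod c y -> D c y != 0.
Hypothesis divZ : forall c, A c -> forall y, cod c y ->
  \sum_j 'D_(e j) (Z c j) y = h (param c y) * D c y.
Hypothesis changeZ : forall c1 c2, A c1 -> A c2 -> forall y, overlap c1 c2 y -> forall l,
  \sum_j Z c1 j y / D c1 y * 'J (transition c1 c2) y j l =
  Z c2 l (transition c1 c2 y) / D c2 (transition c1 c2 y).
Hypothesis volE : forall c, A c -> forall B : set (borel S), measurable B -> B `<=` dom c ->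
  vol B = lebesgue_int (fun y => (\1_(cod c `&` param c @^-1` B) y * `|D c y|)%:E).

(** The derivative of [psi] along the vector field with coordinates [Z c j / D c]; in the quotient
    the sign of the density cancels. *)
Definition flux_derivative (c : chart R n S) (psi : S -> R) (y : 'rV[R]_n) : R :=
  \sum_j Z c j y / D c y * 'D_(e j) (fun z => psi (param c z)) y.

Lemma flux_derivative_change psi (c1 c2 : chart R n S) y : chart_C1 A psi -> A c1 -> A c2 ->
  overlap c1 c2 y ->
  flux_derivative c1 psi y = flux_derivative c2 psi (transition c1 c2 y).
Proof.
move=> Cpsi A1 A2 oy; rewrite /flux_derivative.
under eq_bigr do rewrite (chart_C1_change smA _ Cpsi A1 A2 oy) mulr_sumr.
rewrite exchange_big /=; apply: eq_bigr => l _.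
rewrite -(changeZ A1 A2 oy) mulr_suml; apply: eq_bigr => j _.
by rewrite mulrA.
Qed.

Definition chart_at (p : S) : chart R n S := projT1 (cid2 (covA p)).

Lemma chart_at_atlas p : A (chart_at p).
Proof. by rewrite /chart_at; case: cid2. Qed.

Lemma chart_at_dom p : dom (chart_at p) p.
Proof. by rewrite /chart_at; case: cid2. Qed.

(** The divergence of [psi] times the field, by the product rule, in a chosen chart around [p];
    [flux_divergenceE] shows that any other chart gives the same value. *)
Definition flux_divergence (psi : S -> R) (p : S) : R :=
  flux_derivative (chart_at p) psi (coord (chart_at p) p) + psi p * h p.

Lemma flux_divergenceE psi c y : chart_C1 A psi -> A c -> cod c y ->
  flux_divergence psi (param c y) =
  flux_derivative c psi y + psi (param c y) * h (param c y).
Proof.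
move=> Cpsi Ac cy; set p := param c y; congr (_ + _).
have dp : dom c p by exact: param_dom.
have oy : overlap c (chart_at p) y by split => //; exact: chart_at_dom.
by rewrite (flux_derivative_change Cpsi Ac (chart_at_atlas p) oy).
Qed.

Lemma flux_divergenceZD a b psi phi p : chart_C1 A psi -> chart_C1 A phi ->
  flux_divergence (fun q => a * psi q + b * phi q) p =
  a * flux_divergence psi p + b * flux_divergence phi p.
Proof.
move=> Cpsi Cphi; rewrite /flux_divergence /flux_derivative.
set c := chart_at p; set y := coord c p.
have cy : cod c y by apply: coord_cod; exact: chart_at_dom.
have Ac := chart_at_atlas p.
have D1 j : 'D_(e j) (fun z => a * psi (param c z) + b * phi (param c z)) y =
   a * 'D_(e j) (fun z => psi (param c z)) y + b * 'D_(e j) (fun z => phi (param c z)) y.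
  have d1 := C1_at_derivable (v := e j) (Cpsi c Ac y cy).
  have d2 := C1_at_derivable (v := e j) (Cphi c Ac y cy).
  have H1 : is_derive y (e j) (fun z => a * psi (param c z)) (a * 'D_(e j) (fun z => psi (param c z)) y).
    exact: (is_deriveZ a (derivableP d1)).
  have H2 : is_derive y (e j) (fun z => b * phi (param c z)) (b * 'D_(e j) (fun z => phi (param c z)) y).
    exact: (is_deriveZ b (derivableP d2)).
  exact: (@derive_val _ _ _ _ _ _ _ (is_deriveD H1 H2)).
under eq_bigr do rewrite D1 mulrDr mulrCA [X in _ + X]mulrCA.
rewrite big_split /= -!mulr_sumr; move: (\sum_(_ < n) _) (\sum_(_ < n) _) => s1 s2.
by move: (psi p) (phi p) (h p) => u v w; ring.
Qed.

Lemma flux_divergence_near0 psi p : (\forall q \near p, psi q = 0) -> flux_divergence psi p = 0.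
Proof.
move=> psi0; rewrite /flux_divergence (nbhs_singleton psi0) mul0r addr0.
set c := chart_at p; have dp : dom c p by exact: chart_at_dom.
have cy : cod c (coord c p) by exact: coord_cod.
rewrite /flux_derivative big1 // => j _.
rewrite (@near_eq_derive R _ R _ (cst 0)) ?derive_cst ?mulr0 //.
have : nbhs (param c (coord c p)) (fun q => psi q = 0) by rewrite coordK.
by move=> /(param_cts cy).
Qed.

Lemma flux_divergence_chart_continuous psi c y : chart_C1 A psi -> A c -> cod c y ->
  {for y, continuous (fun z => flux_divergence psi (param c z))}.
Proof.
move=> Cpsi Ac cy.
have cDV : {for y, continuous (fun z => (D c z)^-1)}.
  by apply: for_continuousV; [exact: D0|exact: C1_at_continuous (CD Ac cy)].
(* Continuity of [h] is not assumed: near [y] it is recovered as the coordinate divergence of [Z]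
   divided by [D]. *)
apply: (@for_continuous_near R _ (fun z => flux_derivative c psi z +
    psi (param c z) * ((\sum_j 'D_(e j) (Z c j) z) * (D c z)^-1))).
  have : \forall z \near y, cod c z by apply: open_nbhs_nbhs; split => //; exact: cod_open.
  apply: filterS => z cz; rewrite flux_divergenceE //; congr (_ + _ * _).
  by rewrite divZ // mulfK // D0.
apply: for_continuousD.
  apply: for_continuous_sum => j _; apply: for_continuousM.
    by apply: for_continuousM => //; apply: C1_at_continuous; exact: CZ.
  by have [_] := Cpsi c Ac y cy; exact.
apply: for_continuousM; first exact: C1_at_continuous (Cpsi c Ac y cy).
apply: for_continuousM => //; apply: for_continuous_sum => j _.
by have [_] := CZ Ac cy j; exact.
Qed.

Lemma flux_divergence_continuous psi : chart_C1 A psi -> continuous (flux_divergence psi).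
Proof.
move=> Cpsi p; have [c Ac dp] := covA p.
apply: (coord_continuous_inv dp); apply: flux_divergence_chart_continuous => //.
exact: coord_cod.
Qed.

Lemma flux_divergence_supported psi K : compact K -> chart_C1 A psi ->
  (forall p, ~ K p -> psi p = 0) -> supported K (flux_divergence psi).
Proof.
move=> cK Cpsi psi0; split; first exact: flux_divergence_continuous.
move=> p Kp; apply: flux_divergence_near0.
have oK : open (~` K) by exact: (closed_openC (compact_closed hS cK)).
have : \forall q \near p, (~` K) q by apply: open_nbhs_nbhs.
by apply: filterS => q /psi0.
Qed.

Lemma finite_volume_nbhs (K : set S) : compact K ->
  exists W : set S, [/\ open W, K `<=` W & (vol W < +oo)%E].
Proof.
move=> cK.
have loc p : exists W : set S, [/\ open W, W p & (vol W < +oo)%E].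
  have [c Ac dp] := covA p.
  have [|W [oW Wp _ Wf]] := @chart_nbhs_finite R n S vol c (D c) _ (volE Ac) p dp.
    by move=> y cy; exact: C1_at_continuous (CD Ac cy).
  by exists W.
pose W p := projT1 (cid (loc p)).
have WP p : [/\ open (W p), W p p & (vol (W p) < +oo)%E] by rewrite /W; case: cid.
have [s Ks] := compact_seq_cover cK (fun p => let: And3 o i _ := WP p in conj o i).
have [V [oV sV Vf]] : exists V : set S, [/\ open V, forall q, (exists2 p, p \in s & W p q) -> V q &
    (vol V < +oo)%E].
  elim: s {Ks} => [|p s [V [oV sV Vf]]].
    by exists set0; split; [exact: open0|by move=> q []|rewrite measure0].
  have [oW _ Wf] := WP p; exists (W p `|` V); split; first exact: openU.
    move=> q [p']; rewrite inE => /predU1P[->|p's] Wq; first by left.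
    by right; apply: sV; exists p'.
  apply: le_lt_trans (measureU2 _ (borel_open oW) (borel_open oV)) _.
  by rewrite lte_add_pinfty.
by exists V; split => // q /Ks /sV.
Qed.

(** In the chart the integrand is [|D|] times the divergence, a sum of partial derivatives of
    compactly supported C1 functions, each of integral zero. *)
Lemma divergence_chart psi c K : A c -> compact K -> K `<=` dom c -> chart_C1 A psi ->
  (forall p, ~ K p -> psi p = 0) -> \int[vol]_p flux_divergence psi p = 0.
Proof.
move=> Ac cK Kc Cpsi psi0; have [W [oW KW Wf]] := finite_volume_nbhs cK.
have cD y : cod c y -> {for y, continuous (D c)}.
  by move=> cy; exact: C1_at_continuous (CD Ac cy).
rewrite (chart_integral cD (volE Ac) cK Kc oW KW Wf); last exact: flux_divergence_supported.
pose eps y := Num.sg (D c y).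
pose F j := (fun y => eps y * (Z c j y * psi (param c y))) \_ (cod c).
have ocK := coord_image_cod Kc.
have ccK := coord_compact cK Kc.
have g0 j y : cod c y -> ~ (coord c @` K) y -> eps y * (Z c j y * psi (param c y)) = 0.
  by move=> cy nK; rewrite psi0 ?mulr0 //; exact: coord_image_param cy nK.
(* [D] is continuous without zeros, so its sign is locally constant and passes through derivatives;
   this handles [|D|] without any choice of orientation. *)
have eps_near y : cod c y -> \forall z \near y, eps z = eps y.
  move=> cy; have Dy0 := D0 Ac cy.
  have /for_continuous_dist/(_ (`|D c y| / 2)) [|d d0 dD] := cD y cy.
    by rewrite divr_gt0 // normr_gt0.
  apply/nbhs_ballP; exists d => // z; rewrite -ball_normE /= => /dD.
  rewrite /eps; have [Dp|Dn|D00] := ltrgt0P (D c y).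
  - by move=> /ler_normlP[h1 h2]; rewrite !gtr0_sg //; lra.
  - by move=> /ler_normlP[h1 h2]; rewrite !ltr0_sg //; lra.
  - by rewrite D00 eqxx in Dy0.
have Cg j y : cod c y -> C1_at (fun z => Z c j z * psi (param c z)) y.
  by move=> cy; apply: C1_atM; [exact: CZ|exact: Cpsi].
have Cge j y : cod c y -> C1_at (fun z => eps z * (Z c j z * psi (param c z))) y.
  move=> cy; apply: (C1_at_near (G := fun z => eps y * (Z c j z * psi (param c z)))).
    by apply: filterS (eps_near y cy) => z ->.
  by apply: C1_atM; [exact: C1_at_cst|exact: Cg].
have oc := @cod_open _ _ _ c.
have CF j : forall y, C1_at (F j) y := C1_at_patch oc ccK ocK (g0 j) (Cge j).
have sF j : exists2 r, 0 <= r & csupp r (F j).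
  by apply: (csupp_patch oc ccK ocK (g0 j)) => y cy; exact: C1_at_continuous (Cge j y cy).
have DF j : rint ('D_(e j) (F j)) = 0.
  by have [r r0 cr] := sF j; exact: rint_derive r0 cr (CF j).
have -> : pull c (D c) (flux_divergence psi) = (fun y => \sum_j 'D_(e j) (F j) y).
  apply/funext => y; rewrite /pull patchE; case: ifPn => [/set_mem cy|/negP ncy]; last first.
    rewrite big1 // => j _; rewrite (derive_patch oc ccK ocK (g0 j)) patchE.
    by case: ifPn => // /ncy.
  rewrite flux_divergenceE // mulrDl.
  have -> : `|D c y| = eps y * D c y by rewrite -normrEsg.
  transitivity (\sum_j eps y * ('D_(e j) (Z c j) y * psi (param c y)
      + Z c j y * 'D_(e j) (fun z => psi (param c z)) y)).
    rewrite -mulr_sumr big_split /= -mulr_suml (divZ Ac cy) /flux_derivative mulrDr addrC.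
    congr (_ + _); first by rewrite mulrA mulrC !mulrA; ring.
    rewrite mulrC -mulrA; congr (_ * _); rewrite mulr_sumr; apply: eq_bigr => j _.
    by rewrite mulrA [D c y * _]mulrC divfK // D0.
  apply: eq_bigr => j _; rewrite (derive_patch oc ccK ocK (g0 j)) patchE mem_set //.
  rewrite (@near_eq_derive R _ R (fun z => eps z * (Z c j z * psi (param c z)))
    (fun z => eps y * (Z c j z * psi (param c z)))); last first.
    by apply: filterS (eps_near y cy) => z /= ->.
  have dZ := derivableP (C1_at_derivable (v := e j) (CZ Ac cy j)).
  have dpsi := derivableP (C1_at_derivable (v := e j) (Cpsi c Ac y cy)).
  have H : is_derive y (e j) (fun z => eps y * (Z c j z * psi (param c z))) _ :=
    is_deriveZ (eps y) (is_deriveM dZ dpsi).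
  rewrite (@derive_val _ _ _ _ _ _ _ H) -[RHS]/(_ * _); congr (_ * _).
  by rewrite -[RHS]/(_ * _ + _ * _) addrC; congr (_ + _); rewrite mulrC.
have rint_sum (s : seq 'I_n) : exists2 r, 0 <= r & csupp r (fun y => \sum_(j <- s) 'D_(e j) (F j) y) /\
    rint (fun y => \sum_(j <- s) 'D_(e j) (F j) y) = 0.
  elim: s => [|j s [r r0 [cr Ir]]].
    have c0 : csupp 0 (fun _ : 'rV[R]_n => 0 : R) by split => // y; exact: cst_continuous.
    exists 0 => //; under eq_fun do rewrite big_nil.
    split => //; have := rintZD 0 0 c0 c0; rewrite !mul0r addr0 => h0; rewrite -[RHS]h0.
    by congr rint; apply/funext => y; rewrite mul0r addr0.
  have [r' r'0 cr'] := sF j.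
  have c1 : csupp (Num.max r r') (fun y => \sum_(j <- s) 'D_(e j) (F j) y).
    by apply: csupp_widen cr; rewrite le_max lexx.
  have c2 : csupp (Num.max r r') ('D_(e j) (F j)).
    apply: csupp_widen (csupp_derive (e j) cr' (CF j)).
    by rewrite le_max lexx orbT.
  exists (Num.max r r'); first by rewrite le_max r0.
  have E : (fun y => \sum_(i <- j :: s) 'D_(e i) (F i) y) =
      (fun y => 1 * 'D_(e j) (F j) y + 1 * (\sum_(i <- s) 'D_(e i) (F i) y)).
    by apply/funext => y; rewrite big_cons !mul1r.
  rewrite E; split; first exact: csuppZD.
  by rewrite (rintZD _ _ c2 c1) DF Ir !mulr0 addr0.
by have [r _ [_ ]] := rint_sum (index_enum 'I_n).
Qed.

(** Induction on a finite cover of the support, in place of a partition of unity: a bump equal to 1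
    on one member splits off a summand living in a single chart. *)
Theorem divergence_theorem psi K : compact K -> chart_C1 A psi ->
  (forall p, ~ K p -> psi p = 0) -> \int[vol]_p flux_divergence psi p = 0.
Proof.
move=> cK Cpsi psi0.
pose Q (W : set S) := exists c (beta : S -> R) (L : set S),
  [/\ A c, chart_C1 A beta, compact L /\ L `<=` dom c, forall q, ~ L q -> beta q = 0 &
   forall q, W q -> beta q = 1].
have loc p : exists W : set S, [/\ open W, W p & Q W].
  have [c [beta [L [W [Ac Cb cL b0 [oW Wp b1]]]]]] := manifold_bump hS covA smA p.
  by exists W; split => //; exists c, beta, L.
pose W p := projT1 (cid (loc p)).
have WP p : [/\ open (W p), W p p & Q (W p)] by rewrite /W; case: cid.
have [s Ks] := compact_seq_cover cK (fun p => let: And3 o i _ := WP p in conj o i).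
elim: s psi K cK Cpsi psi0 Ks => [|p s IH] psi K cK Cpsi psi0 Ks.
  rewrite (@eq_Rintegral _ _ _ _ _ (cst 0)) ?Rintegral_cst ?mul0r //.
  move=> q _ /=; apply: flux_divergence_near0; apply: filterE => q'; apply: psi0.
  by move=> /Ks[].
have [oW _ [c [beta [L [Ac Cb [cL Lc] b0 b1]]]]] := WP p.
pose psi1 q := beta q * psi q.
pose psi2 q := (1 * 1 + -1 * beta q) * psi q.
have C1 : chart_C1 A (fun=> 1 : R) by move=> c' Ac' y cy; exact: C1_at_cst.
have Cpsi1 : chart_C1 A psi1 by exact: chart_C1M.
have Cpsi2 : chart_C1 A psi2 by exact: (chart_C1M (chart_C1ZD 1 (-1) C1 Cb) Cpsi).
have s1 q : ~ L q -> psi1 q = 0 by move=> /b0; rewrite /psi1 => ->; rewrite mul0r.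
(* Since [1 - beta] vanishes on [W p], the remaining summand is supported in [K] minus [W p], which
   the shorter list covers. *)
have cK2 : compact (K `&` ~` W p) by apply: compact_closedI => //; exact: open_closedC.
have s2 q : ~ (K `&` ~` W p) q -> psi2 q = 0.
  move=> nK; rewrite /psi2; have [Kq|/psi0 ->] := pselect (K q); last by rewrite mulr0.
  have [Wq|Wq] := pselect (W p q); last by exfalso; apply: nK.
  by rewrite b1 // mulr1 mulN1r subrr mul0r.
have I1 := divergence_chart Ac cL Lc Cpsi1 s1.
have I2 : \int[vol]_p flux_divergence psi2 p = 0.
  apply: (IH psi2 _ cK2 Cpsi2 s2) => q [/Ks[p' p's Wq] nW]; exists p' => //.
  by move: p's; rewrite inE => /predU1P[E|//]; rewrite E in Wq.
have int phi L' : compact L' -> chart_C1 A phi -> (forall q, ~ L' q -> phi q = 0) ->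
    vol.-integrable [set: borel S] (EFin \o flux_divergence phi).
  move=> cL' Cphi phi0; have [V [oV LV Vf]] := finite_volume_nbhs cL'.
  have [cG G0] := flux_divergence_supported cL' Cphi phi0.
  exact: continuous_integrable cL' LV oV Vf cG G0.
rewrite (@eq_Rintegral _ _ _ _ _
  ((fun q : S => flux_divergence psi1 q + flux_divergence psi2 q) : borel S -> R)).
  rewrite RintegralD ?I1 ?I2 ?addr0 //; [exact: int cL Cpsi1 s1|exact: int cK2 Cpsi2 s2].
move=> q _; rewrite -[RHS]/(_ + _) -(mul1r (flux_divergence psi1 q)) -(mul1r (flux_divergence psi2 q)).
rewrite -flux_divergenceZD //; congr (flux_divergence _ q); apply/funext => z.
by rewrite /psi1 /psi2; ring.
Qed.

End DivergenceTheorem.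

(** * The weighted inequality on a hypersurface *)

Lemma manifold_covering (R : realType) (n : nat) (S : topologicalType) (A : set (chart R n S)) :
  smooth_manifold A -> covering A.
Proof. by case=> _ _ []. Qed.

Section Geometry.
Context {R : realType} {n k : nat} {S : ptopologicalType}.
Local Notation e i := (delta_mx 0 i : 'rV[R]_n).
Variables (A : set (chart R n S)) (x nu : S -> 'rV[R]_n.+1) (lam : S -> 'I_n -> R)
  (vol : {measure set (borel S) -> \bar R}).
Hypotheses (kn : (k < n)%N) (mS : smooth_manifold A) (imm : immersion A x)
  (un : unit_normal A x nu) (pc : principal_curvatures A x nu lam)
  (rv : riemannian_volume A x vol).

Let Xc (c : chart R n S) := x \o param c.
Let Nc (c : chart R n S) := nu \o param c.

Let sXc c : A c -> Ck_on (cod c) 2 (Xc c).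
Proof. by move=> Ac; exact: (imm.1 c Ac 2%N). Qed.

Let sNc c : A c -> Ck_on (cod c) 2 (Nc c).
Proof. by move=> Ac; case: un => sN _ _; exact: (sN c Ac 2%N). Qed.

Lemma normal_unit p : dot (nu p) (nu p) = 1.
Proof. by case: un => _ nu1 _; rewrite -enorm_sqr nu1 expr1n. Qed.

Let Nc1 c y : cod c y -> dot (Nc c y) (Nc c y) = 1.
Proof. by move=> _; exact: normal_unit. Qed.

Let XNc c : A c -> forall y, cod c y -> forall i, dot (row i ('J (Xc c) y)) (Nc c y) = 0.
Proof. by move=> Ac y cy i; case: un => _ _; apply. Qed.

Let Xcf c : A c -> forall y, cod c y -> row_free ('J (Xc c) y).
Proof. by move=> Ac y cy; exact: imm.2. Qed.

Let lamc c : A c -> forall y, cod c y ->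
  char_poly ('J (Nc c) y *m pinvmx ('J (Xc c) y)) = \prod_i ('X - (lam (param c y) i)%:P).
Proof. by move=> Ac y cy; exact: pc. Qed.

Definition newton_weight : 'I_n -> R := projT1 (cid (newton_weights kn)).

Let cE : forall (C : 'M[R]_n) (mu : 'I_n -> R), char_poly C = \prod_i ('X - (mu i)%:P) ->
  newton C (fun l => sigma l mu) k = \sum_i newton_weight i *: \adj (1%:M + i%:R *: C).
Proof. by rewrite /newton_weight; case: cid. Qed.

Definition chart_flux (c : chart R n S) (j : 'I_n) : 'rV[R]_n -> R :=
  newton_flux (x \o param c) (nu \o param c) newton_weight j.

Definition chart_volume (c : chart R n S) : 'rV[R]_n -> R :=
  frame_volume (x \o param c) (nu \o param c).

Definition height (p : S) : R := dot (2^-1 *: x p) (nu p).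

Definition position_divergence (p : S) : R :=
  2^-1 * ((n - k)%:R * sigma k (lam p)) - height p * (k.+1%:R * sigma k.+1 (lam p)).

Lemma newton_mxE c y :
  newton_mx x nu lam k c y = newton (shape_mx x nu c y) (fun l => sigma l (lam (param c y))) k.
Proof. by elim: k => [//|l IH] /=; rewrite IH. Qed.

Lemma chart_fluxE c y v : A c -> cod c y ->
  2^-1 *: x (param c y) = height (param c y) *: nu (param c y) + v *m tangent_basis x c y ->
  forall j, chart_flux c j y / chart_volume c y = (v *m newton_mx x nu lam k c y) 0 j.
Proof.
move=> Ac cy E j; rewrite newton_mxE.
have D0 : chart_volume c y != 0.
  exact: (frame_volume_neq0 (@Nc1 c) (XNc Ac) (Xcf Ac) cy).
rewrite /chart_flux (newton_fluxE (@cod_open _ _ _ c) (sNc Ac) (@Nc1 c) (XNc Ac) (Xcf Ac)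
  (lamc Ac) cE j cy E).
by rewrite mulfK.
Qed.

Lemma tangent_decomposition c y : A c -> cod c y -> exists v,
  2^-1 *: x (param c y) = height (param c y) *: nu (param c y) + v *m tangent_basis x c y.
Proof.
move=> Ac cy.
exact: (frame_decomposition (Nc1 cy) (XNc Ac cy) (Xcf Ac cy) (2^-1 *: x (param c y))).
Qed.

Lemma coordinate_chart_C1 (F : S -> 'rV[R]_n.+1) a : smooth_map A F -> chart_C1 A (fun p => F p 0 a).
Proof.
move=> sF c Ac y cy.
exact: (Ck_on1_C1_at (@cod_open _ _ _ c) (sF c Ac 1%N) cy a).
Qed.

Lemma jacobian_change (F : S -> 'rV[R]_n.+1) c1 c2 y : smooth_map A F -> A c1 -> A c2 ->
  overlap c1 c2 y ->
  'J (F \o param c1) y = 'J (transition c1 c2) y *m 'J (F \o param c2) (transition c1 c2 y).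
Proof.
move=> sF A1 A2 oy; have [_ _ [_ smA]] := mS.
have c1y : cod c1 y by case: oy.
have c2y : cod c2 (transition c1 c2 y) by apply: coord_cod; case: oy.
have dF c z : A c -> cod c z -> differentiable (F \o param c) z.
  by move=> Ac cz; exact: (Ck_on1_differentiable (@cod_open _ _ _ c) (sF c Ac 1%N) cz).
apply/matrixP => i a; rewrite (jacobian_entry _ _ (dF c1 y A1 c1y)).
rewrite [RHS]mxE (chart_C1_change smA i (coordinate_chart_C1 a sF) A1 A2 oy).
apply: eq_bigr => l _; congr (_ * _).
by rewrite (jacobian_entry _ _ (dF c2 _ A2 c2y)).
Qed.

(** The shape matrices in two charts are intertwined by the Jacobian of the transition, because both
    represent the derivative of [nu] in the tangent basis; the Newton recursion inherits this. *)
Lemma newton_mx_change c1 c2 y : A c1 -> A c2 -> overlap c1 c2 y ->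
  newton_mx x nu lam k c1 y *m 'J (transition c1 c2) y =
  'J (transition c1 c2) y *m newton_mx x nu lam k c2 (transition c1 c2 y).
Proof.
move=> A1 A2 oy; set J := 'J _ y; set y2 := transition c1 c2 y.
have c1y : cod c1 y by case: oy.
have c2y : cod c2 y2 by apply: coord_cod; case: oy.
have pE : param c2 y2 = param c1 y by case: oy => _ dy; rewrite /y2 /transition /= coordK.
have TE : tangent_basis x c1 y = J *m tangent_basis x c2 y2 by exact: (jacobian_change imm.1).
have wein c z : A c -> cod c z -> shape_mx x nu c z *m tangent_basis x c z = 'J (nu \o param c) z.
  move=> Ac cz.
  exact: (weingarten (@cod_open _ _ _ c) (sNc Ac) (@Nc1 c) (XNc Ac) (Xcf Ac) cz).
have SE : shape_mx x nu c1 y *m J = J *m shape_mx x nu c2 y2.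
  apply: (row_free_inj (Xcf A2 c2y)); transitivity ('J (nu \o param c1) y).
    by rewrite -mulmxA -(wein c1 y A1 c1y); congr (_ *m _); exact: esym TE.
  case: un => sN _ _; rewrite (jacobian_change sN A1 A2 oy) -[RHS]mulmxA; congr (_ *m _).
  exact: esym (wein c2 y2 A2 c2y).
rewrite !newton_mxE pE; move: SE; clear TE wein.
move: (shape_mx x nu c1 y) (shape_mx x nu c2 y2) J => S1 S2 J SE.
elim: k => [|l IH] /=; first by rewrite mul1mx mulmx1.
by rewrite mulmxBl mulmxBr scalar_mxC -mulmxA SE !mulmxA IH.
Qed.

(** The quotients are the coordinates of one geometric tangent vector, the Newton transformation of
    the tangent part of [x / 2]; they transform by the Jacobian. *)
Lemma chart_flux_change c1 c2 : A c1 -> A c2 -> forall y, overlap c1 c2 y -> forall l,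
  \sum_j chart_flux c1 j y / chart_volume c1 y * 'J (transition c1 c2) y j l =
  chart_flux c2 l (transition c1 c2 y) / chart_volume c2 (transition c1 c2 y).
Proof.
move=> A1 A2 y oy l; set J := 'J _ y; set y2 := transition c1 c2 y.
have c1y : cod c1 y by case: oy.
have c2y : cod c2 y2 by apply: coord_cod; case: oy.
have pE : param c2 y2 = param c1 y by case: oy => _ dy; rewrite /y2 /transition /= coordK.
have TE : tangent_basis x c1 y = J *m tangent_basis x c2 y2 by exact: (jacobian_change imm.1).
have [v Ev] := tangent_decomposition A1 c1y.
have [w Ew] := tangent_decomposition A2 c2y.
have vw : v *m J = w.
  have TT : v *m tangent_basis x c1 y = w *m tangent_basis x c2 y2.
    apply: (addrI (height (param c1 y) *: nu (param c1 y))).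
    by have := Ew; rewrite pE; exact: etrans (esym Ev).
  apply: (row_free_inj (Xcf A2 c2y)); rewrite -mulmxA.
  exact: (etrans (congr1 (mulmx v) (esym TE)) TT).
transitivity ((w *m newton_mx x nu lam k c2 y2) 0 l); last exact/esym/(chart_fluxE A2 c2y Ew).
have -> : w *m newton_mx x nu lam k c2 y2 = v *m newton_mx x nu lam k c1 y *m J.
  by rewrite -vw -mulmxA -[RHS]mulmxA; congr (_ *m _); exact/esym/newton_mx_change.
rewrite [RHS]mxE; apply: eq_bigr => j _; congr (_ * _); exact: chart_fluxE A1 c1y Ev j.
Qed.

Lemma chart_volE c : A c -> forall B : set (borel S), measurable B -> B `<=` dom c ->
  vol B = lebesgue_int (fun y => (\1_(cod c `&` param c @^-1` B) y * `|chart_volume c y|)%:E).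
Proof.
move=> Ac B mB Bc; rewrite (rv Ac mB Bc); congr lebesgue_int; apply/funext => y.
congr (_%:E); rewrite indicE; have [/set_mem[cy _]|_] := boolP (y \in _ `&` _); last by rewrite !mul0r.
congr (_ * _); rewrite -sqrtr_sqr; congr Num.sqrt.
by rewrite /chart_volume (frame_volume_sqr (@Nc1 c) (XNc Ac) cy).
Qed.

Let chart_flux_C1 c : A c -> forall y, cod c y -> forall j, C1_at (chart_flux c j) y.
Proof.
move=> Ac y cy j; exact: (newton_flux_C1_at (@cod_open _ _ _ c) (sXc Ac) (sNc Ac)).
Qed.

Let chart_volume_C1 c : A c -> forall y, cod c y -> C1_at (chart_volume c) y.
Proof.
move=> Ac y cy; exact: (frame_volume_C1_at (@cod_open _ _ _ c) (sXc Ac) (sNc Ac)).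
Qed.

Let chart_volume_neq0 c : A c -> forall y, cod c y -> chart_volume c y != 0.
Proof. by move=> Ac y cy; exact: (frame_volume_neq0 (@Nc1 c) (XNc Ac) (Xcf Ac) cy). Qed.

Let chart_flux_div c : A c -> forall y, cod c y ->
  \sum_j 'D_(e j) (chart_flux c j) y = position_divergence (param c y) * chart_volume c y.
Proof.
move=> Ac y cy.
exact: (newton_flux_div (@cod_open _ _ _ c) (sXc Ac) (sNc Ac) (@Nc1 c) (XNc Ac) (Xcf Ac)
    (lamc Ac) kn cE cy).
Qed.

Definition position_flux_divergence : (S -> R) -> S -> R :=
  flux_divergence (manifold_covering mS) chart_flux chart_volume position_divergence.

Lemma position_finite_volume_nbhs (K : set S) : compact K ->
  exists W : set S, [/\ open W, K `<=` W & (vol W < +oo)%E].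
Proof.
exact: (@finite_volume_nbhs R n S A vol (manifold_covering mS) chart_volume chart_volume_C1 chart_volE).
Qed.

Lemma position_flux_divergence_integrable (psi : S -> R) (K : set S) : compact K ->
  chart_C1 A psi -> (forall p, ~ K p -> psi p = 0) ->
  vol.-integrable [set: borel S] (EFin \o position_flux_divergence psi).
Proof.
move=> cK Cpsi psi0; have [hS _ [covA smA]] := mS.
have [W [oW KW Wf]] := position_finite_volume_nbhs cK.
have [cG G0] := @flux_divergence_supported R n S A hS (manifold_covering mS) smA chart_flux
  chart_volume position_divergence chart_flux_C1 chart_volume_C1 chart_volume_neq0 chart_flux_div
  chart_flux_change psi K cK Cpsi psi0.
exact: continuous_integrable cK KW oW Wf cG G0.
Qed.

Lemma position_divergence_theorem (psi : S -> R) (K : set S) : compact K -> chart_C1 A psi ->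
  (forall p, ~ K p -> psi p = 0) -> \int[vol]_p position_flux_divergence psi p = 0.
Proof.
move=> cK Cpsi psi0; have [hS _ [covA smA]] := mS.
exact: (@divergence_theorem R n S A vol hS (manifold_covering mS) smA chart_flux chart_volume
  position_divergence chart_flux_C1 chart_volume_C1 chart_volume_neq0 chart_flux_div
  chart_flux_change chart_volE psi K cK Cpsi psi0).
Qed.

End Geometry.

Section QuarterSqnorm.
Context {R : realType} {m : nat}.

Lemma quarter_sqnormE (z : 'rV[R]_m) : quarter_sqnorm z = dot (2^-1 *: z) (2^-1 *: z).
Proof. by rewrite /quarter_sqnorm enorm_sqr dotZl dotZr; move: (dot _ _) => d; field. Qed.

Lemma is_derive_quarter_sqnorm (n : nat) (F : 'rV[R]_n -> 'rV[R]_m) y v :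
  (forall a, derivable (fun z => F z 0 a) y v) ->
  is_derive y v (fun z => quarter_sqnorm (F z)) (2^-1 * \sum_a F y 0 a * 'D_v (fun z => F z 0 a) y).
Proof.
move=> dF.
have H : is_derive y v (fun z => \sum_a F z 0 a * F z 0 a)
    (\sum_a (F y 0 a * 'D_v (fun z => F z 0 a) y + F y 0 a * 'D_v (fun z => F z 0 a) y)).
  by apply: is_derive_bigsum => a; have := derivableP (dF a) => d; exact: is_deriveM.
have := is_deriveZ 4^-1 H.
rewrite big_split /=; set s := \sum_a _ => {}H.
have -> : 2^-1 * s = 4^-1 *: (s + s).
  by rewrite -[RHS]/(_ * _); move: s {H} => s; field.
have -> // : (fun z => quarter_sqnorm (F z)) = 4^-1 \*: (fun z => \sum_a F z 0 a * F z 0 a).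
by apply/funext => z /=; rewrite /quarter_sqnorm enorm_sqr mulrC.
Qed.

Lemma gradient_quarter_sqnorm (z : 'rV[R]_m) : gradient (@quarter_sqnorm R m) z = 2^-1 *: z.
Proof.
apply/rowP => i; rewrite [LHS]mxE [RHS]mxE.
have D a : is_derive z (delta_mx 0 i : 'rV[R]_m) (fun y : 'rV[R]_m => y 0 a)
    ((delta_mx 0 i : 'rV[R]_m) 0 a).
  have d : derivable (fun y : 'rV[R]_m => y 0 a) z (delta_mx 0 i).
    by apply: C1_at_derivable; exact: C1_at_coord.
  split => //; have := derive_mx (@derivable_id R _ z (delta_mx 0 i : 'rV[R]_m)).
  by rewrite derive_id => /rowP /(_ a) ->; rewrite [RHS]mxE.
have dF a : derivable (fun y : 'rV[R]_m => y 0 a) z (delta_mx 0 i) by have [] := D a.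
rewrite (@derive_val _ _ _ _ _ _ _ (@is_derive_quarter_sqnorm m (fun y => y) z _ dF)).
congr (_ * _); rewrite (bigD1 i) //= big1 ?addr0.
  by rewrite (@derive_val _ _ _ _ _ _ _ (D i)) mxE !eqxx mulr1.
move=> a ai; rewrite (@derive_val _ _ _ _ _ _ _ (D a)) mxE (negbTE ai) andbF mulr0 //.
Qed.

Lemma quarter_sqnorm_ge0 (z : 'rV[R]_m) : 0 <= quarter_sqnorm z.
Proof. by rewrite quarter_sqnormE dot_ge0. Qed.

Lemma continuous_quarter_sqnorm : continuous (@quarter_sqnorm R m).
Proof.
move=> z; have -> : @quarter_sqnorm R m = fun y => (\sum_a y 0 a * y 0 a) * 4^-1.
  by apply/funext => y; rewrite /quarter_sqnorm enorm_sqr.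
apply: C1_at_continuous; apply: C1_atM; last exact: C1_at_cst.
by apply: C1_at_sum => a _; apply: C1_atM; exact: C1_at_coord.
Qed.

Lemma sublevel_compact (t : R) : compact [set z : 'rV[R]_m | quarter_sqnorm z <= t].
Proof.
apply: bounded_closed_compact.
  exists (`|4 * t| + 1); split; first exact: num_real.
  (* A bound [M > 1] avoids a square root: a coordinate larger than [M] would have square above [M],
     hence above [4 t]. *)
  move=> M tM z /= zt; have M1 : 1 < M by rewrite (le_lt_trans _ tM) // lerDr.
  have t4 : 4 * t < M by rewrite (le_lt_trans _ tM) // (le_trans (ler_norm _)) // lerDl.
  rewrite [leLHS]/Num.Def.normr/= mx_normrE (bigmax_le _ _) //=; first by rewrite ltW // (lt_trans _ M1).
  move=> [i a] _ /=; rewrite (ord1 i) leNgt; apply/negP => Mz.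
  have : z 0 a * z 0 a <= 4 * t.
    move: zt; rewrite /quarter_sqnorm enorm_sqr => zt.
    have : z 0 a * z 0 a <= dot z z.
      rewrite /dot (bigD1 a) //= lerDl; apply: sumr_ge0 => l _.
      by rewrite -expr2 sqr_ge0.
    move: (dot z z) (z 0 a * z 0 a) zt => d w; lra.
  rewrite -expr2 -real_normK ?num_real //.
  by move: (`|z 0 a|) Mz t4 M1 => w; nra.
apply: (closed_comp _ (@closed_le R t)) => z _.
exact: continuous_quarter_sqnorm.
Qed.

End QuarterSqnorm.

Section WeightedInequality.
Context {R : realType} {n k : nat} {S : ptopologicalType}.
Local Notation e i := (delta_mx 0 i : 'rV[R]_n).
Variables (A : set (chart R n S)) (x nu : S -> 'rV[R]_n.+1) (lam : S -> 'I_n -> R)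
  (vol : {measure set (borel S) -> \bar R}).
Hypotheses (kn : (k < n)%N) (mS : smooth_manifold A) (imm : immersion A x)
  (un : unit_normal A x nu) (pc : principal_curvatures A x nu lam)
  (rv : riemannian_volume A x vol) (px : proper_map x).
Variables (delta M1 M2 : R).
Hypotheses (delta0 : 0 < delta)
  (coe : forall c y, A c -> cod c y -> forall v : 'rV[R]_n,
    delta * enorm (v *m tangent_basis x c y) ^+ 2
      <= dot (v *m newton_mx x nu lam k c y *m tangent_basis x c y) (v *m tangent_basis x c y))
  (bH : forall p, enorm (normal_part (nu p) (gradient (@quarter_sqnorm R n.+1) (x p))) *
     enorm (curvature_vector x nu lam k (@quarter_sqnorm R n.+1) p) <= M1)
  (bsigma : forall p, `|sigma k (lam p)| <= M2).

Local Notation f := (fun p : S => quarter_sqnorm (x p)).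
Local Notation b := (height x nu).
Local Notation h := (@position_divergence R n k S x nu lam).

Let nu1 p : dot (nu p) (nu p) = 1 := normal_unit un p.

Let Tnu c y : A c -> cod c y -> forall i, dot (row i (tangent_basis x c y)) (nu (param c y)) = 0.
Proof. by move=> Ac cy i; case: un => _ _; apply. Qed.

(** As the gradient of [f] is [x / 2], both vectors are multiples of [nu], and the product of their
    norms is the absolute value on the left. *)
Lemma curvature_normal_bound p :
  `|b p * (b p * sigma k (lam p) - k.+1%:R * sigma k.+1 (lam p))| <= M1.
Proof.
apply: le_trans (bH p).
have nu_enorm : enorm (nu p) = 1 by case: un.
rewrite /curvature_vector /normal_part gradient_quarter_sqnorm -/(b p).
by rewrite scalerA -scalerBl !enormZ nu_enorm !mulr1 normrM [sigma k _ * _]mulrC.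
Qed.

(** Coercivity gives [n delta <= \tr P_k], and the trace is [(n - k) sigma_k]; dividing,
    [n / (n - k) >= 1]. *)
Lemma sigma_ge_delta p : delta <= sigma k (lam p).
Proof.
have [c Ac dp] := manifold_covering mS p.
have cy : cod c (coord c p) by exact: coord_cod.
have E := coordK dp; set y := coord c p in cy E.
have := @trace_coercive R n (nu (param c y)) (tangent_basis x c y) (nu1 _) (Tnu Ac cy) (imm.2 _ _ Ac cy)
  (newton_mx x nu lam k c y) delta.
rewrite newton_mxE (trace_newton (pc Ac cy) kn) E => H.
have {}H : n%:R * delta <= (n - k)%:R * sigma k (lam p).
  by apply: H => v; rewrite -enorm_sqr; have := coe Ac cy v; rewrite newton_mxE E.
have nk : 0 < (n - k)%:R :> R by rewrite ltr0n subn_gt0.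
rewrite -(ler_pM2l nk); apply: le_trans H; rewrite ler_pM2r // ler_nat; exact: leq_subr.
Qed.

Local Notation C0 := (2^-1 * (n%:R * M2) + M1).

(** Adding and subtracting [b^2 sigma_k] exhibits the bounded product of [curvature_normal_bound]
    and leaves [- b^2 sigma_k], which is at most [- delta b^2]. *)
Lemma position_divergence_le p : h p <= C0 - delta * b p ^+ 2.
Proof.
rewrite /position_divergence.
have := curvature_normal_bound p; have := sigma_ge_delta p; have := bsigma p.
have : (n - k)%:R <= n%:R :> R by rewrite ler_nat leq_subr.
have : 0 <= (n - k)%:R :> R by [].
move: (b p) (sigma k (lam p)) (k.+1%:R * sigma _ _) (n - k)%:R (n%:R) => bp s w N1 N2 N10 N12.
move=> /ler_normlP[s1 s2] ds /ler_normlP[w1 w2].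
have : N1 * s <= N2 * M2 by nra.
have : delta * bp ^+ 2 <= s * bp ^+ 2 by rewrite ler_wpM2r // sqr_ge0.
lra.
Qed.

Lemma chart_C1_position : chart_C1 A f.
Proof.
move=> c Ac y cy.
have -> : (fun z => quarter_sqnorm (x (param c z))) =
    (fun z => (\sum_a x (param c z) 0 a * x (param c z) 0 a) * 4^-1).
  by apply/funext => z; rewrite /quarter_sqnorm enorm_sqr.
apply: C1_atM; last exact: C1_at_cst.
by apply: C1_at_sum => a _; apply: C1_atM; exact: (coordinate_chart_C1 a imm.1 Ac).
Qed.

Lemma derive_position c y j : A c -> cod c y ->
  'D_(e j) (fun z => f (param c z)) y = dot (2^-1 *: x (param c y)) (row j (tangent_basis x c y)).
Proof.
move=> Ac cy.
have dx : differentiable (x \o param c) y.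
  exact: (Ck_on1_differentiable (@cod_open _ _ _ c) (imm.1 c Ac 1%N) cy).
have dF a : derivable (fun z => (x \o param c) z 0 a) y (e j).
  by apply: C1_at_derivable; exact: (coordinate_chart_C1 a imm.1 Ac).
rewrite (@derive_val _ _ _ _ _ _ _ (is_derive_quarter_sqnorm dF)) dotZl; congr (_ * _).
apply: eq_bigr => a _; congr (_ * _); rewrite [RHS]mxE.
exact: esym (jacobian_entry _ _ dx).
Qed.

Variables (Phi : R -> R) (theta T : R).
Hypotheses (dPhi : forall t, derivable Phi t 1) (cPhi : continuous (derive1 Phi))
  (Phi0 : forall t, 0 <= Phi t) (theta01 : 0 <= theta <= 1)
  (decPhi : forall t, 0 <= t -> derive1 Phi t <= - theta * Phi t)
  (PhiT : forall t, T <= t -> Phi t = 0).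

Let psi p := Phi (f p).

Lemma chart_C1_weight : chart_C1 A psi.
Proof. by move=> c Ac y cy; apply: C1_at_comp1 => //; exact: chart_C1_position. Qed.

Lemma sublevel_position_compact t : compact [set p : S | f p <= t].
Proof. exact: (px (@sublevel_compact R n.+1 t)). Qed.

Let psi0 p : ~ [set p : S | f p <= T] p -> psi p = 0.
Proof. by move=> /negP; rewrite -ltNge => /ltW /PhiT. Qed.

Local Notation flux_div := (@position_flux_divergence R n k S A x nu lam kn mS).

(** The derivative of [f] along the field is [<P_k Y0, Y0>], since the tangential gradient of [f] is
    [Y0]; it enters with the factor [Phi' (f)]. *)
Lemma flux_divergence_le p : flux_div psi p <= psi p * (C0 - delta * theta * f p).
Proof.
rewrite /position_flux_divergence /flux_divergence; set c := chart_at _ p; set y := coord c p.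
have Ac : A c := chart_at_atlas (manifold_covering mS) p.
have dp : dom c p := chart_at_dom (manifold_covering mS) p.
have cy : cod c y by exact: coord_cod.
have pE : param c y = p by exact: coordK.
have [v Ev] := tangent_decomposition imm un Ac cy.
set t := v *m tangent_basis x c y.
have tnu : dot t (nu (param c y)) = 0 by exact: (frame_tangent (Tnu Ac cy)).
have -> : flux_derivative (chart_flux x nu kn) (chart_volume x nu) c psi y =
    derive1 Phi (f p) * dot (v *m newton_mx x nu lam k c y *m tangent_basis x c y) t.
  rewrite /flux_derivative.
  have D j : 'D_(e j) (fun z => psi (param c z)) y =
      derive1 Phi (f p) * dot (row j (tangent_basis x c y)) t.
    rewrite /psi derive_comp1 //; last exact: C1_at_diff (chart_C1_position Ac cy).
    rewrite derive_position // pE; congr (_ * _); rewrite -pE Ev dotDl dotZl.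
    by rewrite [dot (nu _) _]dotC (Tnu Ac cy) mulr0 add0r dotC.
  under eq_bigr do rewrite D (chart_fluxE kn imm un pc Ac cy Ev) mulrCA.
  rewrite -mulr_sumr; congr (_ * _).
  rewrite (mulmx_sum_row _ (tangent_basis x c y)).
  rewrite (big_morph (fun u => dot u t) (id1 := 0) (op1 := +%R)); last 2 first.
  - by move=> u w; exact: dotDl.
  - by rewrite -(scale0r t) dotZl mul0r.
  by apply: eq_bigr => j _; rewrite dotZl.
have fE : f p = b p ^+ 2 + dot t t.
  rewrite quarter_sqnormE -pE Ev -/t !dotDl !dotDr !dotZl !dotZr nu1 tnu dotC tnu.
  by rewrite !mulr0 addr0 add0r mulr1 expr2.
have tt0 := dot_ge0 t.
have := coe Ac cy v; rewrite -/t enorm_sqr.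
have := decPhi (quarter_sqnorm_ge0 (x p)); rewrite -/(psi p).
have := position_divergence_le p.
move: (position_divergence _ _ _ _) (dot (v *m newton_mx _ _ _ _ _ _ *m _) t) => hp q hle.
rewrite fE => dec qt.
have psip : 0 <= psi p by exact: Phi0.
move: (derive1 Phi _ : R) (psi p) dec psip => P' P dec P0.
case/andP: theta01 => th0 th1.
(* Because [P' <= 0], the lower bound on [q] becomes an upper bound on the product. *)
have c1 : P' * q <= - theta * P * (delta * dot t t).
  apply: le_trans (_ : P' * (delta * dot t t) <= _).
    have P'0 : P' <= 0 by apply: (le_trans dec); rewrite mulNr oppr_le0 mulr_ge0.
    exact: (ler_wnM2l P'0).
  have d0 : 0 <= delta * dot t t by rewrite mulr_ge0 // ltW.
  exact: (ler_wpM2r d0).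
have c2 : P * hp <= P * (C0 - delta * b p ^+ 2) by rewrite ler_wpM2l.
(* The surplus given away when [delta b^2] is weakened to [delta theta b^2]. *)
have c3 : 0 <= (1 - theta) * (P * (delta * b p ^+ 2)).
  apply: mulr_ge0; first by rewrite subr_ge0.
  by apply: mulr_ge0 => //; apply: mulr_ge0; [exact: ltW|exact: sqr_ge0].
move: c1 c2 c3; move: C0 (dot t t) (b p) => C t2 bp; lra.
Qed.

Lemma continuous_position : continuous f.
Proof. exact: (@chart_C1_continuous R n S A (manifold_covering mS) _ chart_C1_position). Qed.

Lemma continuous_weight : continuous psi.
Proof. exact: (@chart_C1_continuous R n S A (manifold_covering mS) _ chart_C1_weight). Qed.

(** Properness makes the sublevel set of height [T] compact, so the weight is an admissible test
    function and its divergence integrates to zero. *)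
Lemma weighted_inequality : 0 <= \int[vol]_p (psi p * (C0 - delta * theta * f p)).
Proof.
have cK : compact [set p : S | f p <= T] := @sublevel_position_compact T.
have [W [oW KW Wf]] := position_finite_volume_nbhs mS imm un rv cK.
rewrite -(position_divergence_theorem kn mS imm un pc rv cK chart_C1_weight psi0).
apply: le_Rintegral => //; last by move=> p _; exact: flux_divergence_le.
  exact: (position_flux_divergence_integrable kn mS imm un pc rv cK chart_C1_weight psi0).
apply: (continuous_integrable cK KW oW Wf); last by move=> p /psi0 ->; rewrite mul0r.
move=> p; apply: cvgM; first exact: continuous_weight.
apply: cvgB; first exact: cvg_cst.
by apply: cvgM; [exact: cvg_cst|exact: continuous_position].
Qed.

End WeightedInequality.

(** * Volume growth *)

Section Cutoff.
Context {R : realType}.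
Variables (m : nat) (T : R).
Hypothesis T0 : 0 < T.

Definition cutoff (t : R) : R := sqpos (1 - t / T) ^+ m.+1.

Lemma is_derive_cutoff (t : R) : is_derive t (1 : R) cutoff
  (m.+1%:R * sqpos (1 - t / T) ^+ m * (2 * Num.max (1 - t / T) 0 * - T^-1)).
Proof.
have D1 : is_derive t (1 : R) (fun t : R => 1 - t / T) (- T^-1).
  have H : is_derive t (1 : R) (fun t : R => 1 - T^-1 * t) (0 - T^-1 * 1).
    exact: is_deriveB.
  rewrite -[- _]add0r -[X in 0 - X]mulr1.
  have -> // : (fun t : R => 1 - t / T) = (fun t : R => 1 - T^-1 * t).
  by apply/funext => u; rewrite mulrC.
have D2 := @is_derive1_comp R sqpos (fun t : R => 1 - t / T) t _ _ (is_derive_sqpos _) D1.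
have := is_deriveX m.+1 D2.
have -> // : (sqpos \o (fun t : R => 1 - t / T)) ^+ m.+1 = cutoff.
by apply/funext => u; rewrite fctE.
Qed.

Lemma derivable_cutoff (t : R) : derivable cutoff t 1.
Proof. by have [] := is_derive_cutoff t. Qed.

Lemma derive1_cutoff (t : R) : derive1 cutoff t =
  m.+1%:R * sqpos (1 - t / T) ^+ m * (2 * Num.max (1 - t / T) 0 * - T^-1).
Proof. by rewrite derive1E; exact: (@derive_val _ _ _ _ _ _ _ (is_derive_cutoff t)). Qed.

Lemma continuous_derive1_cutoff : continuous (derive1 cutoff).
Proof.
have -> : derive1 cutoff = fun t =>
    m.+1%:R * sqpos (1 - t / T) ^+ m * (2 * Num.max (1 - t / T) 0 * - T^-1).
  by apply/funext => t; exact: derive1_cutoff.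
have c1 : continuous (fun t : R => 1 - t / T).
  by move=> t; apply: cvgB; [exact: cvg_cst|apply: cvgM; [exact: cvg_id|exact: cvg_cst]].
have c2 : continuous (fun t : R => Num.max (1 - t / T) 0).
  by move=> t; apply: (@continuous_max _ R (fun t : R => 1 - t / T) (cst 0)); [exact: c1|exact: cvg_cst].
have c3 : continuous (fun t : R => sqpos (1 - t / T) ^+ m).
  have -> : (fun t : R => sqpos (1 - t / T) ^+ m) = (fun t : R => Num.max (1 - t / T) 0 ^+ (2 * m)).
    by apply/funext => t; rewrite exprM.
  move=> t; apply: (@continuous_comp _ _ _ _ (fun u : R => u ^+ (2 * m)) t (c2 t)).
  exact: exprn_continuous.
move=> t; apply: cvgM; apply: cvgM.
- exact: cvg_cst.
- exact: c3.
- by apply: cvgM; [exact: cvg_cst|exact: c2].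
- exact: cvg_cst.
Qed.

Lemma cutoff_ge0 t : 0 <= cutoff t.
Proof. by rewrite exprn_ge0 // sqpos_ge0. Qed.

Lemma cutoff_le1 t : 0 <= t -> cutoff t <= 1.
Proof.
move=> t0; rewrite exprn_ile1 ?sqpos_ge0 // /sqpos exprn_ile1 ?le_max ?lexx ?orbT //.
by rewrite ge_max ler01 andbT gerBl divr_ge0 // ltW.
Qed.

Lemma cutoff_eq0 t : T <= t -> cutoff t = 0.
Proof.
by move=> Tt; rewrite /cutoff sqpos_le0 ?expr0n // subr_le0 ler_pdivlMr // mul1r.
Qed.

Lemma cutoff_ge t : t <= T / 2 -> 4^-1 ^+ m.+1 <= cutoff t.
Proof.
move=> t2; apply: lerXn2r; rewrite ?nnegrE ?sqpos_ge0 ?invr_ge0 //.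
have h : 2^-1 <= 1 - t / T.
  by rewrite lerBrDr -lerBrDl ler_pdivrMr //; move: t2; lra.
rewrite /sqpos max_l; last by apply: le_trans h; rewrite invr_ge0.
have -> : 4^-1 = (2^-1 : R) ^+ 2 by rewrite expr2; field.
by apply: lerXn2r => //; rewrite nnegrE ?invr_ge0 // (le_trans _ h) // invr_ge0.
Qed.

(** With [q] the positive part of [1 - t / T], the derivative carries [q] to the power [2m + 1] and
    the cutoff to the power [2m + 2]; as [q <= 1], the former power dominates. *)
Lemma derive1_cutoff_le t : 0 <= t -> derive1 cutoff t <= - (2 * m.+1%:R / T) * cutoff t.
Proof.
move=> t0; rewrite derive1_cutoff /cutoff exprS; set q := Num.max _ _.
have q0 : 0 <= q by rewrite le_max lexx orbT.
have q1 : q <= 1 by rewrite ge_max ler01 andbT gerBl divr_ge0 // ltW.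
have -> : sqpos (1 - t / T) = q ^+ 2 by [].
set w := (q ^+ 2) ^+ m; have w0 : 0 <= w by rewrite exprn_ge0 // sqr_ge0.
have Ti : 0 <= T^-1 by rewrite invr_ge0 ltW.
rewrite !mulrN mulNr lerN2.
have -> : 2 * m.+1%:R / T * (q ^+ 2 * w) = (m.+1%:R * w * T^-1 * 2) * q ^+ 2.
  by move: (m.+1%:R : R) T^-1 w w0 {Ti} => a b c _; ring.
have -> : m.+1%:R * w * (2 * q * T^-1) = (m.+1%:R * w * T^-1 * 2) * q.
  by move: (m.+1%:R : R) T^-1 w w0 {Ti} => a b c _; ring.
apply: ler_wpM2l; first by rewrite !mulr_ge0.
by rewrite expr2 ler_piMl.
Qed.

End Cutoff.

Section Doubling.
Context {R : realType} {d : measure_display} {T : measurableType d}.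
Variables (mu : {measure set T -> \bar R}) (f : T -> R).
Hypotheses (mf : measurable_fun [set: T] f) (f0 : forall p, 0 <= f p).
Local Notation sublevel t := [set p : T | f p <= t].
Hypothesis fin : forall t, (mu (sublevel t) < +oo)%E.

Lemma measurable_sublevel t : measurable (sublevel t).
Proof.
have := measurable_fun_le (@measurableT _ T) mf (measurable_cst t).
by rewrite setTI.
Qed.

Let vol t : R := fine (mu (sublevel t)).

Let volE t : mu (sublevel t) = (vol t)%:E.
Proof. by rewrite fineK // ge0_fin_numE // fin. Qed.

Let indicR (B : set T) (p : T) : R := \1_B p.

Lemma indic_sublevel_integrable t : mu.-integrable [set: T] (EFin \o (indicR (sublevel t))).
Proof.
apply: (bounded_integrable (M := 1) (measurable_sublevel t) (fin t)).
- exact: measurable_indic (measurable_sublevel t).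
- by move=> p; rewrite ger0_norm // /indicR indicE; case: (_ \in _).
- by move=> p tp; rewrite /indicR indicE memNset.
Qed.

Lemma Rintegral_indic_sublevel t : \int[mu]_p indicR (sublevel t) p = vol t.
Proof. by rewrite /Rintegral integral_indic ?setIT //; exact: measurable_sublevel. Qed.

Variables (C0 delta : R).
Hypotheses (C00 : 0 < C0) (delta0 : 0 < delta).
Hypothesis W : forall (Phi : R -> R) (theta t : R),
  (forall s, derivable Phi s 1) -> continuous (derive1 Phi) -> (forall s, 0 <= Phi s) ->
  0 <= theta <= 1 -> (forall s, 0 <= s -> derive1 Phi s <= - theta * Phi s) ->
  (forall s, t <= s -> Phi s = 0) ->
  0 <= \int[mu]_p (Phi (f p) * (C0 - delta * theta * f p)).

Lemma volume_doubling : exists D t0 : R, [/\ 0 < D, 0 < t0 &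
  forall s : R, t0 <= s -> (mu (sublevel (2 * s)%R) <= D%:E * mu (sublevel s))%E].
Proof.
(* This choice gives [delta theta s >= 2 C0] for the cutoff at height [4 s], so that the integrand
   is at most [- C0] times the cutoff where [f > s]. *)
have [m mC] : exists m : nat, 4 * C0 <= delta * m.+1%:R.
  exists (Num.bound (4 * C0 / delta)); rewrite [leRHS]mulrC -ler_pdivrMr // ltW //.
  have q0 : 0 <= 4 * C0 / delta by apply: divr_ge0; [apply: mulr_ge0|]; exact: ltW.
  by apply: lt_le_trans (archi_boundP q0) _; rewrite ler_nat.
pose c : R := 4^-1 ^+ m.+1.
have c0 : 0 < c by rewrite exprn_gt0 // invr_gt0.
(* The number [c] bounds the cutoff below up to half its height, [2 s]; the threshold [m.+1] ensures
   [theta <= 1]. *)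
exists ((1 + c) / c), m.+1%:R; split => //; first by rewrite divr_gt0 // addr_gt0.
move=> s ms; have s0 : 0 < s by apply: lt_le_trans ms.
pose t := 4 * s; have t0 : 0 < t by rewrite mulr_gt0.
pose theta := 2 * m.+1%:R / t.
have th0 : 0 <= theta by rewrite divr_ge0 ?mulr_ge0 // ltW.
have th1 : theta <= 1 by rewrite ler_pdivrMr // mul1r /t; move: (m.+1%:R : R) ms s0 => u ms s0; lra.
have th01 : 0 <= theta <= 1 by rewrite th0 th1.
have W0 := W (@derivable_cutoff R m t) (@continuous_derive1_cutoff R m t) (@cutoff_ge0 R m t) th01
  (@derive1_cutoff_le R m t t0) (@cutoff_eq0 R m t t0).
rewrite !volE -EFinM lee_fin mulrAC ler_pdivlMr //.
(* On [f <= s] both indicators are 1 and the right side is [C0]; the extra [c] in the first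
   coefficient pays for the second indicator there. *)
have bound p : cutoff m t (f p) * (C0 - delta * theta * f p) <=
    C0 * (1 + c) * indicR (sublevel s) p - C0 * c * indicR (sublevel (2 * s)) p.
  have P0 := cutoff_ge0 m t (f p); have P1 := cutoff_le1 m t0 (f0 p).
  have dtf : 0 <= delta * theta * f p by apply: mulr_ge0 => //; apply: mulr_ge0 => //; exact: ltW.
  have cP s' : \1_(sublevel s') p = ((f p <= s')%R)%:R :> R.
    rewrite indicE; congr (nat_of_bool _)%:R.
    by apply/idP/idP => [/set_mem|ps]; [|exact: mem_set].
  rewrite /indicR !cP; have [ps|ps] := leP (f p) s.
    have -> : f p <= 2 * s by move: ps s0; lra.
    have : cutoff m t (f p) * (C0 - delta * theta * f p) <= C0.
      have := mulr_ge0 P0 dtf; have := ler_piMl (ltW C00) P1; rewrite mulrBr.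
      by move: (_ * C0) (_ * (_ * f p)) => u w; lra.
    by rewrite !mulr1; move: (_ * (_ - _)) => w; lra.
  have dm : 2 * C0 <= delta * theta * f p.
    apply: le_trans (_ : delta * theta * s <= _); last first.
      by apply: ler_wpM2l; [apply: mulr_ge0 => //|]; exact: ltW.
    have -> : delta * theta * s = delta * m.+1%:R / 2.
      by rewrite /theta /t; move: s0 (m.+1%:R : R) => s0 u; field; exact: lt0r_neq0.
    by move: mC; lra.
  have {dm} h : cutoff m t (f p) * (C0 - delta * theta * f p) <= - C0 * cutoff m t (f p).
    by rewrite mulrC; apply: ler_wpM2r => //; move: dm; lra.
  apply: le_trans h _; rewrite mulr0 sub0r mulNr lerN2 -mulrA; apply: ler_wpM2l; first exact: ltW.
  have [ps2|_] := leP (f p) (2 * s); last by rewrite mulr0.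
  by rewrite mulr1; apply: cutoff_ge => //; rewrite /t; move: ps2; lra.
have : 0 <= C0 * (1 + c) * vol s - C0 * c * vol (2 * s).
  have i1 := indic_sublevel_integrable s; have i2 := indic_sublevel_integrable (2 * s).
  have j1 : mu.-integrable [set: T] (EFin \o (fun p => C0 * (1 + c) * indicR (sublevel s) p)).
    exact: (@integrableZl _ _ _ _ _ _ _ _ i1).
  have j2 : mu.-integrable [set: T] (EFin \o (fun p => C0 * c * indicR (sublevel (2 * s)) p)).
    exact: (@integrableZl _ _ _ _ _ _ _ _ i2).
  rewrite -!Rintegral_indic_sublevel -!RintegralZl // -RintegralB //.
  apply: le_trans W0 _; apply: le_Rintegral => //; last exact: (integrableB _ j1 j2).
  apply: (bounded_integrable (M := C0 + delta * theta * t) (measurable_sublevel t) (fin t)).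
  - apply: measurable_funM.
      apply: (measurableT_comp _ mf); apply: continuous_measurable_fun => u.
      apply: differentiable_continuous; apply/derivable1_diffP; exact: derivable_cutoff.
    apply: measurable_funB; first exact: measurable_cst.
    by apply: measurable_funM; [exact: measurable_cst|].
  - move=> p; have [tp|tp] := leP t (f p).
      rewrite cutoff_eq0 // mul0r normr0; apply: addr_ge0; first exact: ltW.
      by apply: mulr_ge0; [apply: mulr_ge0 => //|]; exact: ltW.
    have P0 := cutoff_ge0 m t (f p); have P1 := cutoff_le1 m t0 (f0 p).
    rewrite normrM (ger0_norm P0); apply: le_trans (ler_piMl (normr_ge0 _) P1) _.
    have w0 : 0 <= delta * theta * f p by apply: mulr_ge0 => //; apply: mulr_ge0 => //; exact: ltW.
    have wt : delta * theta * f p <= delta * theta * t.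
      by apply: ler_wpM2l; [apply: mulr_ge0 => //|]; exact: ltW.
    by rewrite ler_norml; move: C00 w0 wt; lra.
  - by move=> p /negP; rewrite -ltNge => /ltW tp; rewrite cutoff_eq0 // mul0r.
move: (vol _) (vol _) => v2 v1; rewrite -!mulrA -mulrBr pmulr_rge0 //; lra.
Qed.

End Doubling.

Lemma dyadic_scale (R : realType) (u : R) : 1 <= u -> exists j : nat, 2 ^+ j <= u < 2 ^+ j.+1.
Proof.
move=> u1; have ex : exists j, u < 2 ^+ j.+1.
  by exists (Num.bound u); apply: upper_nthrootP; exact: leqnSn.
exists (ex_minn ex); case: ex_minnP => -[|j] uj jmin; first by rewrite expr0 u1.
by rewrite uj andbT leNgt; apply/negP => /jmin; rewrite ltnn.
Qed.

Section Growth.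
Context {R : realType} {d : measure_display} {T : measurableType d}.
Variables (mu : {measure set T -> \bar R}) (f : T -> R).
Hypotheses (mf : measurable_fun [set: T] f) (f0 : forall p, 0 <= f p).
Local Notation sublevel t := [set p : T | f p <= t].
Hypothesis fin : forall t, (mu (sublevel t) < +oo)%E.
Local Notation I := (\int[mu]_p (expR (- f p))%:E)%E.

Let msub t : measurable (sublevel t) := measurable_sublevel mf t.

Lemma le_sublevel s t : s <= t -> (mu (sublevel s) <= mu (sublevel t))%E.
Proof.
move=> st; apply: le_measure; rewrite ?inE //; try exact: msub.
by move=> p /= /le_trans; apply.
Qed.

Let measurable_exp : measurable_fun [set: T] (fun p => (expR (- f p))%:E).
Proof.
apply/measurable_EFinP; apply: (measurableT_comp (@measurable_expR R)).
exact: measurable_funN.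
Qed.

(** Markov's inequality: [exp (- f) >= exp (- t)] on the sublevel set. *)
Lemma sublevel_le_exp_integral t : (mu (sublevel t) <= (expR t)%:E * I)%E.
Proof.
have e0 : ((expR (- t))%:E * mu (sublevel t) <= I)%E.
  rewrite -(integral_cst _ (msub t)).
  apply: le_trans (_ : \int[mu]_(p in sublevel t) (expR (- f p))%:E <= _)%E.
    apply: ge0_le_integral => //.
    - by move=> p _; rewrite lee_fin expR_ge0.
    - exact: measurable_funS measurable_exp.
    - by move=> p /= pt; rewrite lee_fin ler_expR lerN2.
  by apply: ge0_subset_integral => // p _; rewrite lee_fin expR_ge0.
apply: le_trans (_ : (expR t)%:E * ((expR (- t))%:E * mu (sublevel t)) <= _)%E.
  by rewrite muleA -EFinM -expRD subrr expR0 mul1e.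
by apply: lee_pmul => //; rewrite ?mule_ge0 // lee_fin expR_ge0.
Qed.

Variables (D t0 : R).
Hypotheses (D0 : 0 < D) (t00 : 0 < t0) (dbl : forall s : R, t0 <= s ->
  (mu (sublevel (2 * s)%R) <= D%:E * mu (sublevel s))%E).

Let v0 : R := fine (mu (sublevel t0)).

Lemma dyadic_growth : exists k : nat, forall j : nat,
  (mu (sublevel (2 ^+ j * t0)%R) <= ((2 ^+ j) ^+ k)%:E * mu (sublevel t0))%E.
Proof.
exists (Num.bound D); set k := Num.bound D.
have Dk : D <= 2 ^+ k by apply: ltW; exact: upper_nthrootP.
elim=> [|j IH]; first by rewrite !expr0 expr1n mul1r mul1e.
have jt : t0 <= 2 ^+ j * t0 by rewrite ler_peMl ?exprn_ege1 ?ltW // ltr1n.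
rewrite exprS -mulrA; apply: le_trans (dbl jt) _.
apply: le_trans (_ : D%:E * (((2 ^+ j) ^+ k)%:E * mu (sublevel t0)) <= _)%E.
  by apply: lee_pmul => //; rewrite lee_fin ltW.
rewrite muleA -EFinM; apply: lee_pmul => //.
  by rewrite lee_fin mulr_ge0 ?exprn_ge0 // ltW.
by rewrite lee_fin exprMn ler_wpM2r // !exprn_ge0.
Qed.

Theorem exp_integral_finite : (I < +oo)%E.
Proof.
have [k kP] := dyadic_growth.
(* On the shell [2^(j-1) t0 < f <= 2^j t0] the exponential is at most [exp (- 2^j t0 / 2)].
   Subtracting 1 from [2^j] makes [w 0 = 1], as needed on the innermost set, where [f] is only known
   to be nonnegative. *)
pose w (j : nat) : R := expR (- ((2 ^+ j - 1) * (t0 / 2))).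
pose g (j : nat) (p : T) : \bar R := (w j * \1_(sublevel (2 ^+ j * t0)) p)%:E.
have g0 j p : (0 <= g j p)%E by rewrite lee_fin mulr_ge0 // expR_ge0.
have mg j : measurable_fun [set: T] (g j).
  apply/measurable_EFinP; apply: measurable_funM; first exact: measurable_cst.
  exact: measurable_indic.
have eg p : ((expR (- f p))%:E <= \sum_(0 <= j <oo) g j p)%E.
  have ex : exists j, f p <= 2 ^+ j * t0.
    exists (Num.bound (f p / t0)); rewrite -ler_pdivrMr // ltW //.
    exact: upper_nthrootP.
  have [j jp wj] : exists2 j, f p <= 2 ^+ j * t0 & expR (- f p) <= w j.
    exists (ex_minn ex); case: ex_minnP => // -[|j] jp jmin.
      by rewrite /w ler_expR expr0 subrr mul0r oppr0 oppr_le0.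
    have jf : 2 ^+ j * t0 < f p by rewrite ltNge; apply/negP => /jmin; rewrite ltnn.
    rewrite /w ler_expR lerN2 exprS; move: (2 ^+ j : R) jf => u jf.
    by move: t00 jf; move: (f p) (t0) => z s; lra.
  apply: le_trans (nneseries_lim_ge j.+1 (fun j _ _ => g0 j p)).
  rewrite big_nat_recr //=; apply: le_trans (_ : g j p <= _)%E.
    by rewrite /g indicE mem_set // mulr1 lee_fin.
  by rewrite leeDr // sume_ge0.
apply: (@le_lt_trans _ _ (\int[mu]_p (\sum_(0 <= j <oo) g j p))%E).
  apply: ge0_le_integral => //.
  by apply: (@ge0_emeasurable_sum _ _ _ _ g xpredT) => *; [exact: g0|exact: mg].
rewrite integral_nneseries //.
(* From [z ^+ k.+1 / k.+1! <= exp z] at [z = 2^j t0 / 2]. The exponent [k.+1] exceeds the growth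
   exponent by one, which leaves a factor [2^-j] and a geometric series. *)
pose K : R := expR (t0 / 2) * (k.+1)`!%:R * (2 / t0) ^+ k.+1 * v0.
have K0 : 0 <= K by rewrite !mulr_ge0 ?expR_ge0 ?exprn_ge0 ?divr_ge0 ?fine_ge0 // ltW.
apply: (@le_lt_trans _ _ (\sum_(0 <= j <oo) (K * 2 / (2 ^ j.+1)%:R)%:E)%E); last first.
  by apply: le_lt_trans (epsilon_trick0 xpredT _) (ltry _); rewrite mulr_ge0.
apply: lee_nneseries => [j _ _|j _]; first exact: integral_ge0.
have -> : (\int[mu]_p g j p = (w j)%:E * mu (sublevel (2 ^+ j * t0)%R))%E.
  under eq_integral do rewrite /g EFinM.
  rewrite ge0_integralZl //; first by rewrite integral_indic ?setIT.
  - by apply/measurable_EFinP; exact: measurable_indic.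
  - by rewrite lee_fin expR_ge0.
apply: le_trans (_ : (w j)%:E * (((2 ^+ j) ^+ k)%:E * v0%:E) <= _)%E.
  apply: lee_pmul => //; first by rewrite lee_fin expR_ge0.
  by rewrite /v0 fineK ?kP // ge0_fin_numE.
rewrite -!EFinM lee_fin natrX exprS.
have u0 : 0 < 2 ^+ j :> R by rewrite exprn_gt0.
move: u0; rewrite /w; move: (2 ^+ j : R) => u u0.
pose z := u * (t0 / 2).
have z0 : 0 <= z by rewrite mulr_ge0 ?divr_ge0 // ltW.
have zk : u ^+ k.+1 * expR (- z) <= (k.+1)`!%:R * (2 / t0) ^+ k.+1.
  have -> : u ^+ k.+1 = (2 / t0) ^+ k.+1 * z ^+ k.+1.
    by rewrite -exprMn /z; congr (_ ^+ _); field; rewrite lt0r_neq0.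
  rewrite -mulrA mulrC; apply: ler_wpM2r; first by rewrite exprn_ge0 // divr_ge0 // ltW.
  rewrite expRN ler_pdivrMr ?expR_gt0 // mulrC -ler_pdivrMr ?ltr0n ?fact_gt0 //.
  by apply: le_trans (expR_ge1Dxn k z0); rewrite lerDr.
have -> : - ((u - 1) * (t0 / 2)) = t0 / 2 - z by rewrite /z; ring.
have v00 : 0 <= v0 by rewrite fine_ge0.
have -> : K * 2 / (2 * u) = expR (t0 / 2) * ((k.+1)`!%:R * (2 / t0) ^+ k.+1) * v0 / u.
  by rewrite /K; move: (expR _) (_`!%:R) ((2 / t0) ^+ _) v0 => a b c v; field; rewrite lt0r_neq0.
rewrite ler_pdivlMr // expRD.
have -> : expR (t0 / 2) * expR (- z) * (u ^+ k * v0) * u =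
    expR (t0 / 2) * (u ^+ k.+1 * expR (- z)) * v0.
  by rewrite exprSr; move: (expR (t0 / 2)) (expR (- z)) (u ^+ k) v0 => a b c v; ring.
by apply: ler_wpM2r => //; apply: ler_wpM2l; first exact: expR_ge0.
Qed.

(** The prefactor has no slack at [s = 1], so small and large [s] are treated apart: Markov's
    inequality at height [s t0] below 2, dyadic growth from 2 on. *)
Theorem sublevel_power_bound : exists2 E : R, 0 <= E & forall s : R, 1 <= s ->
  (mu (sublevel (s * t0)%R) <= (expR t0 * s `^ E)%:E * I)%E.
Proof.
have [k kP] := dyadic_growth.
have I0 : (0 <= I)%E by apply: integral_ge0 => p _; rewrite lee_fin expR_ge0.
(* The term [2 t0] serves [s < 2], through [exp ((s - 1) t0) <= s^(2 t0)]; the term [2 k] serves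
   [s >= 2], where the next power of two is at most [s^2]. *)
exists (k.*2%:R + 2 * t0); first by rewrite addr_ge0 ?mulr_ge0 // ltW.
move=> s s1; have s0 : 0 < s by apply: lt_le_trans s1.
have [s2|s2] := ltP s 2.
  apply: le_trans (sublevel_le_exp_integral _) _; apply: lee_pmul => //.
  rewrite lee_fin; have -> : s * t0 = t0 + (s - 1) * t0 by ring.
  rewrite expRD; apply: ler_wpM2l; first exact: expR_ge0.
  apply: le_trans (_ : s `^ (2 * t0) <= _); last first.
    by apply: ler_powR => //; rewrite lerDr.
  (* [ln s >= 1 - 1/s >= (s - 1) / 2] for [1 <= s <= 2] *)
  rewrite /powR gt_eqF // ler_expR.
  have ls : 1 - s^-1 <= ln s.
    have := expR_ge1Dx (- ln s); rewrite expRN lnK ?posrE //.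
    by move: (ln s) (s^-1) => u v; lra.
  have : s - 1 <= 2 * ln s.
    apply: le_trans (_ : 2 * (1 - s^-1) <= _); last by rewrite ler_wpM2l.
    have -> : 2 * (1 - s^-1) = (2 / s) * (s - 1) by field; rewrite lt0r_neq0.
    by apply: ler_peMl; rewrite ?subr_ge0 // ler_pdivlMr // mul1r ltW.
  by rewrite [2 * t0]mulrC -mulrA; move: (ln s) => u su; rewrite mulrC; apply: ler_wpM2l; rewrite // ltW.
have [j /andP[sj sj1]] := dyadic_scale s1.
have j0 : (0 < j)%N by case: j sj1 {sj} => //; rewrite expr1 ltNge s2.
apply: le_trans (_ : mu (sublevel (2 ^+ j.+1 * t0)%R) <= _)%E.
  by apply: le_sublevel; rewrite ler_wpM2r // ltW.
apply: le_trans (kP j.+1) _.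
apply: le_trans (_ : ((2 ^+ j.+1) ^+ k)%:E * ((expR t0)%:E * I) <= _)%E.
  by apply: lee_pmul => //; exact: sublevel_le_exp_integral.
rewrite muleA -EFinM; apply: lee_pmul => //.
rewrite lee_fin mulrC; apply: ler_wpM2l; first exact: expR_ge0.
apply: le_trans (_ : s `^ k.*2%:R <= _); last first.
  by apply: ler_powR => //; rewrite lerDl mulr_ge0 // ltW.
rewrite (powR_mulrn _ (ltW s0)) -mul2n exprM.
apply: lerXn2r; rewrite ?nnegrE ?sqr_ge0 ?exprn_ge0 //.
apply: le_trans (_ : (2 ^+ j) ^+ 2 <= _); last first.
  by apply: lerXn2r; rewrite ?nnegrE ?exprn_ge0 ?(ltW s0).
by rewrite -exprM; apply: ler_weXn2l; [rewrite ler1n|rewrite muln2 -addnn -addn1 leq_add2l].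
Qed.

End Growth.

Theorem theorem1p2 (R : realType) (n k : nat) (Sigma : ptopologicalType)
    (A : set (chart R n Sigma)) (x nu : Sigma -> 'rV[R]_n.+1)
    (lam : Sigma -> 'I_n -> R) (vol : {measure set (borel Sigma) -> \bar R})
    (f := @quarter_sqnorm R n.+1)
    (H := curvature_vector x nu lam k f) :
  (k < n)%N ->
  smooth_manifold A ->
  connected [set: Sigma] ->
  orientable A ->
  immersion A x ->
  proper_map x ->
  unit_normal A x nu ->
  principal_curvatures A x nu lam ->
  riemannian_volume A x vol ->
  (exists M : R, forall p,
     enorm (normal_part (nu p) (gradient f (x p))) * enorm (H p) <= M) ->
  (exists M : R, forall p, `|sigma k (lam p)| <= M) ->
  coercive A x (newton_mx x nu lam k) ->
  [/\ (\int[vol]_p (expR (- f (x p)))%:E < +oo)%E,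
      polynomial_volume_growth x vol &
      exists beta a : R, [/\ 0 < beta, 0 <= a &
        forall r : R, Num.sqrt (2 * beta) <= r ->
          (vol (ext_ball x r) <=
             ((expR (beta / 2) * (2 * beta) `^ (- (a / beta)))%:E
                * \int[vol]_p (expR (- f (x p)))%:E)
             * (r `^ (2 * a / beta))%:E)%E]].
Proof.
move=> kn mS _ _ imm px un pc rv [M1 bH] [M2 bs] [delta delta0 coe].
(* The bounds are replaced by [|M1|] and [|M2| + 1] so that [C0] is strictly positive; [n > 0]
   because [k < n]. *)
have bH' p : enorm (normal_part (nu p) (gradient f (x p))) * enorm (H p) <= `|M1|.
  by apply: le_trans (bH p) _; exact: ler_norm.
have bs' p : `|sigma k (lam p)| <= `|M2| + 1.
  by apply: le_trans (bs p) _; rewrite (le_trans (ler_norm _)) // lerDl.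
set C0 := 2^-1 * (n%:R * (`|M2| + 1)) + `|M1|.
have C00 : 0 < C0.
  by rewrite ltr_pwDl // !mulr_gt0 ?invr_gt0 // ?ltr_wpDl // ltr0n (leq_trans _ kn).
have cf : continuous (fun p : Sigma => f (x p)) := @continuous_position _ _ _ _ _ mS imm.
have mf := continuous_borel_measurable cf.
have f0 p : 0 <= f (x p) := quarter_sqnorm_ge0 (x p).
have fin t : (vol [set p : Sigma | (f (x p) <= t)%R] < +oo)%E.
  have cK : compact [set p : Sigma | f (x p) <= t] := px _ (@sublevel_compact R n.+1 t).
  have [W [oW KW Wf]] := position_finite_volume_nbhs mS imm un rv cK.
  apply: le_lt_trans Wf; apply: le_measure => //; rewrite inE.
    exact: (measurable_sublevel mf).
  exact: borel_open.
have [D [t0 [D0 t00 dbl]]] := volume_doubling mf f0 fin C00 delta0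
  (fun Phi theta t d c p th dec z => weighted_inequality kn mS imm un pc rv px delta0 coe bH' bs'
     d c p th dec z).
have If := exp_integral_finite mf f0 fin D0 t00 dbl.
have [E E0 growth] := sublevel_power_bound mf D0 t00 dbl.
have ballE r : 0 <= r -> ext_ball x r = [set p : Sigma | f (x p) <= r ^+ 2 / 4].
  move=> r0; apply/seteqP; split => p /=; rewrite /ext_ball /= /f /quarter_sqnorm.
    by move=> xr; rewrite ler_pM2r // lerXn2r // nnegrE sqrtr_ge0.
  by rewrite ler_pM2r ?invr_gt0 // ler_sqr ?nnegrE // sqrtr_ge0.
have E2 : 2 * (E * (2 * t0)) / (2 * t0) = 2 * E.
  by field; rewrite lt0r_neq0.
(* Here [beta = 2 t0] and [a = E beta]. The ball of radius [r] is the sublevel set of height [s t0]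
   with [s = r^2 / (2 beta)], and [s >= 1] is the condition on [r]; the factor
   [(2 beta)^(- a / beta)] comes from [s^E]. *)
have bound r : Num.sqrt (2 * (2 * t0)) <= r -> (vol (ext_ball x r) <=
    ((expR (2 * t0 / 2) * (2 * (2 * t0)) `^ (- (E * (2 * t0) / (2 * t0))))%:E
       * \int[vol]_p (expR (- f (x p)))%:E) * (r `^ (2 * (E * (2 * t0)) / (2 * t0)))%:E)%E.
  move=> tr; have b0 : 0 < 2 * (2 * t0) by rewrite !mulr_gt0.
  have r0 : 0 <= r by rewrite (le_trans _ tr) // sqrtr_ge0.
  have r2 : 2 * (2 * t0) <= r ^+ 2.
    by rewrite -(sqr_sqrtr (ltW b0)) lerXn2r // ?nnegrE // sqrtr_ge0.
  have s1 : 1 <= r ^+ 2 / (2 * (2 * t0)) by rewrite ler_pdivlMr // mul1r.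
  rewrite ballE //; have -> : r ^+ 2 / 4 = r ^+ 2 / (2 * (2 * t0)) * t0.
    by field; rewrite lt0r_neq0.
  apply: le_trans (growth _ s1) _; rewrite muleAC -EFinM.
  suff -> : expR (2 * t0 / 2) * (2 * (2 * t0)) `^ (- (E * (2 * t0) / (2 * t0))) *
    r `^ (2 * (E * (2 * t0)) / (2 * t0)) = expR t0 * (r ^+ 2 / (2 * (2 * t0))) `^ E by [].
  have -> : 2 * t0 / 2 = t0 by field.
  rewrite E2; have -> : E * (2 * t0) / (2 * t0) = E by field; rewrite lt0r_neq0.
  rewrite -mulrA; congr (_ * _); rewrite [RHS]powRM ?sqr_ge0 ?invr_ge0 ?ltW //.
  rewrite [LHS]mulrC; congr (_ * _); first by rewrite powRrM powR_mulrn.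
  by rewrite -powR_inv1 ?ltW // -powRrM mulN1r.
split => //.
- exists (fine (((expR (2 * t0 / 2) * (2 * (2 * t0)) `^ (- (E * (2 * t0) / (2 * t0))))%:E
       * \int[vol]_p (expR (- f (x p)))%:E))), (2 * E); split.
  + rewrite fine_ge0 // mule_ge0 ?lee_fin ?mulr_ge0 ?expR_ge0 ?powR_ge0 //.
    by apply: integral_ge0 => p _; rewrite lee_fin expR_ge0.
  + by rewrite mulr_ge0.
  + near=> r; apply: le_trans (bound r _) _.
      by near: r; exact: nbhs_pinfty_ge.
    rewrite E2 [leRHS]EFinM fineK // fin_numM // ge0_fin_numE //.
    by apply: integral_ge0 => p _; rewrite lee_fin expR_ge0.
- exists (2 * t0), (E * (2 * t0)); split => //; first by rewrite mulr_gt0.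
  by rewrite mulr_ge0 // mulr_ge0 // ltW.
Unshelve. all: by end_near. Qed.
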